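(* For all $x\in\mathbb{C}\setminus\{0\}$ and $t\in\mathbb{C}$ we have $$\prod_{k\in\mathbb{Z}}\left(1-\frac{t}{W_k(x)}\right)=e^{-t/2}-\frac{t}{x}e^{t/2}\;.$$
   Context: Lambert branches: $\log$ is the principal determination of the logarithm (imaginary part in $]-\pi,\pi]$). For $z\in\mathbb{C}\setminus\{0\}$ and $k\in\mathbb{Z}$, if $z\notin[-1/e,0[$ or $k\notin\{0,-1\}$, then $W_k(z)$ is the unique complex solution $w$ of $w+\log(w)=\log(z)+2k\pi i$; if $z\in[-1/e,0[$, then $W_{-1}(z)$ and $W_0(z)$ are the real solutions of $we^w=z$ characterized by $W_{-1}(z)\le -1\le W_0(z)$ (equal when $z=-1/e$). A product over $k\in\mathbb{Z}$ is understood as the limit as $K\to\infty$ of the product over $-K\le k\le K$. *)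

(* Defs.v *)
From Stdlib Require Import Reals ZArith Lra ClassicalEpsilon.
From Coquelicot Require Import Coquelicot.

Open Scope C_scope.

Definition Cexp (z : C) : C :=
  (exp (Re z) * cos (Im z), exp (Re z) * sin (Im z))%R.

(* The branch [Im z = 0] falls under [acos], so negative reals have argument
   [PI].  The value at [0] is meaningless. *)
Definition Carg (z : C) : R :=
  if Rle_dec 0 (Im z) then acos (Re z / Cmod z) else (- acos (Re z / Cmod z))%R.

Definition Clog (z : C) : C := (ln (Cmod z), Carg z).

Lemma Clog_principal (z : C) :
  z <> 0 -> Cexp (Clog z) = z /\ (- PI < Im (Clog z) <= PI)%R.
Proof.
intros Hz.
assert (Hm : (0 < Cmod z)%R) by now apply Cmod_gt_0.
destruct z as [a b].
assert (Hsq : (Cmod (a, b) * Cmod (a, b) = a * a + b * b)%R).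
{ unfold Cmod; simpl; rewrite sqrt_sqrt by nra; ring. }
unfold Cexp, Clog, Carg; simpl in *.
rewrite exp_ln by assumption.
set (m := Cmod (a, b)) in *.
assert (Hq : (a / m * m = a)%R) by (field; lra).
set (q := (a / m)%R) in *.
assert (Hq2 : (q * q <= 1)%R).
{ assert (0 <= (1 - q * q) * (m * m))%R by
    (replace ((1 - q * q) * (m * m))%R with (m * m - (q * m) * (q * m))%R by ring;
     rewrite Hq; nra).
  assert (0 < m * m)%R by nra; nra. }
assert (Hb1 : (-1 <= q <= 1)%R) by (split; nra).
assert (Hs : (m * sqrt (1 - Rsqr q) = Rabs b)%R).
{ rewrite <- (sqrt_Rsqr m) at 1 by lra.
  rewrite <- sqrt_mult by (unfold Rsqr; nra).
  rewrite <- sqrt_Rsqr_abs; f_equal; unfold Rsqr.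
  replace (m * m * (1 - q * q))%R with (m * m - (q * m) * (q * m))%R by ring.
  rewrite Hq; lra. }
pose proof (acos_bound q) as Ha.
pose proof (cos_acos q Hb1) as Hc.
pose proof (sin_acos q Hb1) as Hsin.
destruct (Rle_dec 0 b) as [Hb | Hb].
- rewrite Hc, Hsin, Hs, Rabs_pos_eq by lra.
  split; [f_equal; lra | pose proof PI_RGT_0; lra].
- rewrite cos_neg, sin_neg, Hc, Hsin.
  replace (m * - sqrt (1 - q²))%R with (- (m * sqrt (1 - q²)))%R by ring.
  rewrite Hs, Rabs_left by lra.
  split; [f_equal; lra |].
  split; [| pose proof PI_RGT_0; lra].
  destruct (Req_dec (acos q) PI) as [E | E]; [exfalso | lra].
  rewrite E, sin_PI in Hsin.
  rewrite <- Hsin, Rmult_0_r, Rabs_left in Hs; lra.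
Qed.

(* z is in [-1/e, 0[ *)
Definition in_cut (z : C) : Prop :=
  Im z = 0%R /\ (- (1 / exp 1) <= Re z < 0)%R.

(* The conjunct [w <> 0] is there because [Clog] is total. *)
Definition is_LambertW (k : Z) (z w : C) : Prop :=
  ((~ in_cut z \/ ~ (k = 0%Z \/ k = (-1)%Z)) /\
     w <> 0 /\ w + Clog w = Clog z + 2 * RtoC (IZR k) * RtoC PI * Ci)
  \/ (in_cut z /\ k = (-1)%Z /\
        Im w = 0%R /\ w * Cexp w = z /\ (Re w <= -1)%R)
  \/ (in_cut z /\ k = 0%Z /\
        Im w = 0%R /\ w * Cexp w = z /\ (-1 <= Re w)%R).

(* Definite description; the value is meaningful for [z <> 0] only. *)
Definition LambertW (k : Z) (z : C) : C :=
  epsilon (inhabits (RtoC 0)) (unique (is_LambertW k z)).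

(* Product of [a k] over [-K <= k <= K]. *)
Fixpoint Cprod_sym (a : Z -> C) (K : nat) : C :=
  match K with
  | O => a 0%Z
  | S K' => a (- Z.of_nat K)%Z * Cprod_sym a K' * a (Z.of_nat K)
  end.

Definition is_prod_Z (a : Z -> C) (l : C) : Prop :=
  filterlim (Cprod_sym a) eventually (locally l).

(* Main.v *)
Require Import Defs.
From Stdlib Require Import Reals ZArith.
From Coquelicot Require Import Coquelicot.
From Stdlib Require Import Lra Lia List ClassicalEpsilon Ranalysis5.
Import ListNotations.

Open Scope C_scope.

(** The right-hand side [f t = exp (- t/2) - (t/x) exp (t/2)] takes the value [1] at
    [0] and vanishes exactly where [t exp t = x], that is at the [W_k x].  To see
    that it is the product over its zeros, one follows Euler's treatment of the
    sine: no complex analysis enters, only polynomials and a passage to the limit.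

    For [n = 2m + 1] let [P t = (1 - t/(2n))^n - (t/x) (1 + t/(2n))^(n-1)], which
    tends to [f t], has value [1] at [0] and degree at most [n].  Under the
    substitutions [1/t = 1/T - 1/(2n)] and [T = n (1 - exp (- s/n))] its roots
    are given by [s + log (T s) = log x + 2 k PI i], the equation of [W_k x] with
    [T s] in place of [s].  For [K < |k| <= m], with [K] independent of [n], the map
    [s |-> log x + 2 k PI i - log (T s)] is a contraction of a disc centred at
    [2 k PI i] ([tame_euler_map], [branch_point_exists]).  This locates [2 (m - K)]
    distinct roots of [P], and the root of index [k] tends to [W_k x]
    ([inv_root_cvg]).

    The logarithm shifts the [s] of index [k] by [O(ln |k|)] only, and for the
    unshifted centres the inverses of the roots of index [k] and [- k] are opposite.
    Hence the product of the two factors of index [k] and [- k] is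
    [1 + O(k^(-3/2))] uniformly in [n] ([inv_root_pair_factor]), and the factors with
    [|k| > J] contribute a factor of [P] that is uniformly close to [1]
    ([tail_product_bound]).

    What is left of [P] is a polynomial of degree at most [2 K + 1].  It tends to
    [0] at the [2 K + 1] numbers [W_k x], [|k| <= K], and is [1] at [0]; as its
    degree is fixed, it converges to the product over these numbers
    ([poly_cvg_lin_prod]).  Combining the two parts gives the theorem
    ([product_limit]).

    Two points need separate care.  That every [W_k x] exists and is unique comes
    from the curves [Im (w + log w) = beta], along which [Re (w + log w)] is a
    monotone function of [Im w] ([curve_re_incr]).  And at [x = -1/e], where
    [W_0 x = W_(-1) x], the limit has a double zero: there the parameter of the
    approximant is made to depend on [n], so that [P] has an exact double root
    ([approx_double_root]). *)

Ltac C_ext := apply injective_projections; unfold Re, Im; simpl; ring.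

(** * The complex exponential and the principal logarithm *)

Lemma Cmod_le_sum (z : C) : (Cmod z <= Rabs (Re z) + Rabs (Im z))%R.
Proof.
assert (H : z = RtoC (Re z) + Ci * RtoC (Im z)).
{ destruct z; C_ext. }
rewrite H at 1.
eapply Rle_trans; [apply Cmod_triangle |].
rewrite Cmod_mult, Cmod_Ci, !Cmod_R; lra.
Qed.

Lemma im_le_Cmod (z : C) : (Rabs (Im z) <= Cmod z)%R.
Proof.
eapply Rle_trans; [| apply Rmax_Cmod]; apply Rmax_r.
Qed.

Lemma Cmod_minus_ge (a b : C) : (Cmod a - Cmod b <= Cmod (a - b))%R.
Proof.
pose proof (Cmod_triangle (a - b) b).
replace (a - b + b) with a in H by ring; lra.
Qed.

Lemma Cmod_minus_sym (a b : C) : Cmod (a - b) = Cmod (b - a).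
Proof. rewrite <- Cmod_opp; f_equal; ring. Qed.

Lemma Cmod_minus_le (a b : C) : (Cmod (a - b) <= Cmod a + Cmod b)%R.
Proof.
unfold Cminus; eapply Rle_trans; [apply Cmod_triangle |].
rewrite Cmod_opp; lra.
Qed.

Lemma Cexp_0 : Cexp 0 = 1.
Proof.
unfold Cexp; simpl; rewrite exp_0, cos_0, sin_0.
C_ext.
Qed.

Lemma Cexp_plus (z w : C) : Cexp (z + w) = Cexp z * Cexp w.
Proof.
unfold Cexp; simpl; rewrite exp_plus, cos_plus, sin_plus.
C_ext.
Qed.

Lemma Cmod_Cexp (z : C) : Cmod (Cexp z) = exp (Re z).
Proof.
unfold Cmod, Cexp; simpl.
replace (_ + _)%R with ((exp (Re z))² * ((sin (Im z))² + (cos (Im z))²))%R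
  by (unfold Rsqr; ring).
rewrite sin2_cos2, Rmult_1_r, sqrt_Rsqr; [reflexivity | left; apply exp_pos].
Qed.

Lemma Cexp_nz (z : C) : Cexp z <> 0.
Proof. apply Cmod_gt_0; rewrite Cmod_Cexp; apply exp_pos. Qed.

Lemma Cexp_opp (z : C) : Cexp (- z) = / Cexp z.
Proof.
assert (H : Cexp (- z) * Cexp z = 1).
{ rewrite <- Cexp_plus, <- Cexp_0; f_equal; ring. }
rewrite <- (Cmult_1_r (/ Cexp z)), <- H; field; apply Cexp_nz.
Qed.

Lemma Cexp_R (a : R) : Cexp (RtoC a) = RtoC (exp a).
Proof. unfold Cexp; simpl; rewrite sin_0, cos_0; C_ext. Qed.

Lemma Cexp_conj (z : C) : Cexp (Cconj z) = Cconj (Cexp z).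
Proof.
unfold Cexp, Cconj; simpl; rewrite cos_neg, sin_neg.
C_ext.
Qed.

Lemma Cexp_INR_mult (n : nat) (z : C) : Cexp (RtoC (INR n) * z) = Cexp z ^ n.
Proof.
induction n as [|n IH].
- simpl; rewrite <- Cexp_0; f_equal; ring.
- rewrite S_INR, Cpow_S, <- IH, <- Cexp_plus; f_equal.
  rewrite RtoC_plus; ring.
Qed.

Definition turn (k : Z) : C := 2 * RtoC (IZR k) * RtoC PI * Ci.

Lemma turn_pair (k : Z) : turn k = (0, 2 * IZR k * PI)%R.
Proof. unfold turn; C_ext. Qed.

Lemma Cexp_turn (k : Z) : Cexp (turn k) = 1.
Proof.
rewrite turn_pair; unfold Cexp; simpl.
replace (2 * IZR k * PI)%R with (0 + 2 * IZR k * PI)%R by ring.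
assert (Hc : (cos (0 + 2 * IZR k * PI) = 1)%R /\ (sin (0 + 2 * IZR k * PI) = 0)%R).
{ destruct (Z_le_gt_dec 0 k) as [Hk | Hk].
  - rewrite <- (Z2Nat.id k Hk), <- INR_IZR_INZ.
    rewrite cos_period, sin_period, cos_0, sin_0; lra.
  - assert (Hk' : (0 <= - k)%Z) by lia.
    replace (IZR k) with (- IZR (- k))%R by (rewrite opp_IZR; ring).
    rewrite <- (Z2Nat.id _ Hk'), <- INR_IZR_INZ.
    replace (0 + 2 * - INR (Z.to_nat (- k)) * PI)%R
      with (- (0 + 2 * INR (Z.to_nat (- k)) * PI))%R by ring.
    rewrite cos_neg, sin_neg, cos_period, sin_period, cos_0, sin_0; lra. }
destruct Hc as [-> ->].
rewrite exp_0; C_ext.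
Qed.

Lemma Cexp_eq_1 (z : C) :
  Cexp z = 1 -> exists k : Z, z = turn k.
Proof.
intros H.
assert (Hre : Re z = 0%R).
{ assert (E : exp (Re z) = 1%R) by (rewrite <- Cmod_Cexp, H; apply Cmod_1).
  rewrite <- exp_0 in E; now apply exp_inv. }
assert (Hs : sin (Im z) = 0%R /\ cos (Im z) = 1%R).
{ unfold Cexp in H; rewrite Hre, exp_0 in H; injection H; intros; lra. }
destruct Hs as [Hs Hc].
destruct (sin_eq_0_0 _ Hs) as [j Hj].
destruct (Zeven_odd_dec j) as [He | Ho].
- apply Zeven_ex in He; destruct He as [m ->].
  exists m; rewrite turn_pair; rewrite mult_IZR in Hj.
  apply injective_projections; [exact Hre | exact Hj].
- exfalso.
  apply Zodd_ex in Ho; destruct Ho as [m ->].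
  pose proof (Cexp_turn m) as E.
  rewrite turn_pair in E; unfold Cexp in E; simpl in E; rewrite exp_0 in E.
  injection E as E1 E2.
  rewrite Hj, plus_IZR, mult_IZR in Hc.
  replace ((2 * IZR m + 1) * PI)%R with (2 * IZR m * PI + PI)%R in Hc by ring.
  rewrite neg_cos in Hc.
  lra.
Qed.

Lemma Cexp_Clog (z : C) : z <> 0 -> Cexp (Clog z) = z.
Proof. intros Hz; apply (Clog_principal z Hz). Qed.

Lemma Im_Clog_bounds (z : C) : z <> 0 -> (- PI < Im (Clog z) <= PI)%R.
Proof. intros Hz; apply (Clog_principal z Hz). Qed.

(** Two logarithms of the same number differ by a multiple of [2 PI i], and the
    half-open strip of width [2 PI] contains only one of them. *)
Lemma Clog_unique (z w : C) :
  z <> 0 -> Cexp w = z -> (- PI < Im w <= PI)%R -> Clog z = w.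
Proof.
intros Hz Hw Hi.
assert (E : Cexp (Clog z - w) = 1).
{ unfold Cminus; rewrite Cexp_plus, Cexp_opp, Cexp_Clog, Hw by assumption.
  now field. }
destruct (Cexp_eq_1 _ E) as [k Hk].
pose proof (Im_Clog_bounds z Hz) as Hl.
pose proof PI_RGT_0.
assert (Him : (Im (Clog z) - Im w = 2 * IZR k * PI)%R).
{ rewrite turn_pair in Hk; apply (f_equal Im) in Hk; unfold Im in *; simpl in *; lra. }
assert (k = 0%Z).
{ assert (-1 < IZR k < 1)%R by nra.
  assert (-1 < k < 1)%Z by (split; apply lt_IZR; lra).
  lia. }
subst k.
replace (Clog z) with (Clog z - w + w) by ring.
rewrite Hk; unfold turn; ring.
Qed.

(** * Elementary bounds *)

Lemma exp_le (x y : R) : (x <= y)%R -> (exp x <= exp y)%R.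
Proof.
intros [H | ->]; [left; now apply exp_increasing | right; reflexivity].
Qed.

Lemma sin_sqr_le (v : R) : (sin v * sin v <= v * v)%R.
Proof.
assert (Hp : forall u, (0 < u)%R -> (sin u * sin u <= u * u)%R).
{ intros u Hu; pose proof (sin_lt_x u Hu).
  destruct (Rle_dec u 1).
  - pose proof (sin_ge_0 u ltac:(lra) ltac:(pose proof PI2_1; lra)); nra.
  - pose proof (SIN_bound u); nra. }
destruct (Rtotal_order v 0) as [H | [-> | H]].
- pose proof (Hp (- v)%R ltac:(lra)) as H'; rewrite sin_neg in H'; lra.
- rewrite sin_0; lra.
- now apply Hp.
Qed.

Lemma cos_lower (b : R) : (1 - b * b / 2 <= cos b)%R.
Proof.
replace b with (2 * (b / 2))%R at 3 by field.
rewrite cos_2a_sin; pose proof (sin_sqr_le (b / 2)); lra.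
Qed.

Lemma sin_minus_id_bound (y : R) : (Rabs y <= 1)%R -> (Rabs (sin y - y) <= y * y)%R.
Proof.
assert (H : forall u, (0 < u <= 1)%R -> (Rabs (sin u - u) <= u * u)%R).
{ intros u Hu.
  destruct (MVT_cor2 sin cos 0 u ltac:(lra)) as [c [E Hc]];
    [intros; apply derivable_pt_lim_sin |].
  rewrite sin_0 in E.
  pose proof (cos_lower c); pose proof (COS_bound c).
  apply Rabs_le; nra. }
intros Hy.
destruct (Rtotal_order y 0) as [Hn | [-> | Hp]].
- rewrite Rabs_left in Hy by exact Hn.
  pose proof (H (- y)%R ltac:(lra)) as H'; rewrite sin_neg in H'.
  replace (- sin y - - y)%R with (- (sin y - y))%R in H' by ring.
  rewrite Rabs_Ropp in H'; lra.
- rewrite sin_0, Rminus_0_r, Rabs_R0; lra.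
- rewrite Rabs_pos_eq in Hy by lra; apply H; lra.
Qed.

Lemma exp_Re_le (z : C) : (exp (Re z) <= exp (Cmod z))%R.
Proof.
apply exp_le; eapply Rle_trans; [apply Rle_abs | apply re_le_Cmod].
Qed.

(** The factor [exp (Cmod z)] keeps the bound valid for all [z]; only small [z] and
    differences of close points are met below. *)
Lemma Cexp_minus_1_bound (z : C) :
  (Cmod (Cexp z - 1) <= 2 * Cmod z * exp (Cmod z))%R.
Proof.
assert (Hcos : forall y, (Cmod (Cexp (0, y)%R - 1) <= Rabs y)%R).
{ intros y.
  unfold Cmod, Cexp; simpl; rewrite exp_0.
  replace (_ + _)%R with ((sin y)² + (cos y)² + 1 - 2 * cos y)%R
    by (unfold Rsqr; ring).
  rewrite sin2_cos2, <- sqrt_Rsqr_abs; apply sqrt_le_1_alt.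
  unfold Rsqr; pose proof (cos_lower y); lra. }
assert (Hexp : (Rabs (exp (Re z) - 1) <= Rabs (Re z) * exp (Cmod z))%R).
{ pose proof (exp_Re_le z) as H6.
  set (x := Re z) in *.
  pose proof (exp_ineq1_le x) as H1.
  pose proof (exp_ineq1_le (- x)) as H2.
  pose proof (exp_pos x) as H3.
  assert (H4 : (exp x * exp (- x) = 1)%R) by (rewrite <- exp_plus, Rplus_opp_r; apply exp_0).
  assert (H5 : (1 <= exp (Cmod z))%R).
  { pose proof (exp_ineq1_le (Cmod z)); pose proof (Cmod_ge_0 z); lra. }
  destruct (Rle_dec 0 x).
  - rewrite !Rabs_pos_eq by lra; nra.
  - rewrite Rabs_left1 by nra; rewrite Rabs_left by lra.
    nra. }
assert (E : z = RtoC (Re z) + (0, Im z)%R)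
  by (destruct z; C_ext).
assert (E2 : Cexp z - 1 = RtoC (exp (Re z)) * (Cexp (0, Im z)%R - 1) + RtoC (exp (Re z) - 1)).
{ rewrite E at 1; rewrite Cexp_plus, Cexp_R, RtoC_minus; ring. }
rewrite E2.
eapply Rle_trans; [apply Cmod_triangle |].
rewrite Cmod_mult, !Cmod_R, (Rabs_pos_eq (exp _)) by (left; apply exp_pos).
specialize (Hcos (Im z)).
pose proof (re_le_Cmod z); pose proof (im_le_Cmod z).
pose proof (exp_Re_le z).
pose proof (exp_pos (Re z)).
pose proof (Cmod_ge_0 (Cexp (0, Im z)%R - 1)).
assert (exp (Re z) * Cmod (Cexp (0, Im z)%R - 1) <= exp (Cmod z) * Cmod z)%R
  by (apply Rmult_le_compat; lra).
assert (Rabs (Re z) * exp (Cmod z) <= Cmod z * exp (Cmod z))%R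
  by (apply Rmult_le_compat_r; [left; apply exp_pos | lra]).
lra.
Qed.

(** * Limits of complex sequences *)

Definition Ccvg (u : nat -> C) (l : C) : Prop :=
  is_lim_seq (fun n => Cmod (u n - l)) 0.

Lemma is_lim_seq_0_le (u v : nat -> R) :
  eventually (fun n => 0 <= u n <= v n)%R -> is_lim_seq v 0 -> is_lim_seq u 0.
Proof.
intros H Hv.
apply is_lim_seq_le_le_loc with (fun _ => 0%R) v; [exact H | | exact Hv].
apply is_lim_seq_const.
Qed.

Lemma is_lim_seq_scal_0 (u : nat -> R) (c : R) :
  is_lim_seq u 0 -> is_lim_seq (fun n => c * u n)%R 0.
Proof.
intros H; replace (Finite 0) with (Rbar_mult c (Finite 0)) by (simpl; f_equal; ring).
now apply is_lim_seq_scal_l.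
Qed.

Lemma is_lim_seq_inv_p_infty (u : nat -> R) :
  is_lim_seq u p_infty -> is_lim_seq (fun n => / u n)%R 0.
Proof.
intros H; replace (Finite 0) with (Rbar_inv p_infty) by reflexivity.
apply is_lim_seq_inv; [exact H | discriminate].
Qed.

Lemma Ccvg_le (u : nat -> C) (l : C) (v : nat -> R) :
  eventually (fun n => Cmod (u n - l) <= v n)%R -> is_lim_seq v 0 -> Ccvg u l.
Proof.
intros H Hv; apply is_lim_seq_0_le with v; [| exact Hv].
revert H; apply filter_imp; intros n Hn; split; [apply Cmod_ge_0 | exact Hn].
Qed.

Lemma Ccvg_const (c : C) : Ccvg (fun _ => c) c.
Proof.
apply is_lim_seq_ext with (fun _ => 0%R); [| apply is_lim_seq_const].
intros n; replace (c - c) with (RtoC 0) by ring; now rewrite Cmod_0.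
Qed.

Lemma Ccvg_eq (u : nat -> C) (a b : C) : a = b -> Ccvg u a -> Ccvg u b.
Proof. now intros ->. Qed.

Lemma Ccvg_ext_loc (u v : nat -> C) (l : C) :
  eventually (fun n => u n = v n) -> Ccvg u l -> Ccvg v l.
Proof.
intros H Hu; apply is_lim_seq_ext_loc with (fun n => Cmod (u n - l)); [| exact Hu].
revert H; apply filter_imp; intros n ->; reflexivity.
Qed.

Lemma Ccvg_ext (u v : nat -> C) (l : C) :
  (forall n, u n = v n) -> Ccvg u l -> Ccvg v l.
Proof. intros H; apply Ccvg_ext_loc; now apply filter_forall. Qed.

Lemma Ccvg_plus (u v : nat -> C) (a b : C) :
  Ccvg u a -> Ccvg v b -> Ccvg (fun n => u n + v n) (a + b).
Proof.
intros Hu Hv.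
apply Ccvg_le with (fun n => Cmod (u n - a) + Cmod (v n - b))%R.
- apply filter_forall; intros n.
  replace (u n + v n - (a + b)) with ((u n - a) + (v n - b)) by ring.
  apply Cmod_triangle.
- replace (Finite 0) with (Finite (0 + 0)) by (f_equal; ring).
  now apply is_lim_seq_plus'.
Qed.

Lemma Ccvg_mult (u v : nat -> C) (a b : C) :
  Ccvg u a -> Ccvg v b -> Ccvg (fun n => u n * v n) (a * b).
Proof.
intros Hu Hv.
apply Ccvg_le with (fun n => Cmod (u n - a) * Cmod (v n - b)
   + Cmod (u n - a) * Cmod b + Cmod a * Cmod (v n - b))%R.
- apply filter_forall; intros n.
  replace (u n * v n - a * b)
    with ((u n - a) * (v n - b) + (u n - a) * b + a * (v n - b)) by ring.
  eapply Rle_trans; [apply Cmod_triangle |].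
  rewrite <- !Cmod_mult; apply Rplus_le_compat_r, Cmod_triangle.
- replace (Finite 0) with (Finite (0 * 0 + 0 * Cmod b + Cmod a * 0))
    by (f_equal; ring).
  apply is_lim_seq_plus'; [apply is_lim_seq_plus' |]; apply is_lim_seq_mult';
    assumption || apply is_lim_seq_const.
Qed.

Lemma Ccvg_minus (u v : nat -> C) (a b : C) :
  Ccvg u a -> Ccvg v b -> Ccvg (fun n => u n - v n) (a - b).
Proof.
intros Hu Hv.
apply Ccvg_ext with (fun n => u n + (- (1)) * v n); [intros n; ring |].
replace (a - b) with (a + - (1) * b) by ring.
apply Ccvg_plus, Ccvg_mult; assumption || apply Ccvg_const.
Qed.

Lemma Ccvg_Cmod_lower (u : nat -> C) (a : C) (c : R) :
  (c < Cmod a)%R -> Ccvg u a -> eventually (fun n => c < Cmod (u n))%R.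
Proof.
intros Hc Hu.
apply is_lim_seq_spec in Hu.
assert (He : (0 < Cmod a - c)%R) by lra.
generalize (Hu (mkposreal _ He)); apply filter_imp; intros n Hn; simpl in Hn.
rewrite Rminus_0_r, Rabs_pos_eq in Hn by apply Cmod_ge_0.
pose proof (Cmod_minus_ge a (u n)) as H.
rewrite (Cmod_minus_sym a) in H; lra.
Qed.

Lemma Ccvg_Cmod_lim (u : nat -> C) (a : C) :
  Ccvg u a -> is_lim_seq (fun n => Cmod (u n)) (Cmod a).
Proof.
intros Hu.
apply is_lim_seq_ext with (fun n => (Cmod (u n) - Cmod a) + Cmod a)%R; [intros; ring |].
replace (Finite (Cmod a)) with (Finite (0 + Cmod a)) by (f_equal; ring).
apply is_lim_seq_plus'; [| apply is_lim_seq_const].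
apply is_lim_seq_abs_0, is_lim_seq_0_le with (fun n => Cmod (u n - a)); [| exact Hu].
apply filter_forall; intros n; split; [apply Rabs_pos |].
pose proof (Cmod_minus_ge a (u n)) as H.
pose proof (Cmod_minus_ge (u n) a) as H'.
rewrite Cmod_minus_sym in H; apply Rabs_le; lra.
Qed.

Lemma Ccvg_inv (u : nat -> C) (a : C) :
  a <> 0 -> Ccvg u a -> Ccvg (fun n => / u n) (/ a).
Proof.
intros Ha Hu.
assert (Ha' := proj1 (Cmod_gt_0 a) Ha).
apply Ccvg_le with (fun n => Cmod (u n - a) * (2 / (Cmod a * Cmod a)))%R.
- generalize (Ccvg_Cmod_lower u a (Cmod a / 2) ltac:(lra) Hu).
  apply filter_imp; intros n Hn.
  assert (Hun : u n <> 0) by (apply Cmod_gt_0; lra).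
  replace (/ u n - / a) with (- (u n - a) * / (u n * a)) by (field; auto).
  rewrite Cmod_mult, Cmod_opp, Cmod_inv, Cmod_mult by now apply Cmult_neq_0.
  apply Rmult_le_compat_l; [apply Cmod_ge_0 |].
  replace (2 / (Cmod a * Cmod a))%R with (/ (Cmod a / 2 * Cmod a))%R by (field; lra).
  apply Rinv_le_contravar; nra.
- replace (Finite 0) with (Finite (0 * (2 / (Cmod a * Cmod a)))) by (f_equal; ring).
  apply is_lim_seq_mult'; [exact Hu | apply is_lim_seq_const].
Qed.

Lemma Ccvg_0_Cmod (u : nat -> C) :
  Ccvg u 0 -> is_lim_seq (fun n => Cmod (u n)) 0.
Proof.
intros H; rewrite <- Cmod_0; now apply Ccvg_Cmod_lim.
Qed.

Lemma Ccvg_is_prod_Z (a : Z -> C) (l : C) :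
  Ccvg (Cprod_sym a) l -> is_prod_Z a l.
Proof.
intros H.
apply filterlim_locally; intros eps.
apply is_lim_seq_spec in H.
generalize (H eps); apply filter_imp; intros n Hn.
rewrite Rminus_0_r, Rabs_pos_eq in Hn by apply Cmod_ge_0.
now apply C_NormedModule_mixin_compat1.
Qed.

(** * The exponential as a limit of powers *)

Lemma Cexp_minus_1_minus_id_bound (z : C) :
  (Cmod z <= 1 / 2)%R -> (Cmod (Cexp z - 1 - z) <= 8 * (Cmod z * Cmod z))%R.
Proof.
intros Hr.
pose proof (re_le_Cmod z) as Hx; pose proof (im_le_Cmod z) as Hy.
pose proof (Cmod_ge_0 z) as Hr0.
eapply Rle_trans; [apply Cmod_le_sum |].
replace (Re (Cexp z - 1 - z)) with (exp (Re z) * (cos (Im z) - 1) + (exp (Re z) - 1 - Re z))%R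
  by (unfold Cexp, Re, Im; simpl; ring).
replace (Im (Cexp z - 1 - z)) with (exp (Re z) * (sin (Im z) - Im z) + (exp (Re z) - 1) * Im z)%R
  by (unfold Cexp, Re, Im; simpl; ring).
set (x := Re z) in *; set (y := Im z) in *; set (r := Cmod z) in *.
apply Rabs_le_between in Hx as [Hx1 Hx2]; apply Rabs_le_between in Hy as [Hy1 Hy2].
clearbody x y r.
assert (He1 : (1 + x <= exp x)%R) by apply exp_ineq1_le.
assert (He2 : (exp x <= 1 + x + 2 * (x * x))%R).
{ pose proof (exp_ineq1_le (- x)) as H.
  assert (H' : (exp x * exp (- x) = 1)%R)
    by (rewrite <- exp_plus, Rplus_opp_r; apply exp_0).
  pose proof (exp_pos x).
  assert (exp x * (1 - x) <= 1)%R by nra.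
  assert (1 <= (1 - x) * (1 + x + 2 * (x * x)))%R by nra.
  nra. }
assert (Hc1 : (0 <= 1 - cos y <= y * y / 2)%R)
  by (pose proof (COS_bound y); pose proof (cos_lower y); lra).
assert (Hs1 : (Rabs (sin y - y) <= y * y)%R)
  by (apply sin_minus_id_bound, Rabs_le; lra).
assert (Hx2' : (x * x <= r * r)%R) by nra.
assert (Hy2' : (y * y <= r * r)%R) by nra.
assert (Hex : (exp x <= 2)%R) by nra.
pose proof (exp_pos x).
apply Rabs_le_between in Hs1 as [Hs1 Hs2].
assert (A1 : (Rabs (exp x * (cos y - 1) + (exp x - 1 - x)) <= 3 * (r * r))%R).
{ apply Rabs_le; split; nra. }
assert (A2 : (Rabs (exp x * (sin y - y)) <= 2 * (r * r))%R).
{ rewrite Rabs_mult, (Rabs_pos_eq (exp x)) by lra.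
  apply Rmult_le_compat; [lra | apply Rabs_pos | lra |].
  apply Rabs_le; lra. }
assert (A3 : (Rabs ((exp x - 1) * y) <= 2 * r * r)%R).
{ rewrite Rabs_mult.
  apply Rmult_le_compat; try apply Rabs_pos; apply Rabs_le; nra. }
pose proof (Rabs_triang (exp x * (sin y - y)) ((exp x - 1) * y)).
nra.
Qed.

Lemma Cpow_minus_bound (a b : C) (M : R) (n : nat) :
  (Cmod a <= M)%R -> (Cmod b <= M)%R -> (1 <= M)%R ->
  (Cmod (a ^ n - b ^ n) <= INR n * M ^ n * Cmod (a - b))%R.
Proof.
intros Ha Hb HM.
assert (HMn : forall n, (1 <= M ^ n)%R) by (intros; now apply pow_R1_Rle).
induction n as [|n IH].
- simpl; replace (1 - 1) with (RtoC 0) by ring; rewrite Cmod_0; lra.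
- rewrite !Cpow_S, S_INR; simpl pow.
  replace (a * a ^ n - b * b ^ n) with (a * (a ^ n - b ^ n) + b ^ n * (a - b)) by ring.
  eapply Rle_trans; [apply Cmod_triangle |].
  rewrite !Cmod_mult, Cmod_pow.
  pose proof (Cmod_ge_0 (a - b)); pose proof (Cmod_ge_0 a); pose proof (Cmod_ge_0 b).
  assert (H3 : (Cmod b ^ n <= M ^ n)%R) by (apply pow_incr; lra).
  assert (H4 : (Cmod a * Cmod (a ^ n - b ^ n) <= M * (INR n * M ^ n * Cmod (a - b)))%R)
    by (apply Rmult_le_compat; try apply Cmod_ge_0; lra).
  assert (H5 : (Cmod b ^ n * Cmod (a - b) <= M * M ^ n * Cmod (a - b))%R).
  { apply Rmult_le_compat_r; [assumption |].
    specialize (HMn n); nra. }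
  nra.
Qed.

Lemma exp_pow (x : R) (n : nat) : (exp x ^ n = exp (INR n * x))%R.
Proof.
induction n as [|n IH].
- simpl; now rewrite Rmult_0_l, exp_0.
- rewrite S_INR; simpl; rewrite IH, <- exp_plus; f_equal; ring.
Qed.

(** Both [1 + z/N] and [exp (z/N)] have modulus at most [exp (|z|/N)] and differ
    by [O(1/N^2)], so their [N]-th powers differ by [O(1/N)]. *)
Lemma Ccvg_pow_exp (z : C) (N : nat -> nat) :
  is_lim_seq (fun m => INR (N m)) p_infty ->
  Ccvg (fun m => (1 + z / RtoC (INR (N m))) ^ N m) (Cexp z).
Proof.
intros HN.
apply Ccvg_le with (fun m => exp (Cmod z) * 8 * (Cmod z * Cmod z) * / INR (N m))%R.
- apply is_lim_seq_spec in HN.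
  generalize (HN (1 + 2 * Cmod z)%R); apply filter_imp; intros m Hm.
  pose proof (Cmod_ge_0 z) as Hz.
  assert (Hn0 : RtoC (INR (N m)) <> 0) by (intros E; apply RtoC_inj in E; lra).
  set (n := N m) in *.
  assert (Hmod : Cmod (z / RtoC (INR n)) = (Cmod z / INR n)%R).
  { rewrite Cmod_div, Cmod_R, Rabs_pos_eq; auto; lra. }
  assert (Hpos : (0 <= Cmod z / INR n)%R) by (apply Rdiv_le_0_compat; lra).
  replace (Cexp z) with (Cexp (z / RtoC (INR n)) ^ n)
    by (rewrite <- Cexp_INR_mult; f_equal; field; assumption).
  rewrite Cmod_minus_sym.
  eapply Rle_trans; [apply Cpow_minus_bound with (M := exp (Cmod z / INR n)) |].
  + rewrite Cmod_Cexp, <- Hmod; apply exp_Re_le.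
  + eapply Rle_trans; [apply Cmod_triangle |].
    rewrite Cmod_1, Hmod; apply exp_ineq1_le.
  + pose proof (exp_ineq1_le (Cmod z / INR n)); lra.
  + rewrite exp_pow.
    replace (INR n * (Cmod z / INR n))%R with (Cmod z) by (field; lra).
    replace (Cexp (z / INR n) - (1 + z / INR n)) with (Cexp (z / INR n) - 1 - z / INR n) by ring.
    assert (Hb : (Cmod (Cexp (z / INR n) - 1 - z / INR n)
                  <= 8 * (Cmod z / INR n * (Cmod z / INR n)))%R).
    { rewrite <- Hmod; apply Cexp_minus_1_minus_id_bound; rewrite Hmod.
      apply Rle_div_l; lra. }
    pose proof (exp_pos (Cmod z)).
    replace (exp (Cmod z) * 8 * (Cmod z * Cmod z) * / INR n)%R
      with (INR n * exp (Cmod z) * (8 * (Cmod z / INR n * (Cmod z / INR n))))%R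
      by (field; lra).
    apply Rmult_le_compat_l; [apply Rmult_le_pos; lra | exact Hb].
- now apply is_lim_seq_scal_0, is_lim_seq_inv_p_infty.
Qed.

(** * Polynomial functions *)

(** Degree at most [d], in Horner form: division by [t - r] is then a direct
    induction. *)
Inductive poly : nat -> (C -> C) -> Prop :=
| poly_const (c : C) (p : C -> C) : (forall t, p t = c) -> poly 0 p
| poly_step (d : nat) (c : C) (p q : C -> C) :
    poly d q -> (forall t, p t = c + t * q t) -> poly (S d) p.

Lemma poly_ext (d : nat) (p p' : C -> C) :
  (forall t, p' t = p t) -> poly d p -> poly d p'.
Proof.
intros E H; destruct H as [c p H | d c p q Hq H].
- apply poly_const with c; intros t; now rewrite E.
- apply poly_step with c q; [exact Hq |]; intros t; now rewrite E.
Qed.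

Lemma poly_add (d : nat) (p q : C -> C) :
  poly d p -> poly d q -> poly d (fun t => p t + q t).
Proof.
intros Hp; revert q; induction Hp as [c p H | d c p p1 Hp1 IH H]; intros q Hq.
- inversion Hq as [c' q' H' |]; subst.
  apply poly_const with (c + c'); intros t; now rewrite H, H'.
- inversion Hq as [| d' c' q' q1 Hq1 H']; subst.
  apply poly_step with (c + c') (fun t => p1 t + q1 t); [now apply IH |].
  intros t; rewrite H, H'; ring.
Qed.

Lemma poly_scal (d : nat) (a : C) (p : C -> C) :
  poly d p -> poly d (fun t => a * p t).
Proof.
induction 1 as [c p H | d c p q Hq IH H].
- apply poly_const with (a * c); intros t; now rewrite H.
- apply poly_step with (a * c) (fun t => a * q t); [exact IH |].
  intros t; rewrite H; ring.
Qed.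

Lemma poly_mulX (d : nat) (p : C -> C) : poly d p -> poly (S d) (fun t => t * p t).
Proof. intros H; apply poly_step with (RtoC 0) p; [exact H | intros; ring]. Qed.

Lemma poly_S (d : nat) (p : C -> C) : poly d p -> poly (S d) p.
Proof.
induction 1 as [c p H | d c p q Hq IH H].
- apply poly_step with c (fun _ => 0); [now apply poly_const with (RtoC 0) |].
  intros t; rewrite H; ring.
- now apply poly_step with c q.
Qed.

Lemma poly_cst (d : nat) (c : C) : poly d (fun _ => c).
Proof.
induction d as [|d IH]; [now apply poly_const with c | now apply poly_S].
Qed.

Lemma poly_mul_lin (d : nat) (a b : C) (p : C -> C) :
  poly d p -> poly (S d) (fun t => (a + b * t) * p t).
Proof.
intros H; apply poly_ext with (fun t => a * p t + b * (t * p t)); [intros; ring |].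
apply poly_add; apply poly_scal; [now apply poly_S | now apply poly_mulX].
Qed.

Lemma poly_lin_pow (a b : C) (n : nat) : poly n (fun t => (a + b * t) ^ n).
Proof.
induction n as [|n IH].
- now apply poly_const with (RtoC 1).
- apply poly_ext with (fun t => (a + b * t) * (a + b * t) ^ n); [reflexivity |].
  now apply poly_mul_lin.
Qed.

Lemma poly_divide (d : nat) (p : C -> C) (r : C) :
  poly (S d) p -> exists q, poly d q /\ forall t, p t = p r + (t - r) * q t.
Proof.
revert p; induction d as [|d IH]; intros p Hp;
  inversion Hp as [| d' c p' p1 Hp1 H]; subst.
- exists p1; split; [exact Hp1 |].
  inversion Hp1 as [c' p' H' |]; subst.
  intros t; rewrite !H, !H'; ring.
- destruct (IH p1 Hp1) as [q [Hq E]].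
  exists (fun t => p1 t + r * q t); split.
  + apply poly_add; [exact Hp1 | now apply poly_S, poly_scal].
  + intros t; rewrite !H, (E t); ring.
Qed.

(** Products of the linear factors [1 - t a], the roots being the inverses of
    the entries of the list: this normalises every polynomial at [t = 0] and
    allows the approximants of a product to be compared factor by factor. *)
Fixpoint lin_prod (l : list C) (t : C) : C :=
  match l with
  | [] => 1
  | a :: l' => (1 - t * a) * lin_prod l' t
  end.

Lemma lin_prod_0 (l : list C) : lin_prod l 0 = 1.
Proof. induction l as [|a l IH]; simpl; [reflexivity | rewrite IH; ring]. Qed.

Lemma lin_prod_app (l l' : list C) (t : C) :
  lin_prod (l ++ l') t = lin_prod l t * lin_prod l' t.
Proof. induction l as [|a l IH]; simpl; [ring | rewrite IH; ring]. Qed.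

Lemma lin_factor_nz (t a : C) : t <> 0 -> a <> / t -> 1 - t * a <> 0.
Proof.
intros Ht H E; apply H.
replace a with (t * a / t) by (field; exact Ht).
replace (t * a) with (1 - (1 - t * a)) by ring; rewrite E; field; exact Ht.
Qed.

Lemma lin_prod_nz (l : list C) (t : C) : t <> 0 -> ~ In (/ t) l -> lin_prod l t <> 0.
Proof.
intros Ht; induction l as [|a l IH]; simpl; intros H; [exact C1_nz |].
apply Cmult_neq_0; [apply lin_factor_nz; auto | apply IH; auto].
Qed.

Lemma poly_lin_prod (l : list C) : poly (length l) (lin_prod l).
Proof.
induction l as [|a l IH]; simpl.
- now apply poly_const with (RtoC 1).
- apply poly_ext with (fun t => (1 + (- a) * t) * lin_prod l t);
    [intros; ring | now apply poly_mul_lin].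
Qed.

Lemma Cinv_inv (a : C) : a <> 0 -> / / a = a.
Proof. intros Ha; field; exact Ha. Qed.

Lemma Cinv_nz (a : C) : a <> 0 -> / a <> 0.
Proof.
intros Ha E; apply C1_nz; rewrite <- (Cinv_l a Ha), E; ring.
Qed.

(** Each root of [l] is divided out in turn; the others remain roots of the quotient
    since they are distinct. *)
Lemma poly_factor (l : list C) (d : nat) (p : C -> C) :
  poly (length l + d) p -> NoDup l ->
  (forall a, In a l -> a <> 0 /\ p (/ a) = 0) ->
  exists q, poly d q /\ forall t, p t = q t * lin_prod l t.
Proof.
revert p; induction l as [|a l IH]; simpl; intros p Hp Hl H.
- exists p; split; [exact Hp | intros; ring].
- inversion Hl as [| a' l' Ha Hl']; subst.
  destruct (H a (or_introl eq_refl)) as [Ha0 Hpa].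
  destruct (poly_divide _ p (/ a) Hp) as [q [Hq E]].
  destruct (IH (fun t => (- / a) * q t)) as [q' [Hq' E']].
  + now apply poly_scal.
  + exact Hl'.
  + intros b Hb; destruct (H b (or_intror Hb)) as [Hb0 Hpb]; split; [exact Hb0 |].
    assert (Hab : / b - / a <> 0).
    { intros E1; apply Ha; replace a with b; [exact Hb |].
      rewrite <- (Cinv_inv a), <- (Cinv_inv b) by assumption; f_equal.
      now apply Ceq_minus. }
    rewrite E, Hpa in Hpb; revert Hab Hpb; generalize (/ b - / a); intros u Hu Hpb.
    replace (q (/ b)) with ((0 + u * q (/ b)) / u)
      by (field; auto).
    rewrite Hpb; field; auto.
  + exists q'; split; [exact Hq' |]; intros t.
    rewrite E, Hpa.
    replace (q' t * ((1 - t * a) * lin_prod l t))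
      with ((1 - t * a) * (q' t * lin_prod l t)) by ring.
    rewrite <- E'; field; exact Ha0.
Qed.

(** A polynomial of degree [d] depends linearly and continuously on its values
    at [d + 1] points (Newton interpolation). *)
Lemma poly_interpolation_cvg (l : list C) (w : C) (p : nat -> C -> C) (t : C) :
  eventually (fun n => poly (length l) (p n)) -> NoDup (w :: l) ->
  (forall v, In v (w :: l) -> Ccvg (fun n => p n v) 0) ->
  Ccvg (fun n => p n t) 0.
Proof.
revert w p; induction l as [|v l IH]; intros w p Hp Hl H.
- apply Ccvg_ext_loc with (fun n => p n w); [| apply H; now left].
  revert Hp; apply filter_imp; intros n Hn.
  inversion Hn as [c p' E |]; now rewrite !E.
- simpl in Hp.
  assert (Hq : forall n, exists q, poly (S (length l)) (p n) ->
     poly (length l) q /\ forall t, p n t = p n w + (t - w) * q t).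
  { intros n; destruct (ClassicalEpsilon.excluded_middle_informative
                          (poly (S (length l)) (p n))) as [Hn | Hn].
    - destruct (poly_divide _ _ w Hn) as [q Hq]; now exists q.
    - exists (fun _ => 0); tauto. }

  set (q := fun n => proj1_sig (ClassicalEpsilon.constructive_indefinite_description _ (Hq n))).
  assert (Hqs : eventually (fun n => poly (length l) (q n) /\
     forall t, p n t = p n w + (t - w) * q n t)).
  { revert Hp; apply filter_imp; intros n Hn.
    exact (proj2_sig (ClassicalEpsilon.constructive_indefinite_description _ (Hq n)) Hn). }
  inversion Hl as [| ? ? Hw Hl']; subst.
  assert (Hqt : Ccvg (fun n => q n t) 0).
  { apply IH with v; [| exact Hl' |].
    - revert Hqs; apply filter_imp; tauto.
    - intros u Hu.
      assert (Huw : u - w <> 0).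
      { intros E; apply Hw; replace w with u; [exact Hu | now apply Ceq_minus]. }
      apply Ccvg_ext_loc with (fun n => (p n u - p n w) * / (u - w)).
      + revert Hqs; apply filter_imp; intros n [_ E]; rewrite (E u); field; exact Huw.
      + apply Ccvg_eq with ((0 - 0) * / (u - w)); [ring |].
        apply Ccvg_mult; [apply Ccvg_minus | apply Ccvg_const]; apply H;
          [right; exact Hu | now left]. }
  apply Ccvg_ext_loc with (fun n => p n w + (t - w) * q n t).
  + revert Hqs; apply filter_imp; intros n [_ E]; now rewrite (E t).
  + apply Ccvg_eq with (0 + (t - w) * 0); [ring |].
    apply Ccvg_plus; [apply H; now left |].
    apply Ccvg_mult; [apply Ccvg_const | exact Hqt].
Qed.

(** The points [/ a] and [0] are [length l + 1] nodes, at which the values of the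
    limit [lin_prod l] are [0] and [1]. *)
Lemma poly_cvg_lin_prod (l : list C) (q : nat -> C -> C) (t : C) :
  eventually (fun n => poly (length l) (q n)) -> NoDup l ->
  (forall a, In a l -> a <> 0 /\ Ccvg (fun n => q n (/ a)) 0) ->
  Ccvg (fun n => q n 0) 1 ->
  Ccvg (fun n => q n t) (lin_prod l t).
Proof.
intros Hq Hl H H0.
assert (Hin : forall a, In a l -> lin_prod l (/ a) = 0).
{ clear -H; induction l as [|b l IH]; simpl; [tauto |].
  intros a [-> | Ha].
  - replace (1 - / a * a) with (RtoC 0); [ring |].
    destruct (H a (or_introl eq_refl)); field; assumption.
  - rewrite IH; [ring | intros; apply H; now right | exact Ha]. }
assert (E : Ccvg (fun n => q n t - lin_prod l t) 0).
{ apply (poly_interpolation_cvg (map Cinv l) 0 (fun n s => q n s - lin_prod l s)).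
  - rewrite length_map; revert Hq; apply filter_imp; intros n Hn.
    apply poly_ext with (fun s => q n s + (- (1)) * lin_prod l s); [intros; ring |].
    apply poly_add; [exact Hn | apply poly_scal, poly_lin_prod].
  - apply NoDup_cons.
    + rewrite in_map_iff; intros [a [E Ha]].
      destruct (H a Ha); now apply (Cinv_nz a).
    + clear -Hl H; induction l as [|a l IH]; simpl; constructor.
      * inversion Hl as [| ? ? Ha Hl']; subst.
        rewrite in_map_iff; intros [b [E Hb]]; apply Ha.
        destruct (H a (or_introl eq_refl)), (H b (or_intror Hb)).
        rewrite <- (Cinv_inv a), <- E, Cinv_inv by assumption; exact Hb.
      * inversion Hl; subst; apply IH; [assumption |].
        intros; apply H; now right.
  - intros v [<- | Hv].
    + rewrite lin_prod_0; apply Ccvg_eq with (1 - 1); [ring |].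
      apply Ccvg_minus; [exact H0 | apply Ccvg_const].
    + apply in_map_iff in Hv as [a [<- Ha]].
      rewrite Hin by exact Ha.
      apply Ccvg_eq with (0 - 0); [ring |].
      apply Ccvg_minus; [now apply H | apply Ccvg_const]. }
apply Ccvg_ext with (fun n => (q n t - lin_prod l t) + lin_prod l t); [intros; ring |].
apply Ccvg_eq with (0 + lin_prod l t); [ring |].
apply Ccvg_plus; [exact E | apply Ccvg_const].
Qed.

Lemma poly_factor_double (d : nat) (p q : C -> C) (w : C) :
  w <> 0 -> poly (S d) q -> q w = 0 -> (forall t, p t = (t - w) * q t) ->
  exists q', poly d q' /\ forall t, p t = (1 - t / w) * (1 - t / w) * q' t.
Proof.
intros Hw Hq Hqw E.
destruct (poly_divide _ q w Hq) as [q1 [Hq1 E1]].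
exists (fun t => (w * w) * q1 t); split; [now apply poly_scal |].
intros t; rewrite E, E1, Hqw; field; exact Hw.
Qed.

(** The value at [w] of the quotient by [t - w] is the derivative: this detects
    double roots algebraically. *)
Lemma lin_pow_expansion (a b w : C) (n : nat) :
  exists q, poly n q /\
    (forall t, (a + b * t) ^ S n = (a + b * w) ^ S n + (t - w) * q t) /\
    q w = RtoC (INR (S n)) * b * (a + b * w) ^ n.
Proof.
induction n as [|n [q [Hq [E Ew]]]].
- exists (fun _ => b); split; [now apply poly_const with b |].
  split; [intros; simpl; ring | simpl; ring].
- exists (fun t => b * (a + b * w) ^ S n + (a + b * t) * q t); split; [| split].
  + apply poly_add; [apply poly_cst | now apply poly_mul_lin].
  + intros t; rewrite !(Cpow_S _ (S n)), (E t); ring.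
  + rewrite Ew, (S_INR (S n)), RtoC_plus, Cpow_S; ring.
Qed.

(** * Lipschitz estimates for the principal logarithm *)

(** Jordan's inequality: by concavity of the sine on [[0, PI/2]], its graph lies
    above the chord. *)
Lemma jordan_sin (v : R) : (0 <= v <= PI / 2 -> 2 * v <= PI * sin v)%R.
Proof.
intros [H0 H1].
destruct (Req_dec v 0) as [-> | Hn0]; [rewrite sin_0; lra |].
destruct (Req_dec v (PI / 2)) as [-> | Hn1]; [rewrite sin_PI2; lra |].
assert (Hd : forall c, derivable_pt_lim sin c (cos c)) by apply derivable_pt_lim_sin.
destruct (MVT_cor2 sin cos 0 v ltac:(lra) ltac:(intros; apply Hd)) as [c1 [E1 Hc1]].
destruct (MVT_cor2 sin cos v (PI / 2) ltac:(lra) ltac:(intros; apply Hd)) as [c2 [E2 Hc2]].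
rewrite sin_0 in E1; rewrite sin_PI2 in E2.
assert (Hc : (cos c2 <= cos c1)%R) by (apply cos_decr_1; pose proof PI_RGT_0; lra).
assert (H : (v * (PI / 2 - v) * cos c2 <= v * (PI / 2 - v) * cos c1)%R)
  by (apply Rmult_le_compat_l; [apply Rmult_le_pos |]; lra).
replace (v * (PI / 2 - v) * cos c2)%R with (v * (1 - sin v))%R in H by (rewrite E2; ring).
replace (v * (PI / 2 - v) * cos c1)%R with (sin v * (PI / 2 - v))%R in H
  by (rewrite <- (Rminus_0_r (sin v)), E1; ring).
lra.
Qed.

(** [|exp d - 1|^2 = (exp x - 1)^2 + 4 exp x sin^2 (y/2)] for [d = x + i y]; Jordan's
    inequality bounds the sine on the whole range [|y| <= PI]. *)
Lemma Cexp_minus_1_lower (d : C) :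
  (0 <= Re d)%R -> (Rabs (Im d) <= PI)%R ->
  (2 * Cmod d <= PI * Cmod (Cexp d - 1))%R.
Proof.
intros Hx Hy.
pose proof PI_RGT_0 as Hpi; pose proof PI2_1 as Hpi2.
apply Rsqr_incr_0_var; [| apply Rmult_le_pos; [lra | apply Cmod_ge_0]].
unfold Rsqr.
assert (E1 : (2 * Cmod d * (2 * Cmod d) = 4 * (Re d ^ 2 + Im d ^ 2))%R)
  by (rewrite <- Cmod2_alt; ring).
assert (E2 : (PI * Cmod (Cexp d - 1) * (PI * Cmod (Cexp d - 1))
   = PI * PI * ((exp (Re d) - 1) ^ 2 + exp (Re d) * (4 * (sin (Im d / 2) * sin (Im d / 2)))))%R).
{ replace (PI * Cmod (Cexp d - 1) * (PI * Cmod (Cexp d - 1)))%R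
    with (PI * PI * Cmod (Cexp d - 1) ^ 2)%R by ring.
  rewrite Cmod2_alt; f_equal.
  replace (4 * (sin (Im d / 2) * sin (Im d / 2)))%R with (2 - 2 * cos (Im d))%R.
  - unfold Cexp, Re, Im; simpl.
    set (x := exp (fst d)); set (y := snd d).
    replace ((x * cos y + - (1)) * ((x * cos y + - (1)) * 1)
      + (x * sin y + - 0) * ((x * sin y + - 0) * 1))%R
      with (x * x * ((sin y)² + (cos y)²) - 2 * x * cos y + 1)%R by (unfold Rsqr; ring).
    rewrite sin2_cos2; ring.
  - replace (Im d) with (2 * (Im d / 2))%R at 1 by field.
    rewrite cos_2a_sin; ring. }
rewrite E1, E2.
assert (Hs : (Im d ^ 2 <= PI * PI * (sin (Im d / 2) * sin (Im d / 2)))%R).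
{ destruct (Rle_dec 0 (Im d)) as [H | H].
  - rewrite Rabs_pos_eq in Hy by lra.
    pose proof (jordan_sin (Im d / 2) ltac:(lra)); nra.
  - rewrite Rabs_left in Hy by lra.
    pose proof (jordan_sin (- (Im d / 2)) ltac:(lra)) as H'.
    rewrite sin_neg in H'; nra. }
assert (He : (Re d <= exp (Re d) - 1)%R) by (pose proof (exp_ineq1_le (Re d)); lra).
assert (He2 : (Re d ^ 2 <= (exp (Re d) - 1) ^ 2)%R) by (apply pow_incr; lra).
assert (4 <= PI * PI)%R by nra.
assert (0 <= sin (Im d / 2) * sin (Im d / 2))%R by nra.
assert (0 <= (exp (Re d) - 1) ^ 2)%R by apply pow2_ge_0.
assert (4 * Re d ^ 2 <= PI * PI * (exp (Re d) - 1) ^ 2)%R by nra.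
assert (4 * (PI * PI * (sin (Im d / 2) * sin (Im d / 2)))
  <= exp (Re d) * (4 * (PI * PI * (sin (Im d / 2) * sin (Im d / 2)))))%R.
{ assert (0 <= PI * PI * (sin (Im d / 2) * sin (Im d / 2)))%R by nra. nra. }
nra.
Qed.

Lemma Cmod_exp_Clog (z : C) : z <> 0 -> exp (Re (Clog z)) = Cmod z.
Proof. intros Hz; rewrite <- Cmod_Cexp, Cexp_Clog; auto. Qed.

(** The bound is the lower bound for [exp d - 1] read backwards, with
    [d = log p - log q]; it applies as long as [p] and [q] do not straddle the cut.
    Exchanging [p] and [q] one may take [Re d >= 0]. *)
Lemma Clog_lipschitz (p q : C) (m : R) :
  (0 < m <= Cmod p)%R -> (m <= Cmod q)%R ->
  (Rabs (Im (Clog p) - Im (Clog q)) <= PI)%R ->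
  (m * Cmod (Clog p - Clog q) <= 2 * Cmod (p - q))%R.
Proof.
assert (H : forall p q, (0 < m <= Cmod p)%R -> (m <= Cmod q)%R ->
  (Rabs (Im (Clog p) - Im (Clog q)) <= PI)%R -> (Re (Clog q) <= Re (Clog p))%R ->
  (m * Cmod (Clog p - Clog q) <= 2 * Cmod (p - q))%R).
{ clear p q; intros p q Hp Hq Hi Hr.
  assert (Hp0 : p <> 0) by (apply Cmod_gt_0; lra).
  assert (Hq0 : q <> 0) by (apply Cmod_gt_0; lra).
  pose proof (Cexp_minus_1_lower (Clog p - Clog q)) as H.
  assert (E : p - q = q * (Cexp (Clog p - Clog q) - 1)).
  { unfold Cminus at 3; rewrite Cexp_plus, Cexp_opp, !Cexp_Clog by assumption.
    field; exact Hq0. }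
  rewrite E, Cmod_mult.
  assert (H' : (2 * Cmod (Clog p - Clog q) <= PI * Cmod (Cexp (Clog p - Clog q) - 1))%R).
  { apply H; unfold Re, Im in *; simpl in *; [lra | exact Hi]. }
  pose proof PI_4; pose proof PI_RGT_0.
  pose proof (Cmod_ge_0 (Clog p - Clog q)).
  pose proof (Cmod_ge_0 (Cexp (Clog p - Clog q) - 1)).
  assert (Cmod (Clog p - Clog q) <= 2 * Cmod (Cexp (Clog p - Clog q) - 1))%R by nra.
  nra. }
intros Hp Hq Hi.
destruct (Rle_dec (Re (Clog q)) (Re (Clog p))) as [Hr | Hr]; [now apply H |].
rewrite (Cmod_minus_sym (Clog p)), (Cmod_minus_sym p).
apply H; [lra | lra | | lra].
now rewrite Rabs_minus_sym.
Qed.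

(** Two half-planes avoiding the cut of the logarithm, bounded by diagonals: the
    values [T s] have an argument between about [0] and [PI / 2] for [k > 0],
    between about [- PI / 2] and [0] for [k < 0]. *)
Definition half_plane (up : bool) (z : C) : Prop :=
  (0 < Re z + (if up then Im z else - Im z))%R.

(** Turned by [PI / 4], the argument has a sine of constant sign. *)
Lemma Clog_half_plane (up : bool) (p q : C) :
  half_plane up p -> half_plane up q ->
  (Rabs (Im (Clog p) - Im (Clog q)) <= PI)%R.
Proof.
pose proof PI_RGT_0 as Hpi.
assert (Hz : forall z, half_plane up z -> z <> 0).
{ intros z H ->; unfold half_plane in H; destruct up; simpl in H; lra. }
assert (Hs : forall z, half_plane up z ->
  (if up then 0 < Im (Clog z) + PI / 4 < PI else - PI < Im (Clog z) - PI / 4 < 0)%R).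
{ intros z H; specialize (Hz z H).
  pose proof (Im_Clog_bounds z Hz) as Hb.
  pose proof (Cexp_Clog z Hz) as E.
  rewrite <- E in H; unfold half_plane, Cexp in H; revert Hb H.
  set (a := Im (Clog z)); pose proof (exp_pos (Re (Clog z))).
  set (e := exp (Re (Clog z))) in *; intros Hb.
  assert (Hq2 : (0 < 1 / sqrt 2)%R).
  { apply Rdiv_lt_0_compat; [lra | apply sqrt_lt_R0; lra]. }
  destruct up; unfold Re, Im; simpl; intros H1.
  - assert (Hsin : (0 < sin (a + PI / 4))%R).
    { rewrite sin_plus, cos_PI4, sin_PI4. assert (0 < cos a + sin a)%R by nra. nra. }
    split; apply Rnot_le_lt; intros H2.
    + pose proof (sin_ge_0 (- (a + PI / 4)) ltac:(lra) ltac:(lra)) as H3.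
      rewrite sin_neg in H3; lra.
    + pose proof (sin_le_0 (a + PI / 4) ltac:(lra) ltac:(lra)); lra.
  - assert (Hsin : (sin (a - PI / 4) < 0)%R).
    { rewrite sin_minus, cos_PI4, sin_PI4. assert (0 < cos a - sin a)%R by nra. nra. }
    split; apply Rnot_le_lt; intros H2.
    + pose proof (sin_le_0 (- (a - PI / 4)) ltac:(lra) ltac:(lra)) as H3.
      rewrite sin_neg in H3; lra.
    + pose proof (sin_ge_0 (a - PI / 4) ltac:(lra) ltac:(lra)); lra. }
intros Hp Hq; specialize (Hs p Hp) as H1; specialize (Hs q Hq) as H2.
apply Rabs_le; destruct up; lra.
Qed.

Lemma Clog_bound (z : C) (M : R) :
  (1 <= Cmod z <= M)%R -> (Cmod (Clog z) <= ln M + PI)%R.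
Proof.
intros [H1 H2].
assert (Hz : z <> 0) by (apply Cmod_gt_0; lra).
eapply Rle_trans; [apply Cmod_le_sum |].
pose proof (Im_Clog_bounds z Hz).
apply Rplus_le_compat; [| apply Rabs_le; lra].
unfold Clog, Re; simpl.
rewrite Rabs_pos_eq.
- apply ln_le; lra.
- rewrite <- ln_1; apply ln_le; lra.
Qed.

(** * Fixed points of contractions *)

Lemma ex_lim_geometric_increments (r : nat -> R) (A : R) :
  (forall n, Rabs (r (S n) - r n) <= A * (1 / 2) ^ n)%R ->
  exists l : R, is_lim_seq r l.
Proof.
intros H.
assert (H1 : forall n j, (Rabs (r (n + j)%nat - r n) <= 2 * A * (1 / 2) ^ n * (1 - (1 / 2) ^ j))%R).
{ intros n j; induction j as [|j IH].
  - rewrite Nat.add_0_r; simpl.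
    replace (r n - r n)%R with 0%R by ring; rewrite Rabs_R0; lra.
  - rewrite Nat.add_succ_r.
    replace (r (S (n + j)) - r n)%R
      with ((r (S (n + j)) - r (n + j)%nat) + (r (n + j)%nat - r n))%R by ring.
    eapply Rle_trans; [apply Rabs_triang |].
    specialize (H (n + j)%nat); rewrite pow_add in H; simpl; lra. }
assert (HA : (0 <= A)%R).
{ specialize (H 0%nat); simpl in H.
  pose proof (Rabs_pos (r 1%nat - r 0%nat)); lra. }
assert (Hg : is_lim_seq (fun n => 2 * A * (1 / 2) ^ n)%R 0).
{ apply is_lim_seq_scal_0, is_lim_seq_geom; rewrite Rabs_pos_eq; lra. }
assert (Hl : ex_finite_lim_seq r).
{ apply ex_lim_seq_cauchy_corr; intros eps.
  apply is_lim_seq_spec in Hg.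
  destruct (Hg (pos_div_2 eps)) as [N HN]; exists N.
  assert (HN' : forall n, (N <= n)%nat -> (Rabs (r n - r N) < eps / 2)%R).
  { intros n Hn; replace n with (N + (n - N))%nat by lia.
    eapply Rle_lt_trans; [apply H1 |].
    specialize (HN N (le_n N)); simpl in HN.
    pose proof (pow_lt (1 / 2) N ltac:(lra)); pose proof (pow_lt (1 / 2) (n - N) ltac:(lra)).
    assert (0 <= 2 * A * (1 / 2) ^ N)%R by (apply Rmult_le_pos; lra).
    rewrite Rminus_0_r, Rabs_pos_eq in HN by assumption.
    nra. }
  intros n m Hn Hm.
  pose proof (HN' n Hn) as A1; pose proof (HN' m Hm) as A2.
  apply Rabs_lt_between in A1; apply Rabs_lt_between in A2.
  apply Rabs_lt_between; lra. }
destruct Hl as [l Hl]; now exists l.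
Qed.

Lemma contraction_fixed_point (F : C -> C) (c : C) (rho : R) :
  (0 <= rho)%R ->
  (forall s, Cmod (s - c) <= rho -> Cmod (F s - c) <= rho)%R ->
  (forall s s', Cmod (s - c) <= rho -> Cmod (s' - c) <= rho ->
     Cmod (F s - F s') <= 1 / 2 * Cmod (s - s'))%R ->
  exists s, (Cmod (s - c) <= rho)%R /\ F s = s.
Proof.
intros Hrho Hmaps Hcontr.
set (u := fix u (n : nat) : C := match n with O => c | S n' => F (u n') end).
assert (Hin : forall n, (Cmod (u n - c) <= rho)%R).
{ induction n as [|n IH]; simpl; [| now apply Hmaps].
  replace (c - c) with (RtoC 0) by ring; rewrite Cmod_0; lra. }
assert (Hinc : forall n, (Cmod (u (S n) - u n) <= rho * (1 / 2) ^ n)%R).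
{ induction n as [|n IH].
  - simpl pow; rewrite Rmult_1_r; apply (Hin 1%nat).
  - change (u (S (S n))) with (F (u (S n))); change (u (S n)) with (F (u n)) at 2.
    eapply Rle_trans; [apply Hcontr; apply Hin |]; simpl pow; lra. }
destruct (ex_lim_geometric_increments (fun n => Re (u n)) rho) as [a Ha].
{ intros n; eapply Rle_trans; [| apply Hinc].
  eapply Rle_trans; [| apply re_le_Cmod]; right; reflexivity. }
destruct (ex_lim_geometric_increments (fun n => Im (u n)) rho) as [b Hb].
{ intros n; eapply Rle_trans; [| apply Hinc].
  eapply Rle_trans; [| apply im_le_Cmod]; right; reflexivity. }
set (s := (a, b) : C).
assert (Hs : Ccvg u s).
{ apply Ccvg_le with (fun n => Rabs (Re (u n) - a) + Rabs (Im (u n) - b))%R.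
  - apply filter_forall; intros n; apply Cmod_le_sum.
  - replace (Finite 0) with (Finite (Rabs (a - a) + Rabs (b - b)))
      by (f_equal; rewrite !Rminus_diag, Rabs_R0; ring).
    apply is_lim_seq_plus'; apply (is_lim_seq_abs _ (Finite _));
      (apply is_lim_seq_minus'; [assumption | apply is_lim_seq_const]). }
assert (Hsin : (Cmod (s - c) <= rho)%R).
{ apply (is_lim_seq_le (fun n => Cmod (u n - c)) (fun _ => rho) (Cmod (s - c)) rho Hin);
    [| apply is_lim_seq_const].
  apply Ccvg_Cmod_lim, Ccvg_minus; [exact Hs | apply Ccvg_const]. }
exists s; split; [exact Hsin |].
apply Ceq_minus, Cmod_eq_0.
apply Rle_antisym; [| apply Cmod_ge_0].
apply (is_lim_seq_le (fun _ => Cmod (F s - s))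
  (fun n => 1 / 2 * Cmod (u n - s) + Cmod (u (S n) - s))%R (Cmod (F s - s)) 0).
- intros n.
  replace (F s - s) with ((F s - F (u n)) + (u (S n) - s)) by (simpl; ring).
  eapply Rle_trans; [apply Cmod_triangle |].
  apply Rplus_le_compat_r.
  rewrite (Cmod_minus_sym (u n)); now apply Hcontr.
- apply is_lim_seq_const.
- replace (Finite 0) with (Finite (1 / 2 * 0 + 0)) by (f_equal; ring).
  apply is_lim_seq_plus'.
  + apply is_lim_seq_mult'; [apply is_lim_seq_const | exact Hs].
  + apply (is_lim_seq_incr_1 (fun n => Cmod (u n - s))), Hs.
Qed.

(** * The branches of [s + log (T s) = lambda + 2 k PI i] *)

Definition zabs (k : Z) : R := Rabs (IZR k).

Definition disc (k : Z) (s : C) : Prop := (Cmod (s - turn k) <= zabs k / 4)%R.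

(** On the disc around [2 k PI i], [T] has the size of [k], stays in a half-plane where
    the logarithm is continuous, and is Lipschitz. *)
Definition tame (T : C -> C) (k : Z) : Prop :=
  (forall s, disc k s -> 3 * zabs k <= Cmod (T s) <= 9 * zabs k)%R /\
  (forall s, disc k s -> half_plane (0 <? k)%Z (T s)) /\
  (forall s s', disc k s -> disc k s' -> Cmod (T s - T s') <= 3 * Cmod (s - s'))%R.

(** [|k|] exceeds the constants depending on the bound [L] for [lambda]. *)
Definition large (L : R) (k : Z) : Prop :=
  (4 <= zabs k /\ L + (ln (9 * zabs k) + PI) <= zabs k / 4)%R.

(** For [T s = s] and [lam = log z] this is the equation of [W_k z]. *)
Definition branch_point (T : C -> C) (lam : C) (k : Z) (s : C) : Prop :=
  disc k s /\ s + Clog (T s) = lam + turn k.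

Lemma large_nz (L : R) (k : Z) : large L k -> k <> 0%Z.
Proof. intros [H _] ->; unfold zabs in H; rewrite Rabs_R0 in H; lra. Qed.

Lemma zabs_pos (k : Z) : (0 <= zabs k)%R.
Proof. apply Rabs_pos. Qed.

Lemma zabs_opp (k : Z) : zabs (- k) = zabs k.
Proof. unfold zabs; rewrite opp_IZR; apply Rabs_Ropp. Qed.

Lemma disc_center (k : Z) : disc k (turn k).
Proof.
unfold disc; replace (turn k - turn k) with (RtoC 0) by ring.
rewrite Cmod_0; pose proof (zabs_pos k); lra.
Qed.

(** The Lipschitz bound keeps [T s] within [3/4 |k|] of its value at the centre, so
    the other conditions need only be tested there, with some margin. *)
Lemma tame_intro (T : C -> C) (k : Z) :
  (4 * zabs k <= Cmod (T (turn k)) <= 8 * zabs k)%R -> (0 < zabs k)%R ->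
  (4 * zabs k <= Re (T (turn k)) +
     (if (0 <? k)%Z then Im (T (turn k)) else - Im (T (turn k))))%R ->
  (forall s s', disc k s -> disc k s' -> Cmod (T s - T s') <= 3 * Cmod (s - s'))%R ->
  tame T k.
Proof.
intros Hc Hk Hh HL.
assert (Hd : forall s, disc k s -> (Cmod (T s - T (turn k)) <= 3 / 4 * zabs k)%R).
{ intros s Hs; eapply Rle_trans; [apply HL; [exact Hs | apply disc_center] |].
  unfold disc in Hs; lra. }
split; [| split; [| exact HL]]; intros s Hs; specialize (Hd s Hs).
- pose proof (Cmod_minus_ge (T s) (T (turn k))).
  pose proof (Cmod_minus_ge (T (turn k)) (T s)) as H'.
  rewrite (Cmod_minus_sym _ (T s)) in H'; lra.
- pose proof (re_le_Cmod (T s - T (turn k))) as H1.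
  pose proof (im_le_Cmod (T s - T (turn k))) as H2.
  apply Rabs_le_between in H1; apply Rabs_le_between in H2.
  unfold half_plane, Re, Im in *; simpl in *.
  destruct (0 <? k)%Z; lra.
Qed.

Lemma tame_Clog_lipschitz (T T' : C -> C) (k : Z) (s s' : C) :
  (0 < zabs k)%R -> tame T k -> tame T' k -> disc k s -> disc k s' ->
  (3 * zabs k * Cmod (Clog (T s) - Clog (T' s')) <= 2 * Cmod (T s - T' s'))%R.
Proof.
intros Hk [Hb [Hh _]] [Hb' [Hh' _]] Hs Hs'.
apply Clog_lipschitz.
- specialize (Hb s Hs); lra.
- apply (Hb' s' Hs').
- apply Clog_half_plane with (0 <? k)%Z; auto.
Qed.

(** Since [T] stays at distance of order [|k|] from the origin, [log (T s)] has a
    small Lipschitz constant and a size of order [ln |k|], so that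
    [s |-> lambda + 2 k PI i - log (T s)] is a contraction of the disc. *)
Lemma branch_point_exists (T : C -> C) (lam : C) (k : Z) :
  tame T k -> large (Cmod lam) k -> exists s, branch_point T lam k s.
Proof.
intros HT [Hk Hlam].
destruct (contraction_fixed_point (fun s => lam + turn k - Clog (T s)) (turn k) (zabs k / 4))
  as [s [Hs E]].
- lra.
- intros s Hs.
  replace (lam + turn k - Clog (T s) - turn k) with (lam - Clog (T s)) by ring.
  eapply Rle_trans; [apply Cmod_minus_le |].
  assert (Hb := Clog_bound (T s) (9 * zabs k)).
  destruct (proj1 HT s Hs); lra.
- intros s s' Hs Hs'.
  replace (lam + turn k - Clog (T s) - (lam + turn k - Clog (T s')))
    with (Clog (T s') - Clog (T s)) by ring.
  pose proof (tame_Clog_lipschitz T T k s' s ltac:(lra) HT HT Hs' Hs) as H.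
  pose proof (proj2 (proj2 HT) s' s Hs' Hs) as H'.
  rewrite (Cmod_minus_sym s' s) in H'.
  pose proof (Cmod_ge_0 (Clog (T s') - Clog (T s))).
  nra.
- exists s; split; [exact Hs |].
  rewrite <- E at 1; ring.
Qed.

(** A contraction that moves little has a fixed point that moves little. *)
Lemma branch_point_stable (T T' : C -> C) (lam lam' : C) (k : Z) (s w : C) :
  tame T k -> tame T' k -> (4 <= zabs k)%R ->
  branch_point T lam k s -> branch_point T' lam' k w ->
  (Cmod (s - w) <= 2 * (Cmod (lam - lam') + Cmod (T w - T' w)))%R.
Proof.
intros HT HT' Hk [Hs Es] [Hw Ew].
assert (E : s - w = (lam - lam') - ((Clog (T s) - Clog (T w)) + (Clog (T w) - Clog (T' w)))).
{ replace s with (lam + turn k - Clog (T s)) at 1 by (rewrite <- Es; ring).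
  replace w with (lam' + turn k - Clog (T' w)) at 1 by (rewrite <- Ew; ring).
  ring. }
pose proof (tame_Clog_lipschitz T T k s w ltac:(lra) HT HT Hs Hw) as H1.
pose proof (tame_Clog_lipschitz T T' k w w ltac:(lra) HT HT' Hw Hw) as H2.
pose proof (proj2 (proj2 HT) s w Hs Hw) as H3.
pose proof (Cmod_minus_le (lam - lam')
  ((Clog (T s) - Clog (T w)) + (Clog (T w) - Clog (T' w)))) as H4.
rewrite <- E in H4.
pose proof (Cmod_triangle (Clog (T s) - Clog (T w)) (Clog (T w) - Clog (T' w))) as H5.
pose proof (Cmod_ge_0 (Clog (T s) - Clog (T w))).
pose proof (Cmod_ge_0 (Clog (T w) - Clog (T' w))).
pose proof (Cmod_ge_0 (s - w)).
assert (2 * Cmod (Clog (T s) - Clog (T w)) <= Cmod (s - w))%R by nra.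
assert (Cmod (Clog (T w) - Clog (T' w)) <= Cmod (T w - T' w))%R by nra.
lra.
Qed.

Lemma ln_9_le (x : R) : (1 <= x)%R -> (ln (9 * x) <= 6 * sqrt x)%R.
Proof.
intros Hx.
assert (Hs : (0 < sqrt x)%R) by (apply sqrt_lt_R0; lra).
replace (9 * x)%R with ((3 * sqrt x) * (3 * sqrt x))%R
  by (rewrite <- (sqrt_sqrt x) at 3 by lra; ring).
rewrite ln_mult by lra.
assert (ln (3 * sqrt x) < 3 * sqrt x)%R.
{ rewrite <- (ln_exp (3 * sqrt x)) at 2.
  apply ln_increasing; [lra |].
  pose proof (exp_ineq1_le (3 * sqrt x)); lra. }
lra.
Qed.

(** The displacement is [lam - log (T s)], of order [ln |k|]; the square root is a
    convenient upper bound. *)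
Lemma branch_point_near_center (T : C -> C) (lam : C) (k : Z) (s : C) :
  tame T k -> (4 <= zabs k)%R -> branch_point T lam k s ->
  (Cmod (s - turn k) <= (Cmod lam + 10) * sqrt (zabs k))%R.
Proof.
intros HT Hk [Hs E].
replace (s - turn k) with (lam - Clog (T s)).
2:{ replace s with (lam + turn k - Clog (T s)) at 2 by (rewrite <- E; ring); ring. }
eapply Rle_trans; [apply Cmod_minus_le |].
assert (Hb := Clog_bound (T s) (9 * zabs k)).
destruct (proj1 HT s Hs).
pose proof (ln_9_le (zabs k) ltac:(lra)); pose proof PI_4.
assert (1 <= sqrt (zabs k))%R by (rewrite <- sqrt_1; apply sqrt_le_1; lra).
pose proof (Cmod_ge_0 lam); nra.
Qed.

Lemma large_eventually (L : R) : exists K : nat, forall k : Z,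
  (Z.of_nat K < Z.abs k)%Z -> large L k.
Proof.
destruct (nfloor_ex (Rabs L * 8 + 700)) as [K HK]; [pose proof (Rabs_pos L); lra |].
exists (S K); intros k Hk.
apply Zlt_le_weak, IZR_le in Hk; rewrite <- INR_IZR_INZ, S_INR, abs_IZR in Hk.
fold (zabs k) in Hk.
pose proof (Rabs_pos L); pose proof (Rle_abs L).
assert (700 + 8 * Rabs L <= zabs k)%R by lra.
split; [lra |].
pose proof (ln_9_le (zabs k) ltac:(lra)); pose proof PI_4.
pose proof (sqrt_sqrt (zabs k) ltac:(lra)).
assert (6 * sqrt (zabs k) <= zabs k / 8 + 72)%R.
{ pose proof (pow2_ge_0 (sqrt (zabs k) - 24)); simpl in *; nra. }
lra.
Qed.

(** * The identity and its finite counterpart *)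

Lemma tame_id (k : Z) : k <> 0%Z -> tame (fun s => s) k.
Proof.
intros Hk.
assert (Hz : (0 < zabs k)%R) by (apply Rabs_pos_lt, eq_IZR_contrapositive, Hk).
assert (Hm : Cmod (turn k) = (2 * PI * zabs k)%R).
{ unfold turn; rewrite !Cmod_mult, Cmod_Ci, !Cmod_R; unfold zabs.
  pose proof PI_RGT_0; rewrite (Rabs_pos_eq PI), (Rabs_pos_eq 2) by lra; ring. }
pose proof PI_4; pose proof PI2_1.
apply tame_intro; [rewrite Hm; nra | exact Hz | | intros; pose proof (Cmod_ge_0 (s - s')); lra].
rewrite turn_pair; unfold Re, Im; simpl.
unfold zabs in *; destruct (Z.ltb_spec 0 k) as [H1 | H1]; apply IZR_lt in H1 || apply IZR_le in H1.
- rewrite Rabs_pos_eq in * by lra; nra.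
- rewrite Rabs_left1 in * by lra; nra.
Qed.

(** The map tends to the identity as [N] grows, and [1 - euler_map N s / N] has the
    [N]-th power [exp (- s)]. *)
Definition euler_map (N : R) (s : C) : C := RtoC N * (1 - Cexp (- (s / RtoC N))).

Lemma exp_8th : (exp (1 / 8) <= 8 / 7)%R.
Proof.
assert (H := exp_ineq1_le (- (1 / 8))).
replace (exp (1 / 8)) with (/ exp (- (1 / 8)))%R by (rewrite exp_Ropp, Rinv_inv; reflexivity).
replace (8 / 7)%R with (/ (1 + - (1 / 8)))%R by field.
apply Rinv_le_contravar; lra.
Qed.

Lemma Re_div_R (s : C) (N : R) : N <> 0%R -> Re (s / RtoC N) = (Re s / N)%R.
Proof.
intros HN; unfold Cdiv; rewrite <- RtoC_inv by exact HN; apply re_scal_r.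
Qed.

Lemma euler_map_lipschitz (N : R) (k : Z) (s s' : C) :
  (0 < N)%R -> (2 * zabs k <= N)%R -> disc k s -> disc k s' ->
  (Cmod (euler_map N s - euler_map N s') <= 3 * Cmod (s - s'))%R.
Proof.
intros HN Hk Hs Hs'.
assert (HN0 : RtoC N <> 0) by (intros E; apply RtoC_inj in E; lra).
replace (euler_map N s - euler_map N s')
  with (RtoC N * (Cexp (- (s' / RtoC N)) * - (Cexp ((s' - s) / RtoC N) - 1))).
2:{ unfold euler_map.
    replace (Cexp (- (s / RtoC N))) with (Cexp (- (s' / RtoC N)) * Cexp ((s' - s) / RtoC N))
      by (rewrite <- Cexp_plus; f_equal; field; exact HN0).
    ring. }
rewrite !Cmod_mult, Cmod_opp, Cmod_R, Cmod_Cexp, Rabs_pos_eq by lra.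
pose proof (zabs_pos k) as Hz.
assert (Hd : (Cmod (s' - s) <= zabs k / 2)%R).
{ replace (s' - s) with ((s' - turn k) - (s - turn k)) by ring.
  eapply Rle_trans; [apply Cmod_minus_le |]; unfold disc in *; lra. }
assert (Hm : Cmod ((s' - s) / RtoC N) = (Cmod (s - s') / N)%R).
{ rewrite Cmod_div, Cmod_R, Rabs_pos_eq, Cmod_minus_sym by (lra || exact HN0); reflexivity. }
pose proof (Cexp_minus_1_bound ((s' - s) / RtoC N)) as Hb; rewrite Hm in Hb.
rewrite Cmod_minus_sym in Hd.
pose proof exp_8th as H8.
assert (H1 : (exp (Re (- (s' / RtoC N))) <= 8 / 7)%R).
{ eapply Rle_trans; [apply exp_le | exact H8].
  change (Re (- (s' / N))) with (- Re (s' / N))%R; rewrite Re_div_R by lra.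
  unfold disc in Hs'.
  pose proof (re_le_Cmod (s' - turn k)) as H; rewrite turn_pair in *.
  apply Rabs_le_between in H; unfold Re in *; simpl in *.
  apply Ropp_le_cancel; rewrite Ropp_involutive; apply Rle_div_r; lra. }
assert (H2 : (exp (Cmod (s - s') / N) <= 8 / 7 * (8 / 7))%R).
{ apply Rle_trans with (exp (1 / 8 + 1 / 8)).
  - apply exp_le, Rle_div_l; lra.
  - rewrite exp_plus; apply Rmult_le_compat; try (left; apply exp_pos); exact H8. }
(* [2 (8/7)^3 < 3] *)
pose proof (exp_pos (Cmod (s - s') / N)); pose proof (exp_pos (Re (- (s' / RtoC N)))).
pose proof (Cmod_ge_0 (s - s')).
assert (Hq : (0 <= Cmod (s - s') / N)%R) by (apply Rdiv_le_0_compat; lra).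
apply Rle_trans with (N * (8 / 7 * (2 * (Cmod (s - s') / N) * (8 / 7 * (8 / 7)))))%R.
- apply Rmult_le_compat_l; [lra |].
  apply Rmult_le_compat; [lra | apply Cmod_ge_0 | lra |].
  eapply Rle_trans; [exact Hb |].
  apply Rmult_le_compat_l; lra.
- replace (N * (8 / 7 * (2 * (Cmod (s - s') / N) * (8 / 7 * (8 / 7)))))%R
    with (1024 / 343 * Cmod (s - s'))%R by (field; lra).
  lra.
Qed.

(** At the centre, with [v = PI |k| / N <= PI / 2], the value is
    [2 N sin v (sin v + i cos v)] or its conjugate; Jordan's inequality gives
    [N sin v >= 2 |k|]. *)
Lemma tame_euler_map (N : R) (k : Z) :
  k <> 0%Z -> (2 * zabs k <= N)%R -> tame (euler_map N) k.
Proof.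
intros Hk HkN.
assert (Hz : (0 < zabs k)%R) by (apply Rabs_pos_lt, eq_IZR_contrapositive, Hk).
pose proof PI_RGT_0 as Hpi; pose proof PI_4 as Hpi4.
set (v := (PI * zabs k / N)%R).
assert (Hv : (0 <= v <= PI / 2)%R).
{ unfold v; split; [apply Rdiv_le_0_compat; nra |].
  apply Rle_div_l; nra. }
assert (HvN : (v * N = PI * zabs k)%R) by (unfold v; field; lra).
set (sg := (if (0 <? k)%Z then 1 else -1)%R).
assert (Hsg : (IZR k = sg * zabs k /\ sg * sg = 1)%R).
{ unfold sg, zabs; destruct (Z.ltb_spec 0 k) as [H1 | H1]; [apply IZR_lt in H1 | apply IZR_le in H1].
  - rewrite Rabs_pos_eq by lra; lra.
  - rewrite Rabs_left1 by lra; lra. }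
destruct Hsg as [Hsg Hsg2].
assert (E : euler_map N (turn k) = (N * (2 * (sin v * sin v)), N * (sg * (2 * sin v * cos v)))%R).
{ unfold euler_map.
  replace (- (turn k / RtoC N)) with ((0, - (sg * (2 * v)))%R : C).
  - unfold Cexp; simpl; rewrite exp_0, cos_neg, sin_neg.
    assert (Hcs : cos (sg * (2 * v)) = cos (2 * v) /\ sin (sg * (2 * v)) = (sg * sin (2 * v))%R).
    { unfold sg; destruct (0 <? k)%Z.
      - rewrite !Rmult_1_l; split; ring.
      - replace (-1 * (2 * v))%R with (- (2 * v))%R by ring.
        rewrite cos_neg, sin_neg; split; ring. }
    destruct Hcs as [-> ->]; rewrite cos_2a_sin, sin_2a.
    C_ext.
  - rewrite turn_pair; unfold Cdiv; rewrite <- RtoC_inv by lra.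
    rewrite Hsg; unfold v; apply injective_projections; simpl; field; lra. }
pose proof (jordan_sin v Hv) as Hj.
assert (Hs0 : (0 <= sin v)%R) by (apply sin_ge_0; lra).
assert (Hc0 : (0 <= cos v)%R) by (apply cos_ge_0; lra).
assert (Hsv : (sin v <= v)%R).
{ destruct (Req_dec v 0) as [-> | Hn]; [rewrite sin_0; lra |].
  left; apply sin_lt_x; lra. }
assert (Hsc : (sin v * sin v + cos v * cos v = 1)%R).
{ pose proof (sin2_cos2 v) as H; unfold Rsqr in H; exact H. }
assert (HNs : (2 * zabs k <= N * sin v)%R) by nra.
assert (HNs2 : (N * sin v <= 4 * zabs k)%R) by nra.
assert (Hm : Cmod (euler_map N (turn k)) = (2 * (N * sin v))%R).
{ rewrite E; unfold Cmod; simpl.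
  replace (_ + _)%R with ((2 * (N * sin v)) * (2 * (N * sin v)) *
     (sin v * sin v + (sg * sg) * (cos v * cos v)))%R by ring.
  rewrite Hsg2, Rmult_1_l, Hsc, Rmult_1_r.
  apply sqrt_square; lra. }
apply tame_intro.
- rewrite Hm; lra.
- exact Hz.
- rewrite E; unfold Re, Im; simpl.
  assert (Hsum : (1 <= sin v + cos v)%R) by nra.
  apply Rle_trans with (2 * (N * sin v) * (sin v + cos v))%R; [nra |].
  unfold sg; destruct (0 <? k)%Z; right; ring.
- intros s s' Hs Hs'; apply euler_map_lipschitz with k; assumption || lra.
Qed.

Lemma euler_map_cvg (w : C) (N : nat -> nat) :
  is_lim_seq (fun m => INR (N m)) p_infty ->
  Ccvg (fun m => euler_map (INR (N m)) w) w.
Proof.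
intros HN.
apply Ccvg_le with (fun m => 8 * (Cmod w * Cmod w) * / INR (N m))%R.
- apply is_lim_seq_spec in HN.
  generalize (HN (1 + 2 * Cmod w)%R); apply filter_imp; intros m Hm.
  pose proof (Cmod_ge_0 w) as Hw.
  assert (Hn0 : RtoC (INR (N m)) <> 0) by (intros E; apply RtoC_inj in E; lra).
  set (n := INR (N m)) in *.
  replace (euler_map n w - w)
    with (- RtoC n * (Cexp (- (w / RtoC n)) - 1 - - (w / RtoC n)))
    by (unfold euler_map; field; exact Hn0).
  assert (Hmod : Cmod (- (w / RtoC n)) = (Cmod w / n)%R).
  { rewrite Cmod_opp, Cmod_div, Cmod_R, Rabs_pos_eq; auto; lra. }
  pose proof (Cexp_minus_1_minus_id_bound (- (w / RtoC n))) as H; rewrite Hmod in H.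
  rewrite Cmod_mult, Cmod_opp, Cmod_R, Rabs_pos_eq by lra.
  apply Rle_trans with (n * (8 * (Cmod w / n * (Cmod w / n))))%R.
  + apply Rmult_le_compat_l; [lra |]; apply H, Rle_div_l; lra.
  + right; field; lra.
- now apply is_lim_seq_scal_0, is_lim_seq_inv_p_infty.
Qed.

(** * Existence and uniqueness of the Lambert branches *)

Lemma Cmod_polar (z : C) : z <> 0 ->
  (Re z = Cmod z * cos (Im (Clog z)) /\ Im z = Cmod z * sin (Im (Clog z)))%R.
Proof.
intros Hz; pose proof (Cexp_Clog z Hz) as E; pose proof (Cmod_exp_Clog z Hz) as Em.
unfold Cexp in E; rewrite Em in E.
split; rewrite <- E at 1; reflexivity.
Qed.

Lemma Im_Clog_pos (z : C) : (0 < Im z)%R -> (0 < Im (Clog z) < PI)%R.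
Proof.
intros H.
assert (Hz : z <> 0) by (intros ->; simpl in H; lra).
destruct (Cmod_polar z Hz) as [_ E].
pose proof (Im_Clog_bounds z Hz) as Hb; pose proof (proj1 (Cmod_gt_0 z) Hz) as Hm.
set (a := Im (Clog z)) in *.
assert (Hs : (0 < sin a)%R) by (rewrite E in H; nra).
split; apply Rnot_le_lt; intros H1.
- pose proof (sin_ge_0 (- a) ltac:(lra) ltac:(lra)) as H2; rewrite sin_neg in H2; lra.
- replace a with PI in Hs by lra; rewrite sin_PI in Hs; lra.
Qed.

Lemma Im_Clog_neg (z : C) : (Im z < 0)%R -> (- PI < Im (Clog z) < 0)%R.
Proof.
intros H.
assert (Hz : z <> 0) by (intros ->; simpl in H; lra).
destruct (Cmod_polar z Hz) as [_ E].
pose proof (Im_Clog_bounds z Hz) as Hb; pose proof (proj1 (Cmod_gt_0 z) Hz) as Hm.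
set (a := Im (Clog z)) in *.
assert (Hs : (sin a < 0)%R) by (rewrite E in H; nra).
split; [lra |]; apply Rnot_le_lt; intros H1.
pose proof (sin_ge_0 a ltac:(lra) ltac:(lra)); lra.
Qed.

Lemma Clog_pos_real (a : R) : (0 < a)%R -> Clog (RtoC a) = (ln a, 0)%R.
Proof.
intros Ha; pose proof PI_RGT_0; apply Clog_unique.
- intros E; apply RtoC_inj in E; lra.
- unfold Cexp; simpl; rewrite exp_ln, cos_0, sin_0 by assumption; C_ext.
- simpl; lra.
Qed.

Lemma Clog_neg_real (a : R) : (a < 0)%R -> Clog (RtoC a) = (ln (- a), PI)%R.
Proof.
intros Ha; pose proof PI_RGT_0; apply Clog_unique.
- intros E; apply RtoC_inj in E; lra.
- unfold Cexp; simpl; rewrite exp_ln, cos_PI, sin_PI by lra; C_ext.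
- simpl; lra.
Qed.

Lemma Clog_conj (z : C) : Im z <> 0%R -> Clog (Cconj z) = Cconj (Clog z).
Proof.
intros H.
assert (Hz : z <> 0) by (intros ->; simpl in H; lra).
apply Clog_unique.
- intros E; apply H; apply (f_equal Im) in E; unfold Im in *; simpl in *; lra.
- now rewrite Cexp_conj, Cexp_Clog.
- assert (Hb : (- PI < Im (Clog z) < PI)%R).
  { destruct (Rtotal_order (Im z) 0) as [H1 | [H1 | H1]]; [| lra |].
    - pose proof (Im_Clog_neg z H1); pose proof PI_RGT_0; lra.
    - pose proof (Im_Clog_pos z H1); lra. }
  unfold Im in *; simpl in *; lra.
Qed.

Lemma ln_le_minus_1 (x : R) : (0 < x)%R -> (ln x <= x - 1)%R.
Proof.
intros Hx; pose proof (exp_ineq1_le (ln x)) as H; rewrite exp_ln in H by assumption; lra.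
Qed.

(** The real part of [w + log w] along the curve [Im (w + log w) = beta] of the
    upper half-plane, parametrised by [b = Im w]: there [w] has argument
    [beta - b], hence [w = b cot (beta - b) + i b] and [|w| = b / sin (beta - b)]. *)
Definition curve_re (beta b : R) : R :=
  (b * (cos (beta - b) / sin (beta - b)) + ln b - ln (sin (beta - b)))%R.

Definition curve_dom (beta b : R) : Prop := (0 < b /\ 0 < beta - b < PI)%R.

Lemma curve_re_derive (beta b : R) : curve_dom beta b ->
  is_derive (curve_re beta) b
    ((b * b * (sin (beta - b) ^ 2 + cos (beta - b) ^ 2)
      + 2 * b * sin (beta - b) * cos (beta - b) + sin (beta - b) ^ 2)
      / (b * sin (beta - b) ^ 2))%R.
Proof.
intros [Hb Hphi].
assert (Hs : (0 < sin (beta - b))%R) by (apply sin_gt_0; lra).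
unfold curve_re; auto_derive.
- change (beta + - b)%R with (beta - b)%R; repeat split; lra.
- change (beta + - b)%R with (beta - b)%R; field; split; lra.
Qed.

Lemma curve_re_incr (beta b b' : R) :
  curve_dom beta b -> curve_dom beta b' -> (b < b')%R ->
  (curve_re beta b < curve_re beta b')%R.
Proof.
intros H H' Hlt.
apply (incr_function (curve_re beta) (Rmax 0 (beta - PI)) beta
  (fun b => ((b * b * (sin (beta - b) ^ 2 + cos (beta - b) ^ 2)
      + 2 * b * sin (beta - b) * cos (beta - b) + sin (beta - b) ^ 2)
      / (b * sin (beta - b) ^ 2))%R)).
- intros u H1 H2; simpl in *; apply Rmax_Rlt in H1; apply curve_re_derive; split; lra.
- intros u H1 H2; simpl in *; apply Rmax_Rlt in H1.
  assert (Hs : (0 < sin (beta - u))%R) by (apply sin_gt_0; lra).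
  apply Rdiv_lt_0_compat.
  + (* the numerator is [(u + sin cos)^2 + sin^4] *)
    pose proof (sin2_cos2 (beta - u)) as E; unfold Rsqr in E; revert Hs E.
    generalize (sin (beta - u)) (cos (beta - u)); intros sn cs Hs E.
    apply Rlt_le_trans with ((u + sn * cs) ^ 2 + sn ^ 4)%R.
    * pose proof (pow2_ge_0 (u + sn * cs)); pose proof (pow_lt _ 4 Hs); lra.
    * right; replace (cs * (cs * 1))%R with (1 - sn * sn)%R by lra.
      replace (sn ^ 4)%R with (sn ^ 2 * (1 - cs * cs))%R; [ring |].
      replace (1 - cs * cs)%R with (sn * sn)%R by lra; ring.
  + apply Rmult_lt_0_compat; [lra | nra].
- destruct H; simpl; apply Rmax_lub_lt; lra.
- exact Hlt.
- destruct H'; simpl; lra.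
Qed.

(** As [b] tends to [beta] the argument of [w] tends to [0], and [|w|] to infinity. *)
Lemma curve_re_large (beta c : R) : (0 < beta)%R ->
  exists b, curve_dom beta b /\ (c < curve_re beta b)%R.
Proof.
intros Hb.
set (m := Rmin (beta / 2) (Rmin 1 (beta / 2 * exp (- c - 1)))).
assert (Hm : (0 < m)%R).
{ unfold m; repeat apply Rmin_glb_lt; try lra.
  apply Rmult_lt_0_compat; [lra | apply exp_pos]. }
assert (Hm1 : (m <= beta / 2)%R) by apply Rmin_l.
assert (Hm2 : (m <= 1)%R) by (unfold m; rewrite Rmin_r; apply Rmin_l).
assert (Hm3 : (m <= beta / 2 * exp (- c - 1))%R) by (unfold m; rewrite Rmin_r; apply Rmin_r).
pose proof PI2_1; exists (beta - m)%R; split; [split; lra |].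
unfold curve_re; replace (beta - (beta - m))%R with m by ring.
assert (Hs : (0 < sin m)%R) by (apply sin_gt_0; lra).
assert (Hc : (0 <= cos m)%R) by (apply cos_ge_0; lra).
assert (H1 : (0 <= (beta - m) * (cos m / sin m))%R)
  by (apply Rmult_le_pos; [lra | apply Rdiv_le_0_compat; lra]).
assert (H2 : (ln (beta / 2) <= ln (beta - m))%R) by (apply ln_le; lra).
assert (H3 : (ln (sin m) <= ln (beta / 2) + (- c - 1))%R).
{ rewrite <- (ln_exp (- c - 1)), <- ln_mult by (lra || apply exp_pos).
  apply ln_le; [exact Hs |].
  pose proof (sin_lt_x m Hm); lra. }
lra.
Qed.

(** The curve ends at the origin, where [log w] tends to minus infinity. *)
Lemma curve_re_small_lt_PI (beta c : R) : (0 < beta < PI)%R ->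
  exists b, curve_dom beta b /\ (curve_re beta b < c)%R.
Proof.
intros Hb.
(* a lower bound for [sin (beta - b)] when [b <= beta / 2] *)
set (mu := Rmin (sin (beta / 2)) (sin beta)).
assert (Hmu : (0 < mu)%R) by (apply Rmin_glb_lt; apply sin_gt_0; lra).
assert (Hsin : forall u, (beta / 2 <= u <= beta)%R -> (mu <= sin u)%R).
{ intros u Hu; pose proof PI_RGT_0.
  destruct (Rle_dec u (PI / 2)) as [Hu1 | Hu1].
  - eapply Rle_trans; [apply Rmin_l |]; apply sin_incr_1; lra.
  - eapply Rle_trans; [apply Rmin_r |]; apply sin_decr_1; lra. }
clearbody mu.
set (b := Rmin (beta / 2) (Rmin mu (exp (c - 2 + ln mu)))).
assert (Hb0 : (0 < b)%R).
{ unfold b; repeat apply Rmin_glb_lt; try lra; apply exp_pos. }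
assert (Hb1 : (b <= beta / 2)%R) by apply Rmin_l.
assert (Hb2 : (b <= mu)%R) by (unfold b; rewrite Rmin_r; apply Rmin_l).
assert (Hb3 : (b <= exp (c - 2 + ln mu))%R) by (unfold b; rewrite Rmin_r; apply Rmin_r).
exists b; split; [split; lra |].
unfold curve_re.
specialize (Hsin (beta - b)%R ltac:(lra)).
assert (H1 : (b * (cos (beta - b) / sin (beta - b)) <= 1)%R).
{ replace (b * (cos (beta - b) / sin (beta - b)))%R
    with (b * cos (beta - b) / sin (beta - b))%R by (field; lra).
  apply Rle_div_l; [lra |].
  pose proof (COS_bound (beta - b)); nra. }
assert (H2 : (ln mu <= ln (sin (beta - b)))%R) by (apply ln_le; lra).
assert (H3 : (ln b <= c - 2 + ln mu)%R).
{ rewrite <- (ln_exp (c - 2 + ln mu)); now apply ln_le. }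
lra.
Qed.

(** The curve ends at [w = -1], where [w + log w] is [-1 + PI i]. *)
Lemma curve_re_small_PI (c : R) : (-1 < c)%R ->
  exists b, curve_dom PI b /\ (curve_re PI b < c)%R.
Proof.
intros Hc.
set (b := Rmin 1 ((c + 1) / 2)).
assert (Hb0 : (0 < b)%R) by (apply Rmin_glb_lt; lra).
assert (Hb1 : (b <= 1)%R) by apply Rmin_l.
assert (Hb2 : (b <= (c + 1) / 2)%R) by apply Rmin_r.
pose proof PI2_1; exists b; split; [split; lra |].
unfold curve_re; rewrite cos_minus, sin_minus, cos_PI, sin_PI.
replace (-1 * cos b + 0 * sin b)%R with (- cos b)%R by ring.
replace (0 * cos b - -1 * sin b)%R with (sin b)%R by ring.
pose proof (cos_lower b) as Hcos.
assert (Hs : (0 < sin b)%R) by (apply sin_gt_0; lra).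
assert (Hsb : (sin b < b)%R) by (apply sin_lt_x; lra).
assert (Hsl : (b * cos b <= sin b)%R).
{ destruct (MVT_cor2 sin cos 0 b Hb0) as [d [E Hd]]; [intros; apply derivable_pt_lim_sin |].
  rewrite sin_0 in E.
  assert (cos b <= cos d)%R by (apply cos_decr_1; lra).
  nra. }
assert (Hbb : (b * b <= b)%R) by nra.
assert (Hcos0 : (1 / 2 <= cos b)%R) by nra.
assert (H1 : (cos b <= b * cos b / sin b)%R) by (apply Rle_div_r; nra).
assert (H2 : (ln b - ln (sin b) <= b / sin b - 1)%R).
{ rewrite <- ln_div by lra; apply ln_le_minus_1, Rdiv_lt_0_compat; lra. }
assert (H3 : (b / sin b <= 1 + b * b)%R).
{ apply Rle_div_l; [lra |].
  assert (H4 : (b * (1 - b * b / 2) <= sin b)%R) by nra.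
  apply Rle_trans with ((1 + b * b) * (b * (1 - b * b / 2)))%R; [| apply Rmult_le_compat_l; nra].
  assert (H5 : (0 <= b * b * (1 - b * b))%R) by (apply Rmult_le_pos; nra).
  nra. }
replace (b * (- cos b / sin b))%R with (- (b * cos b / sin b))%R by (field; lra).
nra.
Qed.

(** The curve goes to infinity along [Im w = beta - PI], to the left; [Re w] wins over
    the logarithm. *)
Lemma curve_re_small_gt_PI (beta c : R) : (PI < beta)%R ->
  exists b, curve_dom beta b /\ (curve_re beta b < c)%R.
Proof.
intros Hbeta.
pose proof PI2_1 as Hpi; pose proof PI_4 as Hpi4.
remember (beta - PI)%R as b0 eqn:Eb0; assert (Hb0 : (0 < b0)%R) by lra.
set (A := (ln (b0 + 1) - ln (b0 / 8) - c + 1)%R).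
set (v := Rmin 1 (b0 / (4 * (Rabs A + 1)))).
pose proof (Rabs_pos A) as HA0; pose proof (Rle_abs A) as HA1.
assert (Hv0 : (0 < v)%R).
{ apply Rmin_glb_lt; [lra |]; apply Rdiv_lt_0_compat; lra. }
assert (Hv1 : (v <= 1)%R) by apply Rmin_l.
assert (Hv2 : (v * (4 * (Rabs A + 1)) <= b0)%R).
{ apply Rle_div_r; [lra | apply Rmin_r]. }
exists (b0 + v)%R; split; [unfold curve_dom; lra |].
unfold curve_re.
replace (beta - (b0 + v))%R with (PI - v)%R by (rewrite Eb0; ring).
rewrite cos_minus, sin_minus, cos_PI, sin_PI.
replace (-1 * cos v + 0 * sin v)%R with (- cos v)%R by ring.
replace (0 * cos v - -1 * sin v)%R with (sin v)%R by ring.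
pose proof (cos_lower v) as Hcos.
assert (Hs : (0 < sin v)%R) by (apply sin_gt_0; lra).
assert (Hsv : (sin v < v)%R) by (apply sin_lt_x; lra).
pose proof (jordan_sin v ltac:(lra)) as Hj.
assert (Hsl : (v / 2 <= sin v)%R) by nra.
assert (H1 : (b0 / (2 * v) <= (b0 + v) * (cos v / sin v))%R).
{ apply Rle_trans with (b0 * (/ 2 / v))%R; [right; field; lra |].
  apply Rmult_le_compat; [lra | apply Rdiv_le_0_compat; lra | lra |].
  apply Rle_trans with (cos v / v)%R.
  - apply Rmult_le_compat_r; [left; now apply Rinv_0_lt_compat | nra].
  - apply Rmult_le_compat_l; [nra |]; apply Rinv_le_contravar; lra. }
assert (H2 : (ln (b0 + v) <= ln (b0 + 1))%R) by (apply ln_le; lra).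
assert (H3 : (- ln (sin v) <= ln (2 / v))%R).
{ rewrite <- ln_Rinv by exact Hs; apply ln_le; [now apply Rinv_0_lt_compat |].
  replace (2 / v)%R with (/ (v / 2))%R by (field; lra).
  apply Rinv_le_contravar; lra. }
assert (H4 : (ln (2 / v) <= b0 / (4 * v) - ln (b0 / 8))%R).
{ assert (H : (ln (2 / v * (b0 / 8)) <= 2 / v * (b0 / 8) - 1)%R).
  { apply ln_le_minus_1, Rmult_lt_0_compat; [apply Rdiv_lt_0_compat |]; lra. }
  rewrite ln_mult in H by (try apply Rdiv_lt_0_compat; lra).
  replace (b0 / (4 * v))%R with (2 / v * (b0 / 8))%R by (field; lra).
  lra. }
assert (H5 : (Rabs A + 1 <= b0 / (4 * v))%R) by (apply Rle_div_r; lra).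
replace (b0 / (2 * v))%R with (2 * (b0 / (4 * v)))%R in H1 by (field; lra).
replace ((b0 + v) * (- cos v / sin v))%R with (- ((b0 + v) * (cos v / sin v)))%R by (field; lra).
unfold A in *; lra.
Qed.

Definition omega_eq (c beta : R) (w : C) : Prop :=
  w <> 0 /\ w + Clog w = (c, beta).

Lemma omega_eq_upper (c beta : R) (w : C) : (0 < Im w)%R ->
  (omega_eq c beta w <->
   curve_dom beta (Im w) /\ curve_re beta (Im w) = c /\
   Re w = (Im w * (cos (beta - Im w) / sin (beta - Im w)))%R).
Proof.
intros Hi.
assert (Hw : w <> 0) by (intros ->; simpl in Hi; lra).
pose proof (Im_Clog_pos w Hi) as Ha.
pose proof (proj1 (Cmod_gt_0 w) Hw) as Hm.
destruct (Cmod_polar w Hw) as [E1 E2].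
unfold curve_re; split.
- intros [_ E].
  assert (Er : (Re w + ln (Cmod w) = c)%R) by (apply (f_equal Re) in E; exact E).
  assert (Ei : (Im (Clog w) = beta - Im w)%R).
  { apply (f_equal Im) in E; unfold Im in *; simpl in *; lra. }
  rewrite Ei in *.
  assert (Hs : (0 < sin (beta - Im w))%R) by (apply sin_gt_0; lra).
  assert (Er' : Re w = (Im w * (cos (beta - Im w) / sin (beta - Im w)))%R).
  { rewrite E1; revert E2 Hs; generalize (sin (beta - Im w)) (cos (beta - Im w)).
    intros sn cs E2 Hs; rewrite E2; field; lra. }
  assert (El : (ln (Im w) = ln (Cmod w) + ln (sin (beta - Im w)))%R)
    by (rewrite <- ln_mult by lra; f_equal; exact E2).
  split; [split; lra | split; [| exact Er']].
  rewrite <- Er, <- Er', El; ring.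
- intros [[_ Hd] [Ec Er]]; split; [exact Hw |].
  assert (Hs : (0 < sin (beta - Im w))%R) by (apply sin_gt_0; lra).
  pose proof PI_RGT_0.
  set (r := (Im w / sin (beta - Im w))%R).
  assert (Hr : (0 < r)%R) by (apply Rdiv_lt_0_compat; lra).
  assert (El : Clog w = (ln r, beta - Im w)%R).
  { apply Clog_unique; [exact Hw | | simpl; lra].
    unfold Cexp; simpl; rewrite exp_ln by exact Hr.
    apply injective_projections; simpl; unfold r.
    - transitivity (Re w); [rewrite Er; field; lra | reflexivity].
    - transitivity (Im w); [field; lra | reflexivity]. }
  rewrite El; apply injective_projections; simpl.
  + rewrite <- Ec; change (fst w) with (Re w); rewrite Er; unfold r.
    rewrite ln_div by lra; ring.
  + unfold Im; ring.
Qed.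

Lemma omega_eq_upper_exists (c beta : R) : (0 < beta)%R -> (beta = PI -> -1 < c)%R ->
  exists w, (0 < Im w)%R /\ omega_eq c beta w.
Proof.
intros Hb Hc.
destruct (curve_re_large beta c Hb) as [b2 [D2 H2]].
assert (Hsmall : exists b, curve_dom beta b /\ (curve_re beta b < c)%R).
{ destruct (Rtotal_order beta PI) as [H | [H | H]].
  - apply curve_re_small_lt_PI; lra.
  - rewrite H; apply curve_re_small_PI; auto.
  - now apply curve_re_small_gt_PI. }
destruct Hsmall as [b1 [D1 H1]].
assert (Hlt : (b1 < b2)%R).
{ destruct (Rtotal_order b1 b2) as [H | [H | H]]; [exact H | subst; lra |].
  pose proof (curve_re_incr beta b2 b1 D2 D1 H); lra. }
destruct (IVT_interv (fun b => curve_re beta b - c)%R b1 b2) as [b [Hbb E]].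
- intros b H.
  apply continuity_pt_minus; [| now apply continuity_pt_const].
  assert (Hd : curve_dom beta b) by (unfold curve_dom in *; lra).
  apply derivable_continuous_pt.
  eexists; apply is_derive_Reals, (curve_re_derive beta b Hd).
- exact Hlt.
- lra.
- lra.
- assert (Hd : curve_dom beta b) by (unfold curve_dom in *; lra).
  exists (b * (cos (beta - b) / sin (beta - b)), b)%R; split; [apply Hd |].
  apply omega_eq_upper; [apply Hd |]; simpl.
  split; [exact Hd | split; [lra | reflexivity]].
Qed.

Lemma omega_eq_upper_unique (c beta : R) (w w' : C) :
  (0 < Im w)%R -> (0 < Im w')%R -> omega_eq c beta w -> omega_eq c beta w' -> w = w'.
Proof.
intros Hi Hi' H H'.
apply omega_eq_upper in H as [D [E R]]; [| exact Hi].
apply omega_eq_upper in H' as [D' [E' R']]; [| exact Hi'].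
assert (Im w = Im w').
{ destruct (Rtotal_order (Im w) (Im w')) as [Hlt | [Heq | Hlt]]; [| exact Heq |].
  - pose proof (curve_re_incr _ _ _ D D' Hlt); lra.
  - pose proof (curve_re_incr _ _ _ D' D Hlt); lra. }
apply injective_projections; [| assumption].
change (Re w = Re w'); congruence.
Qed.

Lemma real_of_Im_0 (z : C) : Im z = 0%R -> z = RtoC (Re z).
Proof. intros H; apply injective_projections; [reflexivity | exact H]. Qed.

(** A solution on the real axis has [beta = 0] or [beta = PI], and in the second
    case [c <= -1] because [a + ln (- a) <= -1] for [a < 0]. *)
Lemma omega_eq_location (c beta : R) (w : C) : omega_eq c beta w ->
  (0 < beta /\ 0 < Im w \/ beta < 0 /\ Im w < 0 \/
   beta = 0 /\ 0 < Re w /\ Im w = 0 /\ Re w + ln (Re w) = c \/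
   beta = PI /\ c <= -1 /\ Im w = 0)%R.
Proof.
intros [Hw E].
assert (Ei : (Im w + Im (Clog w) = beta)%R) by (apply (f_equal Im) in E; exact E).
destruct (Rtotal_order (Im w) 0) as [H | [H | H]].
- pose proof (Im_Clog_neg w H); right; left; lra.
- right; right.
  pose proof (real_of_Im_0 w H) as Ew.
  destruct (Rtotal_order (Re w) 0) as [H1 | [H1 | H1]].
  + right; rewrite Ew, Clog_neg_real in E by exact H1.
    injection E as E1 E2; simpl in *.
    pose proof (ln_le_minus_1 (- Re w) ltac:(lra)); lra.
  + exfalso; apply Hw; rewrite Ew, H1; reflexivity.
  + left; rewrite Ew, Clog_pos_real in E by exact H1.
    injection E as E1 E2; simpl in *; lra.
- pose proof (Im_Clog_pos w H); left; lra.
Qed.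

Lemma omega_eq_conj (c beta : R) (w : C) :
  Im w <> 0%R -> omega_eq c beta w -> omega_eq c (- beta) (Cconj w).
Proof.
intros Hi [Hw E]; split.
- intros E'; apply Hi; apply (f_equal Im) in E'; unfold Im in *; simpl in *; lra.
- rewrite Clog_conj by exact Hi.
  replace (Cconj w + Cconj (Clog w)) with (Cconj (w + Clog w)) by C_ext.
  rewrite E; reflexivity.
Qed.

Lemma Cconj_involutive (z : C) : Cconj (Cconj z) = z.
Proof. C_ext. Qed.

(** The sign of [beta] decides between the upper half-plane, the lower one, which is
    its mirror image, and the positive real axis.  The excluded values are those
    for which negative real solutions interfere. *)
Lemma omega_eq_exists_unique (c beta : R) :
  (Rabs beta = PI -> -1 < c)%R -> exists w, unique (omega_eq c beta) w.
Proof.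
intros Hc; pose proof PI_RGT_0 as Hpi.
destruct (Rtotal_order beta 0) as [Hb | [Hb | Hb]].
- rewrite Rabs_left in Hc by exact Hb.
  destruct (omega_eq_upper_exists c (- beta) ltac:(lra) Hc) as [w [Hi Hw]].
  exists (Cconj w); split.
  + replace beta with (- - beta)%R by ring; apply omega_eq_conj; [lra | exact Hw].
  + intros w' Hw'.
    destruct (omega_eq_location _ _ _ Hw') as [H | [[_ H] | [H | H]]]; try lra.
    rewrite <- (Cconj_involutive w'); f_equal.
    apply omega_eq_upper_unique with c (- beta)%R; [exact Hi | | exact Hw |].
    * unfold Im in *; simpl; lra.
    * apply omega_eq_conj; [lra | exact Hw'].
- destruct (IVT_interv (fun a => a + ln a - c)%R (exp (- Rabs c - 2)) (Rabs c + 2)) as [a [Ha E]].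
  + intros a Ha; pose proof (exp_pos (- Rabs c - 2)).
    apply continuity_pt_minus; [apply continuity_pt_plus | now apply continuity_pt_const].
    * apply derivable_continuous_pt, derivable_pt_id.
    * apply derivable_continuous_pt; eexists; apply derivable_pt_lim_ln; lra.
  + pose proof (Rabs_pos c).
    apply Rle_lt_trans with (exp 0); [apply exp_le; lra | rewrite exp_0; lra].
  + rewrite ln_exp; pose proof (Rabs_pos c); pose proof (Rle_abs (- c)); rewrite Rabs_Ropp in *.
    assert (exp (- Rabs c - 2) <= exp 0)%R by (apply exp_le; lra).
    rewrite exp_0 in *; lra.
  + pose proof (Rabs_pos c); pose proof (Rle_abs c).
    assert (0 <= ln (Rabs c + 2))%R by (rewrite <- ln_1; apply ln_le; lra).
    lra.
  + assert (Ha0 : (0 < a)%R) by (pose proof (exp_pos (- Rabs c - 2)); lra).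
    exists (RtoC a); split; [split |].
    * intros E'; apply RtoC_inj in E'; lra.
    * rewrite Clog_pos_real by exact Ha0; apply injective_projections; simpl; lra.
    * intros w' Hw'.
      destruct (omega_eq_location _ _ _ Hw') as [H | [H | [[_ [H1 [H2 H3]]] | H]]]; try lra.
      rewrite (real_of_Im_0 w' H2); f_equal.
      destruct (Rtotal_order a (Re w')) as [Hlt | [Heq | Hlt]]; [| exact Heq |].
      -- pose proof (ln_increasing _ _ Ha0 Hlt); lra.
      -- pose proof (ln_increasing _ _ H1 Hlt); lra.
- rewrite Rabs_pos_eq in Hc by lra.
  destruct (omega_eq_upper_exists c beta Hb Hc) as [w [Hi Hw]].
  exists w; split; [exact Hw |].
  intros w' Hw'.
  destruct (omega_eq_location _ _ _ Hw') as [[_ H] | [H | [H | H]]]; try lra.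
  now apply omega_eq_upper_unique with c beta.
Qed.

Lemma x_exp_x_decr (a b : R) : (a < b <= -1)%R -> (b * exp b < a * exp a)%R.
Proof.
intros H.
replace b with (a + (b - a))%R at 2 by ring; rewrite exp_plus.
assert (Hd : (1 + (b - a) < exp (b - a))%R) by (apply exp_ineq1; lra).
pose proof (exp_pos a) as Ha.
assert (H1 : (b * exp (b - a) < a)%R) by nra.
nra.
Qed.

Lemma x_exp_x_incr (a b : R) : (-1 <= a < b)%R -> (a * exp a < b * exp b)%R.
Proof.
intros H.
replace a with (b + - (b - a))%R at 2 by ring; rewrite exp_plus.
assert (Hd : (1 - (b - a) < exp (- (b - a)))%R) by (apply exp_ineq1; lra).
assert (Hd1 : (exp (- (b - a)) <= 1)%R) by (rewrite <- exp_0; apply exp_le; lra).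
pose proof (exp_pos b) as Hb; pose proof (exp_pos (- (b - a))).
assert (H1 : (a * exp (- (b - a)) < b)%R).
{ destruct (Rle_dec 0 a); nra. }
nra.
Qed.

Lemma continuity_x_exp_x : continuity (fun a => a * exp a)%R.
Proof.
apply continuity_mult; [apply derivable_continuous, derivable_id |].
apply derivable_continuous, derivable_exp.
Qed.

Lemma exp_m1 : exp (-1) = (1 / exp 1)%R.
Proof. replace (-1)%R with (- (1))%R by ring; rewrite exp_Ropp; field; apply Rgt_not_eq, exp_pos. Qed.

Lemma x_exp_x_surj_low (y : R) : (- (1 / exp 1) <= y < 0)%R ->
  exists a, (a <= -1 /\ a * exp a = y)%R.
Proof.
intros Hy; rewrite <- exp_m1 in Hy.
set (M := (4 / - y + 1)%R).
assert (HM0 : (0 < 4 / - y)%R) by (apply Rdiv_lt_0_compat; lra).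
assert (HM : (- M * exp (- M) > y)%R).
{ (* [exp M >= (M / 2)^2] makes [M exp (- M)] at most [4 / M] *)
  pose proof (exp_ineq1_le (M / 2)) as H1.
  assert (H2 : (M / 2 * (M / 2) < exp M)%R).
  { replace M with (M / 2 + M / 2)%R at 3 by field; rewrite exp_plus; unfold M in *; nra. }
  rewrite exp_Ropp.
  assert (H3 : (M * / exp M < M * / (M / 2 * (M / 2)))%R).
  { apply Rmult_lt_compat_l; [unfold M; lra |].
    apply Rinv_lt_contravar; [apply Rmult_lt_0_compat; [unfold M; nra | apply exp_pos] | exact H2]. }
  replace (M * / (M / 2 * (M / 2)))%R with (4 / M)%R in H3 by (field; unfold M; lra).
  assert (H4 : (4 / M < - y)%R).
  { apply Rlt_div_l; [unfold M; lra |].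
    unfold M; replace (- y * (4 / - y + 1))%R with (4 - y)%R by (field; lra); lra. }
  lra. }
destruct (IVT_cor (fun a => a * exp a - y)%R (- M) (-1)) as [a [Ha E]].
- apply continuity_minus; [exact continuity_x_exp_x | now apply continuity_const].
- unfold M; lra.
- assert (-1 * exp (-1) - y <= 0)%R by lra.
  assert (0 < - M * exp (- M) - y)%R by lra.
  nra.
- exists a; lra.
Qed.

Lemma x_exp_x_surj_high (y : R) : (- (1 / exp 1) <= y < 0)%R ->
  exists a, (-1 <= a /\ a * exp a = y)%R.
Proof.
intros Hy; rewrite <- exp_m1 in Hy.
destruct (IVT_cor (fun a => a * exp a - y)%R (-1) 0) as [a [Ha E]].
- apply continuity_minus; [exact continuity_x_exp_x | now apply continuity_const].
- lra.
- assert (-1 * exp (-1) - y <= 0)%R by lra.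
  rewrite Rmult_0_l; nra.
- exists a; lra.
Qed.

Lemma real_w_exp_w (z w : C) : Im w = 0%R ->
  (w * Cexp w = z <-> Im z = 0%R /\ (Re w * exp (Re w) = Re z)%R).
Proof.
intros Hw; rewrite (real_of_Im_0 w Hw), Cexp_R, <- RtoC_mult; simpl.
split.
- intros <-; split; reflexivity.
- intros [H1 H2]; rewrite H2; symmetry; now apply real_of_Im_0.
Qed.

Lemma Clog_plus_turn (z : C) (k : Z) :
  Clog z + turn k = (ln (Cmod z), Im (Clog z) + 2 * IZR k * PI)%R.
Proof. rewrite turn_pair; unfold Clog; C_ext. Qed.

(** Off the special cases this is the equation [w + log w = c + i beta]; on the cut the
    function [a exp a] is monotone on each side of [-1]. *)
Lemma is_LambertW_unique (k : Z) (z : C) : z <> 0 -> exists w, unique (is_LambertW k z) w.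
Proof.
intros Hz; pose proof PI_RGT_0 as Hpi.
destruct (excluded_middle_informative (in_cut z /\ (k = 0%Z \/ k = (-1)%Z))) as [[Hc Hk] | Hn].
- destruct Hk as [-> | ->].
  + destruct (x_exp_x_surj_high (Re z)) as [a [Ha E]]; [apply Hc |].
    assert (Hchar : forall w, is_LambertW 0 z w <->
      Im w = 0%R /\ w * Cexp w = z /\ (-1 <= Re w)%R).
    { intros w; unfold is_LambertW; intuition discriminate. }
    exists (RtoC a); split; [apply Hchar; repeat split |].
    * apply real_w_exp_w; [reflexivity |]; split; [apply Hc | exact E].
    * exact Ha.
    * intros w Hw; apply Hchar in Hw as [Hi [Ew Hw]].
      apply real_w_exp_w in Ew as [_ Ew]; [| exact Hi].
      rewrite (real_of_Im_0 w Hi); f_equal.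
      destruct (Rtotal_order a (Re w)) as [H | [H | H]]; [| exact H |].
      -- pose proof (x_exp_x_incr a (Re w)); lra.
      -- pose proof (x_exp_x_incr (Re w) a); lra.
  + destruct (x_exp_x_surj_low (Re z)) as [a [Ha E]]; [apply Hc |].
    assert (Hchar : forall w, is_LambertW (-1) z w <->
      Im w = 0%R /\ w * Cexp w = z /\ (Re w <= -1)%R).
    { intros w; unfold is_LambertW; intuition discriminate. }
    exists (RtoC a); split; [apply Hchar; repeat split |].
    * apply real_w_exp_w; [reflexivity |]; split; [apply Hc | exact E].
    * exact Ha.
    * intros w Hw; apply Hchar in Hw as [Hi [Ew Hw]].
      apply real_w_exp_w in Ew as [_ Ew]; [| exact Hi].
      rewrite (real_of_Im_0 w Hi); f_equal.
      destruct (Rtotal_order a (Re w)) as [H | [H | H]]; [| exact H |].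
      -- pose proof (x_exp_x_decr a (Re w)); lra.
      -- pose proof (x_exp_x_decr (Re w) a); lra.
- assert (Hchar : forall w, is_LambertW k z w <->
    omega_eq (ln (Cmod z)) (Im (Clog z) + 2 * IZR k * PI) w).
  { intros w; unfold is_LambertW, omega_eq.
    rewrite <- Clog_plus_turn; unfold turn; tauto. }
  destruct (omega_eq_exists_unique (ln (Cmod z)) (Im (Clog z) + 2 * IZR k * PI)) as [w [Hw Hu]].
  + intros Hb.
    (* [beta] is an odd multiple of [PI] only for negative [z] *)
    pose proof (Im_Clog_bounds z Hz) as Hi.
    assert (Hk : (k = 0%Z \/ k = (-1)%Z) /\ Im (Clog z) = PI).
    { unfold Rabs in Hb; destruct (Rcase_abs _) as [H | H].
      - assert (H1 : (-1 <= IZR k < 0)%R) by nra.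
        assert (H2 : k = (-1)%Z).
        { destruct H1 as [H1 H2]; apply le_IZR in H1; apply lt_IZR in H2; lia. }
        subst k; split; [now right | lra].
      - assert (H1 : (-1 < IZR k < 1)%R) by nra.
        assert (H2 : k = 0%Z).
        { destruct H1 as [H1 H2]; apply lt_IZR in H1; apply lt_IZR in H2; lia. }
        subst k; split; [now left | lra]. }
    destruct Hk as [Hk HI].
    destruct (Cmod_polar z Hz) as [E1 E2]; rewrite HI, ?cos_PI, ?sin_PI in *.
    assert (Hm := proj1 (Cmod_gt_0 z) Hz).
    apply Rnot_le_lt; intros Hln; apply Hn; split; [| exact Hk].
    split; [lra |]; split; [| lra].
    rewrite <- exp_m1.
    assert (Cmod z <= exp (-1))%R by (rewrite <- (exp_ln (Cmod z)) by exact Hm; now apply exp_le).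
    lra.
  + exists w; split; [now apply Hchar |].
    intros w' Hw'; apply Hu; now apply Hchar.
Qed.

Lemma LambertW_spec (k : Z) (z : C) : z <> 0 -> is_LambertW k z (LambertW k z).
Proof.
intros Hz; pose proof (epsilon_spec (inhabits (RtoC 0)) _ (is_LambertW_unique k z Hz)) as [H _].
exact H.
Qed.

Lemma w_exp_w_of_omega (z w : C) (k : Z) : z <> 0 -> w <> 0 ->
  w + Clog w = Clog z + turn k -> w * Cexp w = z.
Proof.
intros Hz Hw E; apply (f_equal Cexp) in E.
rewrite !Cexp_plus, Cexp_turn, !Cexp_Clog in E by assumption.
rewrite Cmult_comm, E; ring.
Qed.

(** On the cut both real branches solve the logarithmic equation of index [0]. *)
Definition branch_label (z : C) (k : Z) : Z :=
  if excluded_middle_informative (in_cut z /\ k = (-1)%Z) then 0%Z else k.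

Lemma LambertW_omega (k : Z) (z : C) : z <> 0 -> LambertW k z <> 0 /\
  LambertW k z + Clog (LambertW k z) = Clog z + turn (branch_label z k).
Proof.
intros Hz; pose proof (LambertW_spec k z Hz) as H; revert H.
generalize (LambertW k z); intros w H.
assert (Hneg : in_cut z -> Im w = 0%R -> w * Cexp w = z ->
  w <> 0 /\ w + Clog w = Clog z + turn 0).
{ intros [Hzi Hzr] Hi E.
  apply real_w_exp_w in E as [_ E]; [| exact Hi].
  assert (Hw : (Re w < 0)%R) by (pose proof (exp_pos (Re w)); nra).
  rewrite (real_of_Im_0 w Hi), (real_of_Im_0 z Hzi), !Clog_neg_real by lra; split.
  - intros E'; apply RtoC_inj in E'; lra.
  - rewrite <- E, turn_pair.
    replace (- (Re w * exp (Re w)))%R with (- Re w * exp (Re w))%R by ring.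
    rewrite ln_mult, ln_exp by (lra || apply exp_pos); C_ext. }
unfold branch_label; destruct (excluded_middle_informative _) as [[Hc Hk] | Hn];
  destruct H as [[H1 [H2 H3]] | [[H1 [H2 [H3 [H4 H5]]]] | [H1 [H2 [H3 [H4 H5]]]]]].
- exfalso; tauto.
- now apply Hneg.
- now apply Hneg.
- split; [exact H2 |]; rewrite H3; reflexivity.
- exfalso; tauto.
- subst k; now apply Hneg.
Qed.

Lemma LambertW_nz (k : Z) (z : C) : z <> 0 -> LambertW k z <> 0.
Proof. intros Hz; apply (LambertW_omega k z Hz). Qed.

Lemma LambertW_eq (k : Z) (z : C) : z <> 0 -> LambertW k z * Cexp (LambertW k z) = z.
Proof.
intros Hz; destruct (LambertW_omega k z Hz) as [H E].
exact (w_exp_w_of_omega z _ _ Hz H E).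
Qed.

Lemma LambertW_intro (k : Z) (z w : C) : z <> 0 -> k <> 0%Z -> k <> (-1)%Z ->
  w <> 0 -> w + Clog w = Clog z + turn k -> LambertW k z = w.
Proof.
intros Hz H0 H1 Hw E.
destruct (is_LambertW_unique k z Hz) as [v [_ Hu]].
rewrite <- (Hu (LambertW k z) (LambertW_spec k z Hz)).
apply Hu; left; split; [tauto |]; split; [exact Hw | exact E].
Qed.

Lemma turn_inj (j k : Z) : turn j = turn k -> j = k.
Proof.
rewrite !turn_pair; intros E; injection E as E; pose proof PI_RGT_0.
apply eq_IZR; nra.
Qed.

Definition branching_value : C := RtoC (- (1 / exp 1)).

Lemma LambertW_collision (z : C) (j k : Z) : z <> 0 -> LambertW j z = LambertW k z ->
  j <> k -> z = branching_value /\ (j = 0%Z \/ j = (-1)%Z) /\ (k = 0%Z \/ k = (-1)%Z).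
Proof.
intros Hz E Hjk.
destruct (LambertW_omega j z Hz) as [_ Ej]; destruct (LambertW_omega k z Hz) as [_ Ek].
rewrite E, Ek in Ej.
assert (El : branch_label z j = branch_label z k).
{ apply turn_inj.
  replace (turn (branch_label z j)) with ((Clog z + turn (branch_label z j)) - Clog z) by ring.
  rewrite <- Ej; ring. }
assert (Hreal : in_cut z -> LambertW 0 z = LambertW (-1) z -> z = branching_value).
{ intros [Hzi Hzr] E01.
  pose proof (LambertW_spec 0 z Hz) as H0; pose proof (LambertW_spec (-1) z Hz) as H1.
  rewrite E01 in H0.
  destruct H0 as [[[[] | []] _] | [[_ [H0 _]] | [_ [_ [Hi [Ew H0]]]]]];
    [now split | now left | discriminate |].
  destruct H1 as [[[[] | []] _] | [[_ [_ [_ [_ H1]]]] | [_ [H1 _]]]];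
    [now split | now right | | discriminate].
  apply real_w_exp_w in Ew as [_ Ew]; [| exact Hi].
  replace (Re (LambertW (-1) z)) with (-1)%R in Ew by lra.
  rewrite exp_m1 in Ew.
  rewrite (real_of_Im_0 z Hzi), <- Ew; unfold branching_value; f_equal; ring. }
unfold branch_label in El.
destruct (excluded_middle_informative (in_cut z /\ j = (-1)%Z)) as [[Hc Hj] | Hj];
  destruct (excluded_middle_informative (in_cut z /\ k = (-1)%Z)) as [[Hc' Hk] | Hk];
  subst; try tauto.
- split; [now apply Hreal | tauto].
Qed.

Lemma LambertW_branching_value (k : Z) : k = 0%Z \/ k = (-1)%Z ->
  LambertW k branching_value = RtoC (-1).
Proof.
intros Hk.
assert (He : (0 < 1 / exp 1)%R) by (apply Rdiv_lt_0_compat; [lra | apply exp_pos]).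
assert (Hz : branching_value <> 0) by (intros E; apply RtoC_inj in E; lra).
assert (Hc : in_cut branching_value) by (split; simpl; lra).
destruct (is_LambertW_unique k _ Hz) as [v [_ Hu]].
rewrite <- (Hu (LambertW k branching_value) (LambertW_spec k _ Hz)).
apply Hu.
assert (E : RtoC (-1) * Cexp (RtoC (-1)) = branching_value).
{ rewrite Cexp_R, <- RtoC_mult, exp_m1; unfold branching_value; f_equal; ring. }
destruct Hk as [-> | ->].
- right; right; repeat split; try assumption || apply Hc; simpl; lra.
- right; left; repeat split; try assumption || apply Hc; simpl; lra.
Qed.

(** * Products over symmetric ranges of indices *)

Fixpoint pair_list (b : Z -> C) (K j : nat) : list C :=
  match j with
  | O => []
  | S j' => b (Z.of_nat (K + j)) :: b (- Z.of_nat (K + j))%Z :: pair_list b K j'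
  end.

Lemma pair_list_length (b : Z -> C) (K j : nat) : length (pair_list b K j) = (2 * j)%nat.
Proof. induction j as [|j IH]; simpl length; [reflexivity | rewrite IH; lia]. Qed.

Lemma pair_list_app (b : Z -> C) (K i j : nat) :
  pair_list b K (i + j) = pair_list b (K + i) j ++ pair_list b K i.
Proof.
induction j as [|j IH].
- now rewrite Nat.add_0_r.
- rewrite Nat.add_succ_r; cbn [pair_list app]; rewrite IH.
  now replace (K + S (i + j))%nat with (K + i + S j)%nat by lia.
Qed.

Lemma in_pair_list (b : Z -> C) (K j : nat) (a : C) : In a (pair_list b K j) ->
  exists k, (Z.of_nat K < Z.abs k <= Z.of_nat (K + j))%Z /\ a = b k.
Proof.
induction j as [|j IH]; simpl In; [tauto |].
intros [H | [H | H]].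
- exists (Z.of_nat (K + S j)); split; [lia | now symmetry].
- exists (- Z.of_nat (K + S j))%Z; split; [lia | now symmetry].
- destruct (IH H) as [k [Hk E]]; exists k; split; [lia | exact E].
Qed.

Lemma NoDup_pair_list (b : Z -> C) (K j : nat) :
  (forall i k, (Z.of_nat K < Z.abs i <= Z.of_nat (K + j))%Z ->
    (Z.of_nat K < Z.abs k <= Z.of_nat (K + j))%Z -> b i = b k -> i = k) ->
  NoDup (pair_list b K j).
Proof.
induction j as [|j IH]; intros H; [constructor |].
assert (Hnot : forall i, Z.abs i = Z.of_nat (K + S j) -> ~ In (b i) (pair_list b K j)).
{ intros i Hi Hin; apply in_pair_list in Hin as [k [Hk E]].
  assert (i = k) by (apply H; [lia | lia | exact E]); subst; lia. }
cbn [pair_list]; constructor; [| constructor].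
- intros [E | Hin].
  + assert (- Z.of_nat (K + S j) = Z.of_nat (K + S j))%Z by (apply H; [lia | lia | exact E]); lia.
  + now apply (Hnot (Z.of_nat (K + S j))); [lia |].
- apply Hnot; lia.
- apply IH; intros i k Hi Hk; apply H; lia.
Qed.

Lemma Cprod_sym_pair_list (b : Z -> C) (t : C) (K j : nat) :
  Cprod_sym (fun k => 1 - t * b k) (K + j)
  = Cprod_sym (fun k => 1 - t * b k) K * lin_prod (pair_list b K j) t.
Proof.
induction j as [|j IH].
- rewrite Nat.add_0_r; simpl; ring.
- rewrite Nat.add_succ_r; cbn [Cprod_sym pair_list lin_prod]; rewrite IH.
  rewrite Nat.add_succ_r; ring.
Qed.

Lemma Ccvg_pair_list (b : nat -> Z -> C) (c : Z -> C) (K j : nat) (t : C) :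
  (forall k, (Z.of_nat K < Z.abs k)%Z -> Ccvg (fun m => b m k) (c k)) ->
  Ccvg (fun m => lin_prod (pair_list (b m) K j) t) (lin_prod (pair_list c K j) t).
Proof.
intros H.
assert (Hf : forall k, (Z.of_nat K < Z.abs k)%Z -> Ccvg (fun m => 1 - t * b m k) (1 - t * c k)).
{ intros k Hk; apply Ccvg_minus; [apply Ccvg_const |].
  apply Ccvg_mult; [apply Ccvg_const | now apply H]. }
induction j as [|j IH]; cbn [pair_list lin_prod]; [apply Ccvg_const |].
apply Ccvg_mult; [apply Hf; lia |].
apply Ccvg_mult; [apply Hf; lia | exact IH].
Qed.

Lemma inv_cube_sqrt_telescope (k : R) : (1 < k)%R ->
  (1 / (k * sqrt k) <= 2 * (/ sqrt (k - 1) - / sqrt k))%R.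
Proof.
intros Hk.
assert (Ha : (0 < sqrt (k - 1))%R) by (apply sqrt_lt_R0; lra).
assert (Hb : (0 < sqrt k)%R) by (apply sqrt_lt_R0; lra).
assert (Hab : (sqrt (k - 1) <= sqrt k)%R) by (apply sqrt_le_1; lra).
pose proof (sqrt_sqrt (k - 1) ltac:(lra)) as Ea; pose proof (sqrt_sqrt k ltac:(lra)) as Eb.
rewrite <- Eb at 1.
set (a := sqrt (k - 1)) in *; set (b := sqrt k) in *.
assert (Hd : ((b - a) * (b + a) = 1)%R) by lra.
replace (2 * (/ a - / b))%R with (2 * (b - a) / (a * b))%R by (field; lra).
apply (proj1 (Rle_div_r _ _ (a * b)%R (Rmult_lt_0_compat _ _ Ha Hb))).
replace (1 / (b * b * b) * (a * b))%R with (a / (b * b))%R by (field; lra).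
apply (proj2 (Rle_div_l _ _ (b * b)%R (Rmult_lt_0_compat _ _ Hb Hb))).
assert (H1 : (1 <= (b - a) * (2 * b))%R).
{ rewrite <- Hd; apply Rmult_le_compat_l; lra. }
replace (2 * (b - a) * (b * b))%R with ((b - a) * (2 * b) * b)%R by ring.
nra.
Qed.

(** The products stay below the exponential of the sum of the [c k^(-3/2)], which is
    compared with a telescoping sum. *)
Lemma tail_product_bound (b : Z -> C) (t : C) (c : R) (K j : nat) :
  (1 <= K)%nat -> (0 <= c)%R ->
  (forall k : nat, (K < k <= K + j)%nat ->
    Cmod ((1 - t * b (Z.of_nat k)) * (1 - t * b (- Z.of_nat k)%Z) - 1)
      <= c / (INR k * sqrt (INR k)))%R ->
  (Cmod (lin_prod (pair_list b K j) t - 1) <= exp (2 * c / sqrt (INR K)) - 1)%R.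
Proof.
intros HK Hc.
assert (HK1 : (1 <= INR K)%R) by (apply (le_INR 1); exact HK).
assert (Hsq : forall n, (K <= n)%nat -> (0 < sqrt (INR n))%R).
{ intros n Hn; apply sqrt_lt_R0; apply le_INR in Hn; lra. }
set (E := fun j => exp (2 * c * (/ sqrt (INR K) - / sqrt (INR (K + j))))).
assert (Hfin : forall j, (E j <= exp (2 * c / sqrt (INR K)))%R).
{ intros i; apply exp_le; unfold Rdiv; apply Rmult_le_compat_l; [lra |].
  pose proof (Rinv_0_lt_compat _ (Hsq (K + i)%nat ltac:(lia))); lra. }
intros H; apply Rle_trans with (E j - 1)%R; [| specialize (Hfin j); lra].
induction j as [|j IH].
- unfold E; rewrite Nat.add_0_r; simpl.
  replace (1 - 1) with (RtoC 0) by ring; rewrite Cmod_0.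
  replace (2 * c * (/ sqrt (INR K) - / sqrt (INR K)))%R with 0%R by ring.
  rewrite exp_0; lra.
- assert (IH' : (Cmod (lin_prod (pair_list b K j) t - 1) <= E j - 1)%R).
  { apply IH; intros k Hk; apply H; lia. }
  cbn [pair_list lin_prod]; rewrite Cmult_assoc.
  specialize (H (K + S j)%nat ltac:(lia)).
  set (k := (K + S j)%nat) in *.
  set (z := (1 - t * b (Z.of_nat k)) * (1 - t * b (- Z.of_nat k)%Z)) in *.
  set (p := lin_prod (pair_list b K j) t) in *.
  replace (z * p - 1) with ((p - 1) + p * (z - 1)) by ring.
  eapply Rle_trans; [apply Cmod_triangle |]; rewrite Cmod_mult.
  assert (Hp : (Cmod p <= E j)%R).
  { replace p with ((p - 1) + 1) by ring.
    eapply Rle_trans; [apply Cmod_triangle |]; rewrite Cmod_1; lra. }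
  assert (Ek : INR k = (INR (K + j) + 1)%R) by (unfold k; rewrite Nat.add_succ_r, S_INR; reflexivity).
  assert (Hz : (Cmod (z - 1) <= 2 * c * (/ sqrt (INR (K + j)) - / sqrt (INR k)))%R).
  { eapply Rle_trans; [exact H |].
    replace (c / (INR k * sqrt (INR k)))%R with (c * (1 / (INR k * sqrt (INR k))))%R.
    2:{ pose proof (pos_INR (K + j)); pose proof (Hsq k ltac:(lia)); field; lra. }
    replace (2 * c * (/ sqrt (INR (K + j)) - / sqrt (INR k)))%R
      with (c * (2 * (/ sqrt (INR (K + j)) - / sqrt (INR k))))%R by ring.
    apply Rmult_le_compat_l; [exact Hc |].
    replace (INR (K + j)) with (INR k - 1)%R by lra.
    apply inv_cube_sqrt_telescope.
    assert (INR K <= INR (K + j))%R by (apply le_INR; lia); lra. }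
  assert (EE : (E (S j) = E j * exp (2 * c * (/ sqrt (INR (K + j)) - / sqrt (INR k))))%R).
  { unfold E; rewrite <- exp_plus; f_equal; fold k; ring. }
  pose proof (exp_ineq1_le (2 * c * (/ sqrt (INR (K + j)) - / sqrt (INR k)))).
  rewrite EE; pose proof (Cmod_ge_0 (z - 1)); pose proof (Cmod_ge_0 p).
  assert (0 < E j)%R by apply exp_pos.
  assert (Cmod p * Cmod (z - 1) <= E j * Cmod (z - 1))%R by nra.
  assert (E j * Cmod (z - 1) <= E j * (2 * c * (/ sqrt (INR (K + j)) - / sqrt (INR k))))%R by nra.
  nra.
Qed.

Lemma tail_bound_cvg (c : R) (K : nat) :
  is_lim_seq (fun j => exp (2 * c / sqrt (INR (K + j))) - 1)%R 0.
Proof.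
assert (H : is_lim_seq (fun j => 2 * c / sqrt (INR (K + j)))%R 0).
{ apply is_lim_seq_scal_0, is_lim_seq_inv_p_infty.
  apply (filterlim_comp _ _ _ (fun j => INR (K + j)) sqrt _ (Rbar_locally p_infty));
    [| apply filterlim_sqrt_p].
  apply is_lim_seq_le_p_loc with INR; [| apply is_lim_seq_INR].
  apply filter_forall; intros j; apply le_INR; lia. }
replace (Finite 0) with (Finite (exp 0 - 1)) by (f_equal; rewrite exp_0; ring).
apply is_lim_seq_minus'; [| apply is_lim_seq_const].
apply (is_lim_seq_continuous exp); [| exact H].
apply derivable_continuous_pt, derivable_pt_exp.
Qed.

(** * The polynomial approximants *)

Definition deg (m : nat) : nat := S (2 * m).

Definition target (x t : C) : C := Cexp (- t / 2) - t / x * Cexp (t / 2).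

(** Written so that both summands are visibly polynomial in [t]. *)
Definition approx (m : nat) (x t : C) : C :=
  (1 + (- / (2 * RtoC (INR (deg m)))) * t) ^ deg m
  - / x * (t * (1 + / (2 * RtoC (INR (deg m))) * t) ^ (2 * m)).

Lemma deg_lim : is_lim_seq (fun m => INR (deg m)) p_infty.
Proof.
apply is_lim_seq_le_p_loc with INR; [| apply is_lim_seq_INR].
apply filter_forall; intros j; apply le_INR; unfold deg; lia.
Qed.

Lemma INR_deg (m : nat) : INR (deg m) = (2 * INR m + 1)%R.
Proof. unfold deg; rewrite S_INR, mult_INR; reflexivity. Qed.

Lemma INR_deg_pos (m : nat) : (1 <= INR (deg m))%R.
Proof. rewrite INR_deg; pose proof (pos_INR m); lra. Qed.

Lemma INR_deg_nz (m : nat) : RtoC (INR (deg m)) <> 0.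
Proof. intros E; apply RtoC_inj in E; pose proof (INR_deg_pos m); lra. Qed.

Lemma C2_nz : RtoC 2 <> 0.
Proof. intros E; apply RtoC_inj in E; lra. Qed.

Lemma approx_0 (m : nat) (x : C) : approx m x 0 = 1.
Proof.
unfold approx; rewrite !Cmult_0_r, Cmult_0_l, Cplus_0_r, Cpow_1_l; ring.
Qed.

Lemma poly_approx (m : nat) (x : C) : poly (deg m) (approx m x).
Proof.
apply poly_ext with (fun t => (1 + (- / (2 * RtoC (INR (deg m)))) * t) ^ deg m
  + (- / x) * (t * (1 + / (2 * RtoC (INR (deg m))) * t) ^ (2 * m))).
- intros t; unfold approx; ring.
- apply poly_add; [apply poly_lin_pow |].
  apply poly_scal, poly_mulX, poly_lin_pow.
Qed.

Lemma inv_deg_cvg (z : C) : Ccvg (fun m => 1 + z / RtoC (INR (deg m))) 1.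
Proof.
apply Ccvg_le with (fun m => Cmod z * / INR (deg m))%R.
- apply filter_forall; intros m; right.
  replace (1 + z / RtoC (INR (deg m)) - 1) with (z / RtoC (INR (deg m))) by ring.
  rewrite Cmod_div, Cmod_R, Rabs_pos_eq; [reflexivity | | apply INR_deg_nz].
  pose proof (INR_deg_pos m); lra.
- apply is_lim_seq_scal_0, is_lim_seq_inv_p_infty, deg_lim.
Qed.

Lemma pow_2m_cvg (z : C) :
  Ccvg (fun m => (1 + z / RtoC (INR (deg m))) ^ (2 * m)) (Cexp z).
Proof.
apply Ccvg_ext_loc with (fun m =>
  (1 + z / RtoC (INR (deg m))) ^ deg m * / (1 + z / RtoC (INR (deg m)))).
- generalize (Ccvg_Cmod_lower _ 1 0 ltac:(rewrite Cmod_1; lra) (inv_deg_cvg z)).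
  apply filter_imp; intros m Hm; apply Cmod_gt_0 in Hm.
  revert Hm; generalize (1 + z / RtoC (INR (deg m))); intros q Hq.
  unfold deg; rewrite Cpow_S; field; exact Hq.
- apply Ccvg_eq with (Cexp z * / 1); [field |].
  apply Ccvg_mult; [apply Ccvg_pow_exp, deg_lim |].
  apply Ccvg_inv; [exact C1_nz | apply inv_deg_cvg].
Qed.

Lemma approx_cvg (x t : C) (xs : nat -> C) :
  x <> 0 -> Ccvg xs x -> Ccvg (fun m => approx m (xs m) t) (target x t).
Proof.
intros Hx Hxs; unfold approx, target.
apply Ccvg_minus.
- apply Ccvg_ext with (fun m => (1 + (- t / 2) / RtoC (INR (deg m))) ^ deg m).
  + intros m; f_equal; field; apply INR_deg_nz.
  + apply Ccvg_pow_exp, deg_lim.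
- apply Ccvg_eq with (/ x * (t * Cexp (t / 2))); [field; exact Hx |].
  apply Ccvg_mult; [now apply Ccvg_inv |].
  apply Ccvg_mult; [apply Ccvg_const |].
  apply Ccvg_ext with (fun m => (1 + (t / 2) / RtoC (INR (deg m))) ^ (2 * m)).
  + intros m; f_equal; field; apply INR_deg_nz.
  + apply pow_2m_cvg.
Qed.

Lemma target_root (x w : C) : x <> 0 -> w * Cexp w = x -> target x w = 0.
Proof.
intros Hx E; unfold target.
replace w with (w / 2 + w / 2) in E at 2 by (field; exact C2_nz).
rewrite Cexp_plus in E.
replace (- w / 2) with (- (w / 2)) by (field; exact C2_nz).
rewrite Cexp_opp, <- E.
field; split; [apply Cexp_nz |].
intros ->; apply Hx; rewrite <- E; ring.
Qed.

(** The substitution [1/t = 1/T - 1/(2n)] turns [(1 - T/n)^n = T/x] into the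
    vanishing of the approximant at [t]. *)
Lemma approx_root (m : nat) (x T a : C) :
  x <> 0 -> T <> 0 -> a <> 0 -> a = / T - / (2 * RtoC (INR (deg m))) ->
  (1 - T / RtoC (INR (deg m))) ^ deg m = T / x -> approx m x (/ a) = 0.
Proof.
intros Hx HT Ha Ea E; unfold approx.
pose proof (INR_deg_nz m) as Hn; set (n := RtoC (INR (deg m))) in *.
pose proof C2_nz as H2.
replace (1 + - / (2 * n) * / a) with (/ a * / T * (1 - T / n)).
2:{ replace (/ a * / T * (1 - T / n)) with (/ a * (/ T - / (2 * n)) - / a * / (2 * n))
      by (field; repeat split; assumption).
    rewrite <- Ea; field; repeat split; assumption. }
replace (1 + / (2 * n) * / a) with (/ a * / T).
2:{ replace (/ a * / T) with (/ a * (/ T - / (2 * n)) + / a * / (2 * n))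
      by (field; repeat split; assumption).
    rewrite <- Ea; field; repeat split; assumption. }
rewrite Cpow_mult_l, E; unfold deg; rewrite Cpow_S; field; repeat split; assumption.
Qed.

(** [inv_root m lam k] is the inverse of the root of the approximant with index
    [k]; it tends to [1 / W_k]. *)
Definition euler_branch (m : nat) (lam : C) (k : Z) : C :=
  euler_map (INR (deg m))
    (epsilon (inhabits (RtoC 0)) (branch_point (euler_map (INR (deg m))) lam k)).

Definition inv_root (m : nat) (lam : C) (k : Z) : C :=
  / euler_branch m lam k - / (2 * RtoC (INR (deg m))).

Lemma tame_euler_deg (m : nat) (k : Z) :
  k <> 0%Z -> (zabs k <= INR m)%R -> tame (euler_map (INR (deg m))) k.
Proof. intros Hk H; apply tame_euler_map; [exact Hk | rewrite INR_deg; lra]. Qed.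

Section Roots.

Variables (L : R) (m : nat) (lam : C).
Hypothesis Hlam : (Cmod lam <= L)%R.

Lemma euler_branch_spec (k : Z) : large L k -> (zabs k <= INR m)%R ->
  exists s, branch_point (euler_map (INR (deg m))) lam k s /\
    euler_branch m lam k = euler_map (INR (deg m)) s.
Proof.
intros Hk Hm.
eexists; split; [| reflexivity].
apply epsilon_spec, branch_point_exists.
- apply tame_euler_deg; [now apply large_nz in Hk | exact Hm].
- destruct Hk; split; lra.
Qed.

Lemma euler_branch_size (k : Z) : large L k -> (zabs k <= INR m)%R ->
  (3 * zabs k <= Cmod (euler_branch m lam k))%R.
Proof.
intros Hk Hm; destruct (euler_branch_spec k Hk Hm) as [s [[Hs _] ->]].
apply (tame_euler_deg m k); [now apply large_nz in Hk | exact Hm | exact Hs].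
Qed.

Lemma euler_branch_nz (k : Z) : large L k -> (zabs k <= INR m)%R -> euler_branch m lam k <> 0.
Proof.
intros Hk Hm; apply Cmod_gt_0; pose proof (euler_branch_size k Hk Hm); destruct Hk; lra.
Qed.

(** Exponentiating the equation gives [exp s T = exp lam], and [exp (- s)] is the
    [n]-th power of [1 - T/n]. *)
Lemma euler_branch_eq (k : Z) : large L k -> (zabs k <= INR m)%R ->
  (1 - euler_branch m lam k / RtoC (INR (deg m))) ^ deg m = euler_branch m lam k / Cexp lam.
Proof.
intros Hk Hm; pose proof (euler_branch_nz k Hk Hm) as HT.
destruct (euler_branch_spec k Hk Hm) as [s [[_ E] ET]]; rewrite ET in *.
apply (f_equal Cexp) in E; rewrite !Cexp_plus, Cexp_turn, Cexp_Clog in E by exact HT.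
pose proof (INR_deg_nz m) as Hn.
replace (1 - euler_map (INR (deg m)) s / INR (deg m)) with (Cexp (- (s / INR (deg m))))
  by (unfold euler_map; field; exact Hn).
rewrite <- Cexp_INR_mult.
replace (RtoC (INR (deg m)) * - (s / RtoC (INR (deg m)))) with (- s) by (field; exact Hn).
rewrite Cmult_1_r in E; rewrite Cexp_opp, <- E; field; split; [exact HT | apply Cexp_nz].
Qed.

(** A vanishing [inv_root] would mean a root at infinity, [T = 2n], which forces
    [T = - exp lam]. *)
Lemma inv_root_nz (k : Z) : large L k -> (zabs k <= INR m)%R ->
  (Cmod (Cexp lam) < 2 * INR (deg m))%R -> inv_root m lam k <> 0.
Proof.
intros Hk Hm Hx E.
pose proof (euler_branch_nz k Hk Hm) as HT; pose proof (euler_branch_eq k Hk Hm) as Eq.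
pose proof (INR_deg_nz m) as Hn; pose proof C2_nz as H2.
unfold inv_root in E.
assert (ET : euler_branch m lam k = 2 * RtoC (INR (deg m))).
{ rewrite <- (Cinv_inv (euler_branch m lam k)) by exact HT.
  apply Ceq_minus in E; rewrite E; apply Cinv_inv; now apply Cmult_neq_0. }
rewrite ET in Eq.
replace (1 - 2 * RtoC (INR (deg m)) / RtoC (INR (deg m))) with (- (1)) in Eq
  by (field; exact Hn).
apply (f_equal Cmod) in Eq.
rewrite Cmod_pow, Cmod_m1, pow1, Cmod_div, Cmod_mult, !Cmod_R in Eq by apply Cexp_nz.
pose proof (INR_deg_pos m).
rewrite !Rabs_pos_eq in Eq by lra.
pose proof (proj1 (Cmod_gt_0 _) (Cexp_nz lam)) as He.
assert (2 * INR (deg m) = Cmod (Cexp lam))%R; [| lra].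
transitivity (2 * INR (deg m) / Cmod (Cexp lam) * Cmod (Cexp lam))%R; [field; lra |].
rewrite <- Eq; ring.
Qed.

Lemma approx_inv_root (k : Z) : large L k -> (zabs k <= INR m)%R ->
  (Cmod (Cexp lam) < 2 * INR (deg m))%R -> approx m (Cexp lam) (/ inv_root m lam k) = 0.
Proof.
intros Hk Hm Hx.
apply approx_root with (euler_branch m lam k).
- apply Cexp_nz.
- now apply euler_branch_nz.
- now apply inv_root_nz.
- reflexivity.
- now apply euler_branch_eq.
Qed.

(** Equal values of [T] leave two freedoms for [s], a multiple of [2 PI i] from the
    logarithm and one of [2 n PI i] from the exponential; as [|j - k| < n] they are
    compatible only for [j = k]. *)
Lemma inv_root_inj (j k : Z) : large L j -> large L k ->
  (zabs j <= INR m)%R -> (zabs k <= INR m)%R ->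
  inv_root m lam j = inv_root m lam k -> j = k.
Proof.
intros Hj Hk Hjm Hkm E.
assert (ET : euler_branch m lam j = euler_branch m lam k).
{ rewrite <- (Cinv_inv (euler_branch m lam j)), <- (Cinv_inv (euler_branch m lam k))
    by now apply euler_branch_nz.
  f_equal; unfold inv_root in E.
  replace (/ euler_branch m lam j)
    with (/ euler_branch m lam j - / (2 * RtoC (INR (deg m))) + / (2 * RtoC (INR (deg m)))) by ring.
  rewrite E; ring. }
destruct (euler_branch_spec j Hj Hjm) as [s [[_ Es] Ej]].
destruct (euler_branch_spec k Hk Hkm) as [s' [[_ Es'] Ek]].
rewrite <- Ej in Es; rewrite <- Ek, <- ET in Es'.
pose proof (INR_deg_nz m) as Hn; set (n := INR (deg m)) in *.
assert (Ediff : s' - s = turn k - turn j).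
{ replace s with (lam + turn j - Clog (euler_branch m lam j)) by (rewrite <- Es; ring).
  replace s' with (lam + turn k - Clog (euler_branch m lam j)) by (rewrite <- Es'; ring).
  ring. }
assert (Eexp : Cexp ((s' - s) / RtoC n) = 1).
{ assert (E1 : Cexp (- (s / RtoC n)) = Cexp (- (s' / RtoC n))).
  { rewrite Ej, Ek in ET; unfold euler_map in ET.
    replace (Cexp (- (s / RtoC n))) with (1 - RtoC n * (1 - Cexp (- (s / RtoC n))) / RtoC n)
      by (field; exact Hn).
    rewrite ET; field; exact Hn. }
  replace ((s' - s) / RtoC n) with (- (s / RtoC n) + - - (s' / RtoC n)) by (field; exact Hn).
  rewrite Cexp_plus, (Cexp_opp (- (s' / RtoC n))), <- E1; field; apply Cexp_nz. }
destruct (Cexp_eq_1 _ Eexp) as [i Hi].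
assert (Eint : (IZR k - IZR j = n * IZR i)%R).
{ assert (E1 : turn k - turn j = RtoC n * turn i).
  { rewrite <- Ediff, <- Hi; field; exact Hn. }
  rewrite !turn_pair in E1; injection E1 as E1; pose proof PI_RGT_0; nra. }
unfold n in Eint; rewrite INR_deg in Eint.
unfold zabs in *.
apply Rabs_le_between in Hjm; apply Rabs_le_between in Hkm.
assert (i = 0%Z).
{ assert (H : (-1 < IZR i < 1)%R) by (pose proof (pos_INR m); split; nra).
  destruct H as [H1 H2]; apply lt_IZR in H1; apply lt_IZR in H2; lia. }
subst i; apply eq_IZR; lra.
Qed.

Lemma inv_root_bound (k : Z) : large L k -> (zabs k <= INR m)%R ->
  (Cmod (inv_root m lam k) <= / zabs k)%R.
Proof.
intros Hk Hm; unfold inv_root.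
pose proof (euler_branch_size k Hk Hm) as HT; pose proof (euler_branch_nz k Hk Hm) as HT0.
pose proof (INR_deg_nz m) as Hn; pose proof C2_nz as H2; destruct Hk as [Hk _].
eapply Rle_trans; [apply Cmod_minus_le |].
rewrite !Cmod_inv, Cmod_mult, !Cmod_R by (assumption || now apply Cmult_neq_0).
pose proof (INR_deg m) as En.
rewrite !Rabs_pos_eq by lra.
assert (/ Cmod (euler_branch m lam k) <= / (3 * zabs k))%R by (apply Rinv_le_contravar; lra).
assert (/ (2 * INR (deg m)) <= / (3 * zabs k))%R by (apply Rinv_le_contravar; lra).
assert (/ zabs k = / (3 * zabs k) + / (3 * zabs k) + / (3 * zabs k))%R by (field; lra).
assert (0 < / (3 * zabs k))%R by (apply Rinv_0_lt_compat; lra).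
lra.
Qed.

(** The Lipschitz bound of [T], divided by two factors of size [|k|]. *)
Lemma inv_euler_branch_near_center (k : Z) : large L k -> (zabs k <= INR m)%R ->
  (Cmod (/ euler_branch m lam k - / euler_map (INR (deg m)) (turn k))
   <= (L + 10) / (2 * (zabs k * sqrt (zabs k))))%R.
Proof.
intros Hk Hm.
pose proof (euler_branch_size k Hk Hm) as HT; pose proof (euler_branch_nz k Hk Hm) as HT0.
assert (Htame := tame_euler_deg m k (large_nz _ _ Hk) Hm).
destruct (proj1 Htame _ (disc_center k)) as [Hc _].
destruct Hk as [Hk HL].
set (c := euler_map (INR (deg m)) (turn k)) in *.
assert (Hc0 : c <> 0) by (apply Cmod_gt_0; lra).
replace (/ euler_branch m lam k - / c)
  with ((c - euler_branch m lam k) * / (euler_branch m lam k * c))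
  by (field; split; assumption).
rewrite Cmod_mult, Cmod_inv, Cmod_mult by now apply Cmult_neq_0.
assert (Hd : (Cmod (c - euler_branch m lam k) <= 3 * ((L + 10) * sqrt (zabs k)))%R).
{ destruct (euler_branch_spec k (conj Hk HL) Hm) as [s [Hbp ->]].
  pose proof (branch_point_near_center _ _ _ _ Htame Hk Hbp) as Hnear.
  pose proof (sqrt_pos (zabs k)).
  eapply Rle_trans; [apply (proj2 (proj2 Htame)); [apply disc_center | apply Hbp] |].
  rewrite Cmod_minus_sym; nra. }
assert (Hsq : (0 < sqrt (zabs k))%R) by (apply sqrt_lt_R0; lra).
assert (Hinv : (/ (Cmod (euler_branch m lam k) * Cmod c) <= / (9 * (zabs k * zabs k)))%R)
  by (apply Rinv_le_contravar; nra).
assert (HL0 : (0 <= L)%R) by (pose proof (Cmod_ge_0 lam); lra).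
apply Rle_trans with (3 * ((L + 10) * sqrt (zabs k)) * / (9 * (zabs k * zabs k)))%R.
- apply Rmult_le_compat; [apply Cmod_ge_0 | | exact Hd | exact Hinv].
  left; apply Rinv_0_lt_compat, Rmult_lt_0_compat; lra.
- replace (3 * ((L + 10) * sqrt (zabs k)) * / (9 * (zabs k * zabs k)))%R
    with ((L + 10) / (3 * (zabs k * sqrt (zabs k))))%R.
  + apply Rmult_le_compat_l; [lra |].
    apply Rinv_le_contravar; nra.
  + apply Rmult_eq_reg_r with (zabs k * zabs k * sqrt (zabs k))%R;
      [| apply Rgt_not_eq; repeat apply Rmult_lt_0_compat; lra].
    transitivity ((L + 10) * zabs k / 3)%R; [field; lra |].
    rewrite <- (sqrt_sqrt (zabs k)) at 1 by lra; field; lra.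
Qed.

(** [1/(1 - 1/u) + 1/(1 - u) = 1]. *)
Lemma euler_center_pair (k : Z) : k <> 0%Z -> (zabs k <= INR m)%R ->
  / euler_map (INR (deg m)) (turn k) + / euler_map (INR (deg m)) (turn (- k))
  = / RtoC (INR (deg m)).
Proof.
intros Hk Hm.
assert (Hz : (0 < zabs k)%R) by (apply Rabs_pos_lt, eq_IZR_contrapositive, Hk).
destruct (proj1 (tame_euler_deg m k Hk Hm) _ (disc_center k)) as [Hc _].
assert (Hc0 : euler_map (INR (deg m)) (turn k) <> 0) by (apply Cmod_gt_0; lra).
pose proof (INR_deg_nz m) as Hn; revert Hc0; unfold euler_map.
replace (turn (- k)) with (- turn k) by (rewrite !turn_pair, opp_IZR; C_ext).
replace (- (- turn k / RtoC (INR (deg m)))) with (turn k / RtoC (INR (deg m)))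
  by (field; exact Hn).
rewrite Cexp_opp; pose proof (Cexp_nz (turn k / RtoC (INR (deg m)))) as Hu; revert Hu.
generalize (Cexp (turn k / RtoC (INR (deg m)))); intros u Hu H0.
assert (Hu1 : u - 1 <> 0).
{ intros E; apply H0; replace (1 - / u) with ((u - 1) / u) by (field; exact Hu).
  rewrite E; field; exact Hu. }
assert (Hu2 : 1 - u <> 0).
{ intros E; apply Hu1; replace (u - 1) with (- (1 - u)) by ring; rewrite E; ring. }
replace (1 - / u) with ((u - 1) / u) by (field; exact Hu).
field; repeat split; assumption.
Qed.

(** The inverses for [k] and [- k] nearly cancel: at the unshifted centres the
    inverses of [T] add up to exactly [1/n], which the terms [- 1/(2n)] remove. *)
Lemma inv_root_pair (k : Z) : large L k -> large L (- k) -> (zabs k <= INR m)%R ->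
  (Cmod (inv_root m lam k + inv_root m lam (- k)) <= (L + 10) / (zabs k * sqrt (zabs k)))%R.
Proof.
intros Hk Hk' Hm.
assert (Ez := zabs_opp k).
assert (Hm' : (zabs (- k) <= INR m)%R) by (rewrite Ez; exact Hm).
pose proof (inv_euler_branch_near_center k Hk Hm) as H1.
pose proof (inv_euler_branch_near_center (- k) Hk' Hm') as H2; rewrite Ez in H2.
pose proof (euler_center_pair k (large_nz _ _ Hk) Hm) as E.
unfold inv_root.
set (n := RtoC (INR (deg m))) in *.
assert (Hn : n <> 0) by apply INR_deg_nz.
replace (/ euler_branch m lam k - / (2 * n) + (/ euler_branch m lam (- k) - / (2 * n)))
  with ((/ euler_branch m lam k - / euler_map (INR (deg m)) (turn k))
      + (/ euler_branch m lam (- k) - / euler_map (INR (deg m)) (turn (- k)))).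
2:{ transitivity (/ euler_branch m lam k + / euler_branch m lam (- k)
      - (/ euler_map (INR (deg m)) (turn k) + / euler_map (INR (deg m)) (turn (- k)))); [ring |].
    rewrite E.
    replace (/ (2 * n)) with (/ 2 * / n) by (field; exact Hn).
    replace (/ n) with (/ 2 * / n + / 2 * / n) at 1 by (field; exact Hn).
    ring. }
eapply Rle_trans; [apply Cmod_triangle |].
assert (0 < zabs k * sqrt (zabs k))%R.
{ destruct Hk; apply Rmult_lt_0_compat; [| apply sqrt_lt_R0]; lra. }
replace ((L + 10) / (zabs k * sqrt (zabs k)))%R
  with ((L + 10) / (2 * (zabs k * sqrt (zabs k))) + (L + 10) / (2 * (zabs k * sqrt (zabs k))))%R
  by (field; destruct Hk; split; [apply Rgt_not_eq, sqrt_lt_R0 |]; lra).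
lra.
Qed.

Lemma inv_root_pair_factor (k : Z) (t : C) : large L k -> large L (- k) -> (zabs k <= INR m)%R ->
  (Cmod ((1 - t * inv_root m lam k) * (1 - t * inv_root m lam (- k)) - 1)
   <= (Cmod t * (L + 10) + Cmod t * Cmod t) / (zabs k * sqrt (zabs k)))%R.
Proof.
intros Hk Hk' Hm.
pose proof (inv_root_pair k Hk Hk' Hm) as H1.
pose proof (inv_root_bound k Hk Hm) as H2.
pose proof (inv_root_bound (- k) Hk' ltac:(rewrite zabs_opp; exact Hm)) as H3.
rewrite zabs_opp in H3.
set (a := inv_root m lam k) in *; set (b := inv_root m lam (- k)) in *.
replace ((1 - t * a) * (1 - t * b) - 1) with (t * t * (a * b) - t * (a + b)) by ring.
eapply Rle_trans; [apply Cmod_minus_le |]; rewrite !Cmod_mult.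
destruct Hk as [Hk _].
assert (Hs : (0 < sqrt (zabs k))%R) by (apply sqrt_lt_R0; lra).
assert (Hs1 : (sqrt (zabs k) <= zabs k)%R).
{ pose proof (sqrt_sqrt (zabs k) ltac:(lra)) as E.
  assert (1 <= sqrt (zabs k))%R by (rewrite <- sqrt_1; apply sqrt_le_1; lra). nra. }
assert (Hab : (Cmod a * Cmod b <= / (zabs k * sqrt (zabs k)))%R).
{ apply Rle_trans with (/ zabs k * / zabs k)%R.
  - apply Rmult_le_compat; try apply Cmod_ge_0; assumption.
  - rewrite <- Rinv_mult; apply Rinv_le_contravar; nra. }
pose proof (Cmod_ge_0 t) as Ht.
assert (E1 : (Cmod t * Cmod t * (Cmod a * Cmod b)
   <= Cmod t * Cmod t * / (zabs k * sqrt (zabs k)))%R)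
  by (apply Rmult_le_compat_l; [apply Rmult_le_pos; assumption | exact Hab]).
assert (E2 : (Cmod t * Cmod (a + b) <= Cmod t * ((L + 10) / (zabs k * sqrt (zabs k))))%R)
  by (apply Rmult_le_compat_l; lra).
unfold Rdiv in *; lra.
Qed.

End Roots.

(** * Passage to the limit *)

Lemma Ccvg_Cexp (u : nat -> C) (a : C) : Ccvg u a -> Ccvg (fun n => Cexp (u n)) (Cexp a).
Proof.
intros Hu.
apply Ccvg_le with (fun n => Cmod (Cexp a) * (2 * exp 1) * Cmod (u n - a))%R.
- apply is_lim_seq_spec in Hu.
  generalize (Hu (mkposreal 1 Rlt_0_1)); apply filter_imp; intros n Hn; simpl in Hn.
  rewrite Rminus_0_r, Rabs_pos_eq in Hn by apply Cmod_ge_0.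
  replace (Cexp (u n) - Cexp a) with (Cexp a * (Cexp (u n - a) - 1)).
  2:{ replace (u n) with (a + (u n - a)) at 2 by ring; rewrite Cexp_plus; ring. }
  rewrite Cmod_mult, Rmult_assoc; apply Rmult_le_compat_l; [apply Cmod_ge_0 |].
  eapply Rle_trans; [apply Cexp_minus_1_bound |].
  assert (exp (Cmod (u n - a)) <= exp 1)%R by (apply exp_le; lra).
  pose proof (Cmod_ge_0 (u n - a)); nra.
- now apply is_lim_seq_scal_0.
Qed.

Lemma eventually_INR_ge (M : R) : eventually (fun m => M <= INR m)%R.
Proof.
pose proof is_lim_seq_INR as H; apply is_lim_seq_spec in H.
generalize (H M); apply filter_imp; intros; lra.
Qed.

Lemma zabs_of_abs (k : Z) (m : nat) : (Z.abs k <= Z.of_nat m)%Z -> (zabs k <= INR m)%R.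
Proof. intros H; unfold zabs; rewrite <- abs_IZR, INR_IZR_INZ; now apply IZR_le. Qed.

Lemma Ccvg_inv_deg : Ccvg (fun m => / (2 * RtoC (INR (deg m)))) 0.
Proof.
apply Ccvg_ext with (fun m => (1 + / 2 / RtoC (INR (deg m))) - 1).
- intros m; field; apply INR_deg_nz.
- apply Ccvg_eq with (1 - 1); [ring |].
  apply Ccvg_minus; [apply inv_deg_cvg | apply Ccvg_const].
Qed.

(** [W_k] is the fixed point for the identity in the same disc, so the stability of
    fixed points applies. *)
Lemma inv_root_cvg (x : C) (L : R) (lams : nat -> C) (k : Z) :
  x <> 0 -> Ccvg lams (Clog x) -> (Cmod (Clog x) <= L)%R ->
  eventually (fun m => Cmod (lams m) <= L)%R -> large L k ->
  Ccvg (fun m => inv_root m (lams m) k) (/ LambertW k x).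
Proof.
intros Hx Hl HL Hls Hk.
assert (Hk4 : (4 <= zabs k)%R) by apply Hk.
assert (Hk0 := large_nz _ _ Hk).
assert (Hk1 : k <> (-1)%Z).
{ intros ->; unfold zabs in Hk4; rewrite Rabs_left in Hk4; lra. }
assert (Hid := tame_id k Hk0).
destruct (branch_point_exists (fun s => s) (Clog x) k Hid) as [w Hw].
{ destruct Hk; split; lra. }
assert (Hwn : w <> 0).
{ apply Cmod_gt_0; destruct Hw as [Hw _]; apply (proj1 Hid) in Hw; lra. }
rewrite (LambertW_intro k x w Hx Hk0 Hk1 Hwn (proj2 Hw)).
assert (He : Ccvg (fun m => euler_branch m (lams m) k) w).
{ apply Ccvg_le with (fun m => 6 * Cmod (lams m - Clog x)
      + 7 * Cmod (euler_map (INR (deg m)) w - w))%R.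
  - generalize (filter_and _ _ Hls (eventually_INR_ge (zabs k))).
    apply filter_imp; intros m [Hm1 Hm2].
    destruct (euler_branch_spec L m (lams m) Hm1 k Hk Hm2) as [s [Hs ->]].
    assert (Ht := tame_euler_deg m k Hk0 Hm2).
    pose proof (branch_point_stable _ _ _ _ _ _ _ Ht Hid Hk4 Hs Hw) as H1; cbv beta in H1.
    pose proof (proj2 (proj2 Ht) s w (proj1 Hs) (proj1 Hw)) as H2.
    replace (euler_map (INR (deg m)) s - w)
      with ((euler_map (INR (deg m)) s - euler_map (INR (deg m)) w)
            + (euler_map (INR (deg m)) w - w)) by ring.
    eapply Rle_trans; [apply Cmod_triangle |]; lra.
  - replace (Finite 0) with (Finite (6 * 0 + 7 * 0)) by (f_equal; ring).
    apply is_lim_seq_plus'; apply is_lim_seq_mult'; try apply is_lim_seq_const;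
      [exact Hl | apply euler_map_cvg, deg_lim]. }
unfold inv_root; apply Ccvg_eq with (/ w - 0); [ring |].
apply Ccvg_minus; [now apply Ccvg_inv | apply Ccvg_inv_deg].
Qed.

Lemma inv_root_tail_bound (L : R) (m K j : nat) (lam t : C) :
  (0 <= L)%R -> (Cmod lam <= L)%R -> (1 <= K)%nat -> (K + j <= m)%nat ->
  (forall k, (Z.of_nat K < Z.abs k)%Z -> large L k) ->
  (Cmod (lin_prod (pair_list (inv_root m lam) K j) t - 1)
   <= exp (2 * (Cmod t * (L + 10) + Cmod t * Cmod t) / sqrt (INR K)) - 1)%R.
Proof.
intros HL Hlam HK Hm Hlarge.
pose proof (Cmod_ge_0 t).
apply tail_product_bound; [exact HK | nra |].
intros k Hk.
assert (E : zabs (Z.of_nat k) = INR k).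
{ unfold zabs; rewrite <- INR_IZR_INZ; apply Rabs_pos_eq, pos_INR. }
rewrite <- E; apply inv_root_pair_factor with (L := L).
- exact Hlam.
- apply Hlarge; lia.
- apply Hlarge; lia.
- rewrite E; apply le_INR; lia.
Qed.

(** The heart of the argument.  The approximant is [E * q * tail], where [tail]
    runs over the located roots of index [|k| > K], [E] is an explicit factor and
    [q] has a fixed degree.  The tail beyond any [K + j] is uniformly close to [1],
    so [q] tends to zero at the limits of the remaining roots; having a fixed
    degree, [q] converges to the product over these.  The approximant is then
    close to the partial product of index [K + j], uniformly as [j] grows. *)
Lemma product_limit (x : C) (L : R) (K : nat) (lams : nat -> C)
  (E : nat -> C -> C) (Einf : C -> C) (l : list C) :
  x <> 0 -> Ccvg lams (Clog x) -> (Cmod (Clog x) <= L)%R ->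
  eventually (fun m => Cmod (lams m) <= L)%R -> (1 <= K)%nat ->
  (forall k, (Z.of_nat K < Z.abs k)%Z -> large L k) ->
  NoDup l ->
  (forall a, In a l -> a <> 0 /\ target x (/ a) = 0 /\ Einf (/ a) <> 0 /\
     forall k, (Z.of_nat K < Z.abs k)%Z -> / LambertW k x <> a) ->
  (forall t, Ccvg (fun m => E m t) (Einf t)) -> (forall m, E m 0 = 1) ->
  eventually (fun m => exists q, poly (length l) q /\ forall t,
     approx m (Cexp (lams m)) t
     = E m t * (q t * lin_prod (pair_list (inv_root m (lams m)) K (m - K)) t)) ->
  (forall t, Cprod_sym (fun k => 1 - t * / LambertW k x) K = Einf t * lin_prod l t) ->
  forall t, Ccvg (Cprod_sym (fun k => 1 - t * / LambertW k x)) (target x t).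
Proof.
intros Hx Hlam HL Hls HK Hlarge Hl Hroots HE HE0 Hfact Hpart.
assert (HL0 : (0 <= L)%R) by (pose proof (Cmod_ge_0 (Clog x)); lra).
set (b := fun m => inv_root m (lams m)).
set (c := fun k => / LambertW k x).
set (eps := fun (t : C) j =>
  (exp (2 * (Cmod t * (L + 10) + Cmod t * Cmod t) / sqrt (INR (K + j))) - 1)%R).
assert (Hb : forall k, (Z.of_nat K < Z.abs k)%Z -> Ccvg (fun m => b m k) (c k)).
{ intros k Hk; apply inv_root_cvg with L; auto. }
assert (HP : forall t, Ccvg (fun m => approx m (Cexp (lams m)) t) (target x t)).
{ intros t; apply approx_cvg; [exact Hx |].
  apply Ccvg_eq with (Cexp (Clog x)); [now apply Cexp_Clog | now apply Ccvg_Cexp]. }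
set (prop := fun m (q : C -> C) => poly (length l) q /\ forall t,
     approx m (Cexp (lams m)) t = E m t * (q t * lin_prod (pair_list (b m) K (m - K)) t)).
set (Q := fun m => epsilon (inhabits (fun _ : C => RtoC 0)) (prop m)).
assert (HQ : eventually (fun m => prop m (Q m))).
{ revert Hfact; apply filter_imp; intros m Hm; apply epsilon_spec; exact Hm. }
assert (Hsplit : forall j, eventually (fun m => forall t,
   approx m (Cexp (lams m)) t
   = E m t * (Q m t * lin_prod (pair_list (b m) K j) t)
     * lin_prod (pair_list (b m) (K + j) (m - (K + j))) t /\
   (Cmod (lin_prod (pair_list (b m) (K + j) (m - (K + j))) t - 1) <= eps t j)%R)).
{ intros j.
  assert (Hge : eventually (fun m => (K + j <= m)%nat)) by (exists (K + j)%nat; auto).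
  generalize (filter_and _ _ HQ (filter_and _ _ Hge Hls)).
  apply filter_imp; intros m [[_ Hm] [Hmj HmL]] t; split.
  - rewrite Hm; replace (m - K)%nat with (j + (m - (K + j)))%nat by lia.
    rewrite pair_list_app, lin_prod_app; ring.
  - apply inv_root_tail_bound; try assumption; try lia.
    intros k Hk; apply Hlarge; lia. }
assert (Hmid : forall t j,
  Ccvg (fun m => lin_prod (pair_list (b m) K j) t) (lin_prod (pair_list c K j) t))
  by (intros; now apply Ccvg_pair_list).
assert (Heps : forall t, is_lim_seq (eps t) 0) by (intros; apply tail_bound_cvg).
(* at a root [/ a] of the limit, [j] is taken such that the tail beyond [K + j] has
   modulus at least [1/2] *)
assert (HQt : forall t, Ccvg (fun m => Q m t) (lin_prod l t)).
{ intros t; apply poly_cvg_lin_prod.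
  - revert HQ; apply filter_imp; intros m Hm; apply Hm.
  - exact Hl.
  - intros a Ha; destruct (Hroots a Ha) as [Ha0 [Hroot [HEa Hdist]]]; split; [exact Ha0 |].
    assert (Hj : exists j, (eps (/ a)%C j < 1 / 2)%R).
    { pose proof (Heps (/ a)) as H; apply is_lim_seq_spec in H.
      destruct (H (mkposreal (1 / 2) ltac:(lra))) as [j Hj]; exists j.
      specialize (Hj j (le_n j)); simpl in Hj.
      rewrite Rminus_0_r in Hj; eapply Rle_lt_trans; [apply Rle_abs | exact Hj]. }
    destruct Hj as [j Hj].
    set (G := fun m => E m (/ a) * lin_prod (pair_list (b m) K j) (/ a)).
    assert (HG : Ccvg G (Einf (/ a) * lin_prod (pair_list c K j) (/ a)))
      by (apply Ccvg_mult; [apply HE | apply Hmid]).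
    assert (HG0 : Einf (/ a) * lin_prod (pair_list c K j) (/ a) <> 0).
    { apply Cmult_neq_0; [exact HEa |].
      apply lin_prod_nz; [now apply Cinv_nz |].
      rewrite Cinv_inv by exact Ha0; intros Hin.
      apply in_pair_list in Hin as [k [Hk Ek]]; apply (Hdist k); [lia | now symmetry]. }
    assert (HQG : Ccvg (fun m => Q m (/ a) * G m) 0).
    { pose proof (HP (/ a)) as H; rewrite Hroot in H; apply Ccvg_0_Cmod in H.
      apply Ccvg_le with (fun m => 2 * Cmod (approx m (Cexp (lams m)) (/ a)))%R.
      - generalize (Hsplit j); apply filter_imp; intros m Hm.
        destruct (Hm (/ a)) as [E1 E2]; rewrite E1.
        set (tl := lin_prod (pair_list (b m) (K + j) (m - (K + j))) (/ a)) in *.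
        unfold G; set (md := lin_prod (pair_list (b m) K j) (/ a)).
        replace (E m (/ a) * (Q m (/ a) * md)) with (Q m (/ a) * (E m (/ a) * md)) by ring.
        replace (Q m (/ a) * (E m (/ a) * md) - 0) with (Q m (/ a) * (E m (/ a) * md)) by ring.
        set (v := Q m (/ a) * (E m (/ a) * md)).
        rewrite Cmod_mult.
        pose proof (Cmod_minus_ge 1 tl) as H1; rewrite Cmod_1, Cmod_minus_sym in H1.
        pose proof (Cmod_ge_0 v); nra.
      - now apply is_lim_seq_scal_0. }
    apply Ccvg_ext_loc with (fun m => Q m (/ a) * G m * / G m).
    + assert (HGl : (0 < Cmod (Einf (/ a)%C * lin_prod (pair_list c K j) (/ a)%C))%R)
        by now apply Cmod_gt_0.
      generalize (Ccvg_Cmod_lower _ _ 0 HGl HG).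
      apply filter_imp; intros m Hm; apply Cmod_gt_0 in Hm; field; exact Hm.
    + apply Ccvg_eq with (0 * / (Einf (/ a) * lin_prod (pair_list c K j) (/ a))); [ring |].
      apply Ccvg_mult; [exact HQG | now apply Ccvg_inv].
  - apply Ccvg_ext_loc with (fun _ => 1); [| apply Ccvg_const].
    revert HQ; apply filter_imp; intros m [_ Hm].
    specialize (Hm 0); rewrite approx_0, HE0, lin_prod_0 in Hm.
    rewrite Hm; ring. }
intros t.
set (A := fun j => Einf t * (lin_prod l t * lin_prod (pair_list c K j) t)).
assert (HA : forall j, Cprod_sym (fun k => 1 - t * / LambertW k x) (K + j) = A j).
{ intros j; unfold A.
  rewrite (Cprod_sym_pair_list (fun k => / LambertW k x)), Hpart; unfold c; ring. }
assert (Hdiff : forall j, (Cmod (target x t - A j) <= Cmod (A j) * eps t j)%R).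
{ intros j.
  assert (HR : Ccvg (fun m => E m t * (Q m t * lin_prod (pair_list (b m) K j) t)) (A j)).
  { apply Ccvg_mult; [apply HE |]; apply Ccvg_mult; [apply HQt | apply Hmid]. }
  apply (is_lim_seq_le_loc
    (fun m => Cmod (approx m (Cexp (lams m)) t - E m t * (Q m t * lin_prod (pair_list (b m) K j) t)))
    (fun m => Cmod (E m t * (Q m t * lin_prod (pair_list (b m) K j) t)) * eps t j)%R
    (Cmod (target x t - A j)) (Cmod (A j) * eps t j)%R).
  - generalize (Hsplit j); apply filter_imp; intros m Hm.
    destruct (Hm t) as [E1 E2]; rewrite E1.
    set (v := E m t * (Q m t * lin_prod (pair_list (b m) K j) t)).
    set (tl := lin_prod (pair_list (b m) (K + j) (m - (K + j))) t) in *.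
    replace (v * tl - v) with (v * (tl - 1)) by ring; rewrite Cmod_mult.
    apply Rmult_le_compat_l; [apply Cmod_ge_0 | exact E2].
  - apply Ccvg_Cmod_lim, Ccvg_minus; [apply HP | exact HR].
  - apply is_lim_seq_mult'; [now apply Ccvg_Cmod_lim | apply is_lim_seq_const]. }
assert (HAlim : Ccvg A (target x t)).
{ apply Ccvg_le with (fun j => 2 * Cmod (target x t) * eps t j)%R.
  - pose proof (Heps t) as H; apply is_lim_seq_spec in H.
    generalize (H (mkposreal (1 / 2) ltac:(lra))); apply filter_imp; intros j Hj; simpl in Hj.
    rewrite Rminus_0_r in Hj; apply Rabs_lt_between in Hj.
    specialize (Hdiff j).
    pose proof (Cmod_minus_ge (A j) (target x t)) as H1.
    rewrite (Cmod_minus_sym (A j)) in H1.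
    rewrite (Cmod_minus_sym (A j)).
    pose proof (Cmod_ge_0 (A j)); pose proof (Cmod_ge_0 (target x t)).
    assert (0 <= eps t j)%R.
    { pose proof (Cmod_ge_0 (target x t - A j)).
      unfold eps; apply Rle_trans with (exp 0 - 1)%R; [rewrite exp_0; lra |].
      apply Rplus_le_compat_r, exp_le.
      assert (1 <= INR (K + j))%R by (apply (le_INR 1); lia).
      pose proof (Cmod_ge_0 t).
      apply Rdiv_le_0_compat; [nra | apply sqrt_lt_R0; lra]. }
    assert (Cmod (A j) <= 2 * Cmod (target x t))%R by nra.
    nra.
  - apply is_lim_seq_scal_0, Heps. }
apply (is_lim_seq_incr_n _ K).
apply is_lim_seq_ext with (fun j => Cmod (A j - target x t)); [| exact HAlim].
intros j; rewrite <- HA; now rewrite Nat.add_comm.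
Qed.

Lemma LambertW_inv_inj (x : C) (j k : Z) : x <> 0 ->
  / LambertW j x = / LambertW k x -> LambertW j x = LambertW k x.
Proof.
intros Hx E; rewrite <- (Cinv_inv (LambertW j x)), <- (Cinv_inv (LambertW k x))
  by now apply LambertW_nz.
now rewrite E.
Qed.

Lemma pair_list_inv_root_factor (L : R) (K m d : nat) (lam : C) (p : C -> C) :
  (Cmod lam <= L)%R -> (forall k, (Z.of_nat K < Z.abs k)%Z -> large L k) -> (K <= m)%nat ->
  (Cmod (Cexp lam) < 2 * INR (deg m))%R ->
  poly (2 * (m - K) + d) p ->
  (forall k, (Z.of_nat K < Z.abs k <= Z.of_nat m)%Z -> p (/ inv_root m lam k) = 0) ->
  exists q, poly d q /\
    forall t, p t = q t * lin_prod (pair_list (inv_root m lam) K (m - K)) t.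
Proof.
intros Hlam Hlarge HKm Hx Hp Hroot.
apply poly_factor.
- rewrite pair_list_length; exact Hp.
- apply NoDup_pair_list; intros i k Hi Hk E.
  apply (inv_root_inj L m lam Hlam i k); try (apply Hlarge; lia);
    try (apply zabs_of_abs; lia); exact E.
- intros a Ha; apply in_pair_list in Ha as [k [Hk ->]]; split.
  + apply inv_root_nz with L; [exact Hlam | apply Hlarge; lia | apply zabs_of_abs; lia | exact Hx].
  + apply Hroot; lia.
Qed.

Lemma lambert_product_simple (x t : C) : x <> 0 -> x <> branching_value ->
  Ccvg (Cprod_sym (fun k => 1 - t * / LambertW k x)) (target x t).
Proof.
intros Hx Hbv.
set (L := Cmod (Clog x)).
destruct (large_eventually L) as [K0 HK0].
set (K := S K0).
assert (Hlarge : forall k, (Z.of_nat K < Z.abs k)%Z -> large L k)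
  by (intros k Hk; apply HK0; lia).
assert (Hinj : forall j k, / LambertW j x = / LambertW k x -> j = k).
{ intros j k E; apply LambertW_inv_inj in E; [| exact Hx].
  destruct (Z.eq_dec j k) as [H | H]; [exact H |].
  destruct (LambertW_collision x j k Hx E H); contradiction. }
set (c := fun k => / LambertW k x).
set (l := c 0%Z :: pair_list c 0 K).
assert (Hin : forall a, In a l -> exists k, (Z.abs k <= Z.of_nat K)%Z /\ a = c k).
{ intros a [<- | Ha]; [exists 0%Z; split; [lia | reflexivity] |].
  apply in_pair_list in Ha as [k [Hk ->]]; exists k; split; [lia | reflexivity]. }
apply product_limit with (L := L) (K := K) (lams := fun _ => Clog x)
  (E := fun _ _ => 1) (Einf := fun _ => 1) (l := l).
- exact Hx.
- apply Ccvg_const.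
- apply Rle_refl.
- apply filter_forall; intros _; apply Rle_refl.
- unfold K; lia.
- exact Hlarge.
- constructor.
  + intros Ha; apply in_pair_list in Ha as [k [Hk E]]; apply Hinj in E; subst; lia.
  + apply NoDup_pair_list; intros; now apply Hinj.
- intros a Ha; destruct (Hin a Ha) as [k [Hk ->]]; unfold c; repeat split.
  + now apply Cinv_nz, LambertW_nz.
  + rewrite Cinv_inv by now apply LambertW_nz.
    apply target_root; [exact Hx | now apply LambertW_eq].
  + exact C1_nz.
  + intros j Hj E; apply Hinj in E; lia.
- intros; apply Ccvg_const.
- reflexivity.
- assert (Hge : eventually (fun m => (K <= m)%nat)) by (exists K; auto).
  generalize (filter_and _ _ Hge (eventually_INR_ge (Cmod x))); apply filter_imp.
  intros m [HKm Hm].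
  assert (Hxm : (Cmod (Cexp (Clog x)) < 2 * INR (deg m))%R).
  { rewrite Cexp_Clog, INR_deg by exact Hx; pose proof (pos_INR m); lra. }
  destruct (pair_list_inv_root_factor L K m (length l) (Clog x) (approx m (Cexp (Clog x))))
    as [q [Hq Eq]]; try assumption.
  + apply Rle_refl.
  + replace (2 * (m - K) + length l)%nat with (deg m).
    * apply poly_approx.
    * unfold l; simpl length; rewrite pair_list_length; unfold deg; lia.
  + intros k Hk; apply approx_inv_root with L; try assumption.
    * apply Rle_refl.
    * apply Hlarge; lia.
    * apply zabs_of_abs; lia.
  + exists q; split; [exact Hq |]; intros s; rewrite Eq; ring.
- intros s; change (Cprod_sym (fun k => 1 - s * c k) (0 + K) = 1 * lin_prod l s).
  rewrite Cprod_sym_pair_list; unfold l; simpl; ring.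
Qed.

(** * The double root at the branching value *)

(** The opposite of the parameter for which the approximant has an exact double root;
    it tends to [1/e]. *)
Definition double_param (m : nat) : R := ((1 - / INR (deg m)) ^ (2 * m))%R.

Lemma double_base_pos (m : nat) : (0 < m)%nat -> (0 < 1 - / INR (deg m))%R.
Proof.
intros Hm; assert (H : (1 <= INR m)%R) by (apply (le_INR 1); lia).
rewrite INR_deg.
assert (/ (2 * INR m + 1) < 1)%R; [| lra].
rewrite <- Rinv_1; apply Rinv_lt_contravar; lra.
Qed.

Lemma double_param_pos (m : nat) : (0 < double_param m)%R.
Proof.
destruct m as [|m]; [unfold double_param; simpl; lra |].
apply pow_lt, double_base_pos; lia.
Qed.

Lemma double_param_lim : is_lim_seq double_param (exp (-1)).
Proof.
assert (H : Ccvg (fun m => RtoC (double_param m)) (RtoC (exp (-1)))).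
{ rewrite <- Cexp_R.
  apply Ccvg_ext with (fun m => (1 + RtoC (-1) / RtoC (INR (deg m))) ^ (2 * m));
    [| apply pow_2m_cvg].
  intros m; unfold double_param; rewrite RtoC_pow; f_equal.
  pose proof (INR_deg_pos m).
  rewrite RtoC_minus, RtoC_inv by lra; unfold Cdiv; ring. }
apply is_lim_seq_ext with (fun m => (double_param m - exp (-1)) + exp (-1))%R; [intros; ring |].
replace (Finite (exp (-1))) with (Finite (0 + exp (-1))) by (f_equal; ring).
apply is_lim_seq_plus'; [| apply is_lim_seq_const].
apply is_lim_seq_abs_0.
apply is_lim_seq_ext with (fun m => Cmod (RtoC (double_param m) - RtoC (exp (-1)))); [| exact H].
intros m; now rewrite <- RtoC_minus, Cmod_R.
Qed.

Definition double_lam (m : nat) : C := (ln (double_param m), PI)%R.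

Lemma Cexp_double_lam (m : nat) : Cexp (double_lam m) = RtoC (- double_param m).
Proof.
unfold Cexp, double_lam; simpl; rewrite exp_ln, cos_PI, sin_PI by apply double_param_pos.
C_ext.
Qed.

Lemma Clog_branching_value : Clog branching_value = (-1, PI)%R.
Proof.
unfold branching_value; rewrite <- exp_m1.
pose proof (exp_pos (-1)).
rewrite Clog_neg_real, Ropp_involutive, ln_exp by lra; reflexivity.
Qed.

Lemma double_lam_cvg : Ccvg double_lam (Clog branching_value).
Proof.
rewrite Clog_branching_value.
apply Ccvg_le with (fun m => Rabs (ln (double_param m) - -1)).
- apply filter_forall; intros m.
  eapply Rle_trans; [apply Cmod_le_sum |].
  unfold double_lam, Re, Im; simpl; right.
  rewrite Rplus_opp_r, Rabs_R0, Rplus_0_r; reflexivity.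
- replace (Finite 0) with (Finite (Rabs (-1 - -1))) by (f_equal; rewrite Rminus_diag; apply Rabs_R0).
  apply (is_lim_seq_abs _ (Finite _)), is_lim_seq_minus'; [| apply is_lim_seq_const].
  rewrite <- (ln_exp (-1)).
  apply (is_lim_seq_continuous ln); [| exact double_param_lim].
  apply derivable_continuous_pt; eexists; apply derivable_pt_lim_ln, exp_pos.
Qed.

(** The inverse of the double root. *)
Definition double_inv (m : nat) : C := RtoC (- (1 - / (2 * INR (deg m)))).

Lemma double_inv_nz (m : nat) : double_inv m <> 0.
Proof.
intros E; apply RtoC_inj in E; pose proof (INR_deg_pos m).
assert (/ (2 * INR (deg m)) < 1)%R; [| lra].
rewrite <- Rinv_1; apply Rinv_lt_contravar; lra.
Qed.

(** At [w = -2n/(2n-1)] one has [1 - w/(2n) = - w], and with this parameter the two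
    terms of the approximant cancel at [w]; so do those of its derivative. *)
Lemma approx_double_root (m : nat) : (0 < m)%nat ->
  exists q, poly (2 * m - 1) q /\ forall t,
    approx m (RtoC (- double_param m)) t
    = (1 - t * double_inv m) * (1 - t * double_inv m) * q t.
Proof.
intros Hm.
pose proof (double_inv_nz m) as Hd.
set (w := / double_inv m).
assert (Hw : w <> 0) by now apply Cinv_nz.
set (n := RtoC (INR (deg m))).
assert (Hn : n <> 0) by apply INR_deg_nz.
pose proof C2_nz as H2.
set (x := RtoC (- double_param m)).
assert (Hx : x <> 0).
{ intros E; apply RtoC_inj in E; pose proof (double_param_pos m); lra. }
assert (En : n = 2 * RtoC (INR m) + 1).
{ unfold n; rewrite INR_deg, RtoC_plus, RtoC_mult; reflexivity. }
assert (Hn1 : n - 1 <> 0).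
{ unfold n; rewrite <- RtoC_minus; intros E; apply RtoC_inj in E.
  rewrite INR_deg in E; assert (1 <= INR m)%R by (apply (le_INR 1); lia); lra. }
assert (Hn2 : 2 * n - 1 <> 0).
{ unfold n; rewrite <- RtoC_mult, <- RtoC_minus; intros E; apply RtoC_inj in E.
  pose proof (INR_deg_pos m); lra. }
assert (Ew : w = - (2 * n) / (2 * n - 1)).
{ unfold w, double_inv.
  rewrite RtoC_opp, RtoC_minus, RtoC_inv, RtoC_mult by (pose proof (INR_deg_pos m); lra).
  fold n; field; repeat split; assumption. }
assert (Ex : x = - ((n - 1) / n) ^ (2 * m)).
{ unfold x, double_param; rewrite RtoC_opp, RtoC_pow, RtoC_minus, RtoC_inv
    by (pose proof (INR_deg_pos m); lra).
  fold n; do 2 f_equal; field; exact Hn. }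
set (A := 1 + - / (2 * n) * w).
set (B := 1 + / (2 * n) * w).
assert (EA : A = 2 * n / (2 * n - 1)) by (unfold A; rewrite Ew; field; split; assumption).
assert (EB : B = A * ((n - 1) / n)) by (rewrite EA; unfold B; rewrite Ew; field; split; assumption).
assert (HA : A <> 0).
{ rewrite EA; apply Cmult_neq_0; [now apply Cmult_neq_0 | now apply Cinv_nz]. }
assert (EwA : w = - A) by (rewrite Ew, EA; field; assumption).
assert (EBx : / x * B ^ (2 * m) = - A ^ (2 * m)).
{ rewrite EB, Cpow_mult_l, Ex.
  assert (H : ((n - 1) / n) ^ (2 * m) <> 0)
    by (apply Cpow_nz, Cmult_neq_0; [exact Hn1 | now apply Cinv_nz]).
  field; exact H. }
remember (2 * m - 1)%nat as k eqn:Ek.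
assert (E2m : (2 * m)%nat = S k) by lia.
rewrite E2m in Ex, EBx.
destruct (lin_pow_expansion 1 (- / (2 * n)) w (S k)) as [q1 [Hq1 [E1 Ev1]]].
destruct (lin_pow_expansion 1 (/ (2 * n)) w k) as [q2 [Hq2 [E2 Ev2]]].
fold A in E1, Ev1; fold B in E2, Ev2.
set (q := fun t => q1 t + (- / x) * ((1 + / (2 * n) * t) ^ S k + w * q2 t)).
assert (Hq : poly (S k) q).
{ apply poly_add; [exact Hq1 |].
  apply poly_scal, poly_add; [apply poly_lin_pow | now apply poly_S, poly_scal]. }
assert (Eq : forall t, approx m x t = (t - w) * q t).
{ intros t; unfold approx, q; fold n; unfold deg.
  rewrite E2m.
  rewrite E1, !E2.
  rewrite (Cpow_S A).
  transitivity (A * A ^ S k + w * (- (/ x * B ^ S k))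
     + (t - w) * (q1 t + - / x * (B ^ S k + (t - w) * q2 t + w * q2 t))).
  - generalize (A ^ S k) (B ^ S k); intros; ring.
  - rewrite EBx, EwA; generalize (A ^ S k); intros; ring. }
assert (Eqw : q w = 0).
{ unfold q; fold B; rewrite Ev1, Ev2.
  transitivity (RtoC (INR (S (S k))) * - / (2 * n) * A ^ S k
     + - (/ x * B ^ S k)
     + w * (RtoC (INR (S k)) * / (2 * n)) * - (/ x * B ^ S k) * / B).
  - rewrite (Cpow_S B); field.
    repeat split; try assumption.
    rewrite EB; apply Cmult_neq_0; [exact HA |].
    apply Cmult_neq_0; [exact Hn1 | now apply Cinv_nz].
  - rewrite EBx.
    replace (RtoC (INR (S (S k)))) with n
      by (unfold n, deg; now rewrite E2m).
    replace (RtoC (INR (S k))) with (n - 1).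
    2:{ unfold n; rewrite <- RtoC_minus; f_equal; unfold deg.
        rewrite E2m, (S_INR (S k)); ring. }
    rewrite EB, EwA; field; repeat split; assumption. }
destruct (poly_factor_double k (approx m x) q w Hw Hq Eqw Eq) as [q' [Hq' Eq']].
exists q'; split; [exact Hq' |]; intros t; rewrite Eq'.
unfold w; rewrite <- (Cinv_inv (double_inv m)) at 3 4 by exact Hd; reflexivity.
Qed.

Lemma double_inv_cvg : Ccvg double_inv (RtoC (-1)).
Proof.
apply Ccvg_ext with (fun m => / (2 * RtoC (INR (deg m))) - 1).
- intros m; unfold double_inv; pose proof (INR_deg_pos m).
  rewrite RtoC_opp, RtoC_minus, RtoC_inv, RtoC_mult by lra; ring.
- apply Ccvg_eq with (0 - 1).
  + apply injective_projections; simpl; ring.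
  + apply Ccvg_minus; [apply Ccvg_inv_deg | apply Ccvg_const].
Qed.

Lemma Cmod_double_inv (m : nat) : (1 / 2 <= Cmod (double_inv m))%R.
Proof.
unfold double_inv; rewrite Cmod_R, Rabs_Ropp; pose proof (INR_deg_pos m).
assert (/ (2 * INR (deg m)) <= / (2 * 1))%R by (apply Rinv_le_contravar; lra).
rewrite Rabs_pos_eq; lra.
Qed.

Lemma lambert_product_branching (t : C) :
  Ccvg (Cprod_sym (fun k => 1 - t * / LambertW k branching_value)) (target branching_value t).
Proof.
set (x := branching_value).
assert (Hx : x <> 0).
{ intros E; apply RtoC_inj in E.
  assert (0 < 1 / exp 1)%R by (apply Rdiv_lt_0_compat; [lra | apply exp_pos]); lra. }
set (L := (Cmod (Clog x) + 1)%R).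
assert (HLev : eventually (fun m => Cmod (double_lam m) <= L)%R).
{ pose proof double_lam_cvg as H; apply is_lim_seq_spec in H.
  generalize (H (mkposreal 1 Rlt_0_1)); apply filter_imp; intros m Hm; simpl in Hm.
  rewrite Rminus_0_r, Rabs_pos_eq in Hm by apply Cmod_ge_0.
  pose proof (Cmod_minus_ge (double_lam m) (Clog branching_value)); unfold L, x; lra. }
destruct (large_eventually L) as [K0 HK0].
set (K := S (S K0)).
assert (Hlarge : forall k, (Z.of_nat K < Z.abs k)%Z -> large L k)
  by (intros k Hk; apply HK0; lia).
set (c := fun k => / LambertW k x).
assert (Hinj : forall j k, c j = c k -> k <> 0%Z -> k <> (-1)%Z -> j = k).
{ intros j k E H0 H1; apply LambertW_inv_inj in E; [| exact Hx].
  destruct (Z.eq_dec j k) as [H | H]; [exact H |].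
  destruct (LambertW_collision x j k Hx E H) as [_ [_ [|]]]; contradiction. }
assert (Hm1 : c 0%Z = RtoC (-1) /\ c (-1)%Z = RtoC (-1)).
{ assert (E : / RtoC (-1) = RtoC (-1)).
  { rewrite <- RtoC_inv by lra; f_equal; field. }
  unfold c, x; rewrite !LambertW_branching_value by tauto; split; exact E. }
destruct Hm1 as [Hc0 Hc1].
(* the indices [0] and [-1] give the factor [Einf], the others up to [K] the list *)
set (l := c 1%Z :: pair_list c 1 (K - 1)).
assert (Hin : forall a, In a l -> exists k,
  (Z.abs k <= Z.of_nat K)%Z /\ k <> 0%Z /\ k <> (-1)%Z /\ a = c k).
{ intros a [<- | Ha]; [exists 1%Z; repeat split; unfold K; lia |].
  apply in_pair_list in Ha as [k [Hk ->]]; exists k; repeat split; unfold K in *; lia. }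
apply product_limit with (L := L) (K := K) (lams := double_lam)
  (E := fun m s => (1 - s * double_inv m) * (1 - s * double_inv m))
  (Einf := fun s => (1 - s * RtoC (-1)) * (1 - s * RtoC (-1))) (l := l).
- exact Hx.
- exact double_lam_cvg.
- unfold L; lra.
- exact HLev.
- unfold K; lia.
- exact Hlarge.
- constructor.
  + intros Ha; apply in_pair_list in Ha as [k [Hk E]]; apply Hinj in E; lia.
  + apply NoDup_pair_list; intros i k Hi Hk E; apply Hinj; lia || exact E.
- intros a Ha; destruct (Hin a Ha) as [k [Hk [Hk0 [Hk1 ->]]]]; unfold c.
  assert (Hw : LambertW k x <> 0) by now apply LambertW_nz.
  rewrite Cinv_inv by exact Hw; split; [now apply Cinv_nz | split; [| split]].
  + apply target_root; [exact Hx | now apply LambertW_eq].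
  + assert (H : 1 - LambertW k x * RtoC (-1) <> 0).
    { apply lin_factor_nz; [exact Hw |]; rewrite <- Hc0; intros E.
      apply Hinj in E; lia. }
    now apply Cmult_neq_0.
  + intros j Hj E; apply Hinj in E; lia.
- intros s; apply Ccvg_mult; (apply Ccvg_minus; [apply Ccvg_const |];
    apply Ccvg_mult; [apply Ccvg_const | apply double_inv_cvg]).
- intros m; ring.
- assert (Hge : eventually (fun m => (K <= m)%nat)) by (exists K; auto).
  generalize (filter_and _ _ Hge HLev); apply filter_imp.
  intros m [HKm Hm].
  assert (Hxm : (Cmod (Cexp (double_lam m)) < 2 * INR (deg m))%R).
  { rewrite Cexp_double_lam, Cmod_R, Rabs_Ropp, Rabs_pos_eq
      by (left; apply double_param_pos).
    pose proof (INR_deg_pos m).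
    assert (0 < / INR (deg m) <= 1)%R.
    { split; [apply Rinv_0_lt_compat; lra |].
      rewrite <- Rinv_1; apply Rinv_le_contravar; lra. }
    assert (double_param m <= 1)%R.
    { unfold double_param; apply Rle_trans with (1 ^ (2 * m))%R;
        [apply pow_incr | rewrite pow1]; lra. }
    lra. }
  destruct (approx_double_root m) as [p [Hp Ep]]; [unfold K in HKm; lia |].
  rewrite <- Cexp_double_lam in Ep.
  destruct (pair_list_inv_root_factor L K m (length l) (double_lam m) p)
    as [q [Hq Eq]]; try assumption.
  + replace (2 * (m - K) + length l)%nat with (2 * m - 1)%nat; [exact Hp |].
    unfold l; simpl length; rewrite pair_list_length; unfold K in *; lia.
  + intros k Hk.
    assert (Hlk : large L k) by (apply Hlarge; lia).
    assert (Hkm : (zabs k <= INR m)%R) by (apply zabs_of_abs; lia).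
    pose proof (approx_inv_root L m (double_lam m) Hm k Hlk Hkm Hxm) as E.
    rewrite Ep in E.
    assert (Ha0 := inv_root_nz L m (double_lam m) Hm k Hlk Hkm Hxm).
    assert (Hf : 1 - / inv_root m (double_lam m) k * double_inv m <> 0).
    { apply lin_factor_nz; [now apply Cinv_nz |].
      rewrite Cinv_inv by exact Ha0; intros E1.
      pose proof (Cmod_double_inv m) as H1; rewrite E1 in H1.
      pose proof (inv_root_bound L m (double_lam m) Hm k Hlk Hkm) as H2.
      destruct Hlk as [H4 _].
      assert (/ zabs k <= / 4)%R by (apply Rinv_le_contravar; lra); lra. }
    revert E Hf; generalize (1 - / inv_root m (double_lam m) k * double_inv m).
    intros u E Hu.
    replace (p (/ inv_root m (double_lam m) k))
      with (u * u * p (/ inv_root m (double_lam m) k) / (u * u)) by (field; exact Hu).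
    rewrite E; field; exact Hu.
  + exists q; split; [exact Hq |]; intros s; rewrite Ep, Eq; reflexivity.
- intros s; change (Cprod_sym (fun k => 1 - s * c k) K
    = (1 - s * RtoC (-1)) * (1 - s * RtoC (-1)) * lin_prod l s).
  replace K with (1 + (K - 1))%nat at 1 by (unfold K; lia).
  rewrite Cprod_sym_pair_list; unfold l; simpl Cprod_sym.
  rewrite Hc0; change (- (1))%Z with (-1)%Z; rewrite Hc1; simpl lin_prod; ring.
Qed.

Theorem theorem2p2 (x t : C) (hx : x <> 0) :
  is_prod_Z (fun k : Z => 1 - t / LambertW k x)
            (Cexp (- t / 2) - t / x * Cexp (t / 2)).
Proof.
apply Ccvg_is_prod_Z.
change (Ccvg (Cprod_sym (fun k => 1 - t * / LambertW k x)) (target x t)).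
destruct (excluded_middle_informative (x = branching_value)) as [-> | Hbv].
- apply lambert_product_branching.
- now apply lambert_product_simple.
Qed.
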